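(* Let $(M,\mathcal{D},g)$ be a sub-Riemannian Engel structure with canonical frame $\{X_1,X_2,X_3,X_4\}$, and let $T_4$ be the $X_2$-component of $[X_2,X_3]$ in this frame. Then the (nonconstant) abnormal geodesics of the structure are, up to constant-speed reparametrization, integral curves of $X_2$. An abnormal geodesic is strictly abnormal if and only if $T_4\not\equiv 0$ along the geodesic.
   Context: A sub-Riemannian Engel structure $(M,\mathcal{D},g)$ is a smooth 4-dimensional manifold $M$ with a smooth rank-2 distribution $\mathcal{D}$ such that $[\mathcal{D},\mathcal{D}]$ has rank 3 and $[\mathcal{D},[\mathcal{D},\mathcal{D}]]$ has rank 4, together with a smooth positive-definite metric $g$ on $\mathcal{D}$. Canonical frame: a frame $\{X_1,X_2,X_3,X_4\}$ such that $X_1,X_2$ is a $g$-orthonormal frame of $\mathcal{D}$, $X_3=[X_1,X_2]$, $X_4=[X_1,X_3]$, and $[X_2,X_3]\in\mathrm{span}\{X_1,X_2,X_3\}$. It exists (locally, and can be chosen continuously along any curve) and is unique up to the sign changes $X_1\mapsto -X_1$, $X_2\mapsto -X_2$ (with induced changes of $X_3,X_4$); these change $T_4$ at most by a sign. An admissible curve is a Lipschitz curve $q$ on a compact interval with $\dot q=u_1X_1(q)+u_2X_2(q)$ for a.e. time, $u_1,u_2\in L^\infty$; its length is $\int\sqrt{u_1^2+u_2^2}\,dt$. A geodesic is an admissible curve of constant speed whose sufficiently small arcs are length minimizers (among admissible curves with the same endpoints). For $\lambda\in T^*M$ let $h_i(\lambda)=\langle\lambda,X_i\rangle$, and for $u=(u_1,u_2)\in\mathbb{R}^2$,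 $\nu\le0$ let $H_u(\lambda,\nu)=u_1h_1+u_2h_2+\frac{\nu}{2}(u_1^2+u_2^2)$. A curve $q$ with control $\tilde u$ satisfies the Pontryagin maximum principle (PMP) with a Lipschitz curve $\lambda(t)\in T^*_{q(t)}M$ (an extremal) and a number $\nu\le0$ if: (1) $(\lambda(t),\nu)\ne0$; (2) $\dot\lambda(t)=\vec H_{\tilde u(t)}(\lambda(t))$, where $\vec H$ is the Hamiltonian vector field on $T^*M$ with the canonical symplectic structure; (3) $H_{\tilde u(t)}(\lambda(t),\nu)=\max_{u\in\mathbb{R}^2}H_u(\lambda(t),\nu)$ (for a.e. $t$). The extremal is abnormal if the PMP holds with $\nu=0$, and normal if it holds with $\nu<0$. A geodesic is abnormal (normal) if it is the projection of an abnormal (normal) extremal; it is strictly abnormal if it is the projection of an abnormal extremal and is not the projection of any normal extremal. *)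

(* Defs.v *)
From HB Require Import structures.
From mathcomp Require Import all_boot all_order all_algebra.
From mathcomp Require Import all_classical all_reals all_analysis.

Set Implicit Arguments.
Unset Strict Implicit.
Unset Printing Implicit Defensive.

Import Order.TTheory GRing.Theory Num.Theory.
Import numFieldNormedType.Exports.

Local Open Scope classical_set_scope.
Local Open Scope ring_scope.

Fixpoint Ck_on (R : realType) (V : normedModType R) (k : nat)
    (U : set 'rV[R]_4) (f : 'rV[R]_4 -> V) : Prop :=
  match k with
  | 0 => forall x, U x -> {for x, continuous f}
  | k'.+1 => (forall x, U x -> differentiable f x) /\
             (forall v, Ck_on k' U (fun x => 'D_v f x))
  end.

(* Meant for open [U]; [f] is total, its values off [U] are irrelevant. *)
Definition smooth_on (R : realType) (V : normedModType R)
    (U : set 'rV[R]_4) (f : 'rV[R]_4 -> V) : Prop :=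
  forall k, Ck_on k U f.

Record chart (R : realType) (M : topologicalType) := Chart {
  cdom : set M;
  cmap : M -> 'rV[R]_4;
  cinv : 'rV[R]_4 -> M;
  cdom_open : open cdom;
  cimg_open : open (cmap @` cdom);
  cmapK : forall p, cdom p -> cinv (cmap p) = p;
  cmap_continuous : forall p, cdom p -> {for p, continuous cmap};
  cinv_continuous :
    forall x, (cmap @` cdom) x -> {for x, continuous cinv} }.

(* The atlas need not be maximal.  The preferred charts [chart_at] only serve
   to represent (co)tangent vectors; any choice is allowed. *)
Record manifold4 (R : realType) := Manifold4 {
  carrier :> topologicalType;
  atlas : set (chart R carrier);
  chart_at : carrier -> chart R carrier;
  carrier_hausdorff : hausdorff_space carrier;
  carrier_second_countable : @second_countable carrier;
  chart_at_atlas : forall p, atlas (chart_at p);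
  chart_at_dom : forall p, cdom (chart_at p) p;
  transition_smooth : forall c c', atlas c -> atlas c' ->
    smooth_on (cmap c @` (cdom c `&` cdom c')) (cmap c' \o cinv c) }.

(* T_p M is represented by the coordinates of vectors in [chart_at p], and
   T*_p M by the dual coordinates; so vectors at different points are not
   directly comparable and are compared through [tcoord] and [ccoord]. *)
Definition vfield (R : realType) (M : manifold4 R) := M -> 'rV[R]_4.

Definition pairing (R : realType) (l v : 'rV[R]_4) : R :=
  \sum_(i < 4) l 0 i * v 0 i.

Section Manifold.
Context {R : realType} {M : manifold4 R}.
Local Notation E := 'rV[R]_4.

Definition tcoord (c : chart R M) (p : M) (v : E) : E :=
  'd (cmap c \o cinv (chart_at p)) (cmap (chart_at p) p) v.

(* Contragredient to [tcoord]:
   pairing (ccoord c p l) (tcoord c p v) = pairing l v. *)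
Definition ccoord (c : chart R M) (p : M) (l : E) : E :=
  l *m (jacobian (cmap (chart_at p) \o cinv c) (cmap c p))^T.

Definition vf_in (c : chart R M) (X : vfield M) : E -> E :=
  fun x => tcoord c (cinv c x) (X (cinv c x)).

Definition smooth_vf (U : set M) (X : vfield M) : Prop :=
  forall c, atlas c -> smooth_on (cmap c @` (U `&` cdom c)) (vf_in c X).

Definition smooth_fun (U : set M) (f : M -> R) : Prop :=
  forall c, atlas c ->
    smooth_on (cmap c @` (U `&` cdom c)) ((f \o cinv c) : E -> R^o).

Definition lie_bracket (X Y : vfield M) : vfield M := fun p =>
  let c := chart_at p in let x := cmap c p in
  'd (vf_in c Y) x (vf_in c X x) - 'd (vf_in c X) x (vf_in c Y x).

Definition distribution := M -> {vspace E}.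

Definition section_on (D : distribution) (U : set M) (X : vfield M) : Prop :=
  smooth_vf U X /\ forall p, U p -> X p \in D p.

Definition smooth_rank2 (D : distribution) : Prop :=
  forall p, \dim (D p) = 2%N /\
    exists (U : set M) (Y Z : vfield M),
      [/\ open U, U p, section_on D U Y, section_on D U Z &
          forall x, U x -> D x = <<[:: Y x; Z x]>>%VS].

Definition is_span (A : set E) (V : {vspace E}) : Prop :=
  (forall v, A v -> v \in V) /\
  (forall W : {vspace E}, (forall v, A v -> v \in W) -> (V <= W)%VS).

(* D3 = [D1, D2]: at each point, the span of the brackets of local sections. *)
Definition is_bracket (D1 D2 D3 : distribution) : Prop :=
  forall p, is_span
    [set v | exists (U : set M) (Y Z : vfield M),
       [/\ open U, U p, section_on D1 U Y, section_on D2 U Z &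
           v = lie_bracket Y Z p]]
    (D3 p).

Definition engel_distribution (D : distribution) : Prop :=
  smooth_rank2 D /\
  exists D2 D3 : distribution,
    [/\ is_bracket D D D2, forall p, \dim (D2 p) = 3%N,
        is_bracket D D2 D3 & forall p, \dim (D3 p) = 4%N].

(* Only the values of [g p] on [D p] matter. *)
Definition smooth_metric_on (D : distribution) (g : M -> E -> E -> R) : Prop :=
  [/\ forall p (a : R) (u v w : E), u \in D p -> v \in D p -> w \in D p ->
        g p (a *: u + v) w = a * g p u w + g p v w,
      forall p (u v : E), u \in D p -> v \in D p -> g p u v = g p v u,
      forall p (u : E), u \in D p -> u != 0 -> 0 < g p u u
    & forall (U : set M) (Y Z : vfield M), open U ->
        section_on D U Y -> section_on D U Z ->
        smooth_fun U (fun p => g p (Y p) (Z p))].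

End Manifold.
Arguments distribution {R} M.

Record engel_structure (R : realType) (M : manifold4 R) := EngelStructure {
  dist : distribution M;
  metric : M -> 'rV[R]_4 -> 'rV[R]_4 -> R;
  dist_engel : engel_distribution dist;
  metric_smooth : smooth_metric_on dist metric }.

Record frame4 (R : realType) (M : manifold4 R) := Frame4 {
  fX1 : vfield M; fX2 : vfield M; fX3 : vfield M; fX4 : vfield M }.

Section Engel.
Context {R : realType} {M : manifold4 R} (S : engel_structure M).
Local Notation E := 'rV[R]_4.
Local Notation mu := (@lebesgue_measure R).

Definition frame_at (F : frame4 M) (p : M) : 4.-tuple E :=
  [tuple fX1 F p; fX2 F p; fX3 F p; fX4 F p].

Definition canonical_frame_on (U : set M) (F : frame4 M) : Prop :=
  [/\ [/\ smooth_vf U (fX1 F), smooth_vf U (fX2 F),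
          smooth_vf U (fX3 F) & smooth_vf U (fX4 F)]
    & forall p, U p ->
        [/\ basis_of fullv (frame_at F p),
            [/\ fX1 F p \in dist S p, fX2 F p \in dist S p,
                metric S p (fX1 F p) (fX1 F p) = 1,
                metric S p (fX2 F p) (fX2 F p) = 1 &
                metric S p (fX1 F p) (fX2 F p) = 0],
            fX3 F p = lie_bracket (fX1 F) (fX2 F) p,
            fX4 F p = lie_bracket (fX1 F) (fX3 F) p
          & lie_bracket (fX2 F) (fX3 F) p
              \in <<[:: fX1 F p; fX2 F p; fX3 F p]>>%VS]].

(* In ['I_4] the index [1] designates the second vector, X2. *)
Definition T4 (F : frame4 M) (p : M) : R :=
  coord (frame_at F p) 1 (lie_bracket (fX2 F) (fX3 F) p).

(* A canonical frame chosen continuously along [q]: [F t] is a canonical frame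
   near [q t], and nearby times give the same frame germs.  Since canonical
   frames are unique up to signs this is the continuity of the chosen signs; a
   global canonical frame is the case of a constant [F].  The dependence on
   time rather than on the point lets the signs change when [q] comes back to
   the same point. *)
Definition canonical_frame_along (q : R -> M) (a b : R) (F : R -> frame4 M) :=
  forall t, t \in `[a, b] ->
    (exists U : set M, [/\ open U, U (q t) & canonical_frame_on U (F t)]) /\
    (\forall s \near within [set` `[a, b]] (nbhs t),
       \forall x \near q s,
         [/\ fX1 (F s) x = fX1 (F t) x, fX2 (F s) x = fX2 (F t) x,
             fX3 (F s) x = fX3 (F t) x & fX4 (F s) x = fX4 (F t) x]).

Definition has_velocity (q : R -> M) (t : R) (v : E) : Prop :=
  is_derive t (1 : R) (cmap (chart_at (q t)) \o q) v.

Definition lipschitz_curve (q : R -> M) (a b : R) : Prop :=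
  {within [set` `[a, b]], continuous q} /\
  forall t, t \in `[a, b] -> exists2 e : R, 0 < e &
    [lipschitz cmap (chart_at (q t)) (q s) | s in [set` `[a, b]] `&` ball t e].

(* [lam t] is a covector at [q t]. *)
Definition lipschitz_lift (q : R -> M) (lam : R -> E) (a b : R) : Prop :=
  lipschitz_curve q a b /\
  forall t, t \in `[a, b] -> exists2 e : R, 0 < e &
    [lipschitz ccoord (chart_at (q t)) (q s) (lam s)
      | s in [set` `[a, b]] `&` ball t e].

Definition Linfty_on (a b : R) (f : R -> R) : Prop :=
  measurable_fun [set` `[a, b]] f /\
  exists C : R, {ae mu, forall t, t \in `[a, b] -> `|f t| <= C}.

(* The curve [q] on [a, b], with control [u] in the frame [F], is admissible. *)
Definition admissible (q : R -> M) (a b : R) (F : R -> frame4 M)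
    (u : R -> R * R) : Prop :=
  [/\ lipschitz_curve q a b,
      canonical_frame_along q a b F,
      Linfty_on a b (fun t => (u t).1),
      Linfty_on a b (fun t => (u t).2)
    & {ae mu, forall t, t \in `]a, b[ ->
         has_velocity q t ((u t).1 *: fX1 (F t) (q t)
                           + (u t).2 *: fX2 (F t) (q t))}].

Definition speed (u : R -> R * R) (t : R) : R :=
  Num.sqrt ((u t).1 ^+ 2 + (u t).2 ^+ 2).

Definition curve_length (a b : R) (u : R -> R * R) : \bar R :=
  (\int[mu]_(t in [set` `[a, b]]) (speed u t)%:E)%E.

Definition length_minimizer (q : R -> M) (a b : R) (u : R -> R * R) : Prop :=
  forall (q' : R -> M) (a' b' : R) (F' : R -> frame4 M) (u' : R -> R * R),
    a' < b' -> admissible q' a' b' F' u' -> q' a' = q a -> q' b' = q b ->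
    (curve_length a b u <= curve_length a' b' u')%E.

Definition geodesic (q : R -> M) (a b : R) (F : R -> frame4 M)
    (u : R -> R * R) : Prop :=
  [/\ a < b, admissible q a b F u,
      exists c : R, {ae mu, forall t, t \in `[a, b] -> speed u t = c}
    & exists2 e : R, 0 < e &
        forall s t, a <= s -> s < t -> t <= b -> t - s < e ->
          length_minimizer q s t u].

Definition pmp_hamiltonian (u : R * R) (nu h1 h2 : R) : R :=
  u.1 * h1 + u.2 * h2 + nu / 2 * (u.1 ^+ 2 + u.2 ^+ 2).

(* H_u on T*M near (p, l), with the frame [F], in the canonical coordinates
   (x, xi) of the chart [c]. *)
Definition hamiltonian_in (c : chart R M) (F : frame4 M) (u : R * R) (nu : R) :
    E * E -> R^o :=
  fun z => pmp_hamiltonian u nu (pairing z.2 (vf_in c (fX1 F) z.1))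
                                (pairing z.2 (vf_in c (fX2 F) z.1)).

(* sum_i dxi_i /\ dx_i evaluated at (w, v). *)
Definition canonical_form (w v : E * E) : R :=
  pairing w.2 v.1 - pairing v.2 w.1.

(* Sign convention: the Hamiltonian vector v of H satisfies
   canonical_form (., v) = dH. *)
Definition is_hamiltonian_vector (H : E * E -> R^o) (z v : E * E) : Prop :=
  forall w, canonical_form w v = 'd H z w.

Definition extremal_equation (q : R -> M) (lam : R -> E) (F : R -> frame4 M)
    (u : R -> R * R) (nu t : R) : Prop :=
  let c := chart_at (q t) in
  let lift s : E * E := (cmap c (q s), ccoord c (q s) (lam s)) in
  exists v : E * E, is_derive t (1 : R) lift v /\
    is_hamiltonian_vector (hamiltonian_in c (F t) (u t) nu) (lift t) v.

Definition hamiltonian (F : frame4 M) (p : M) (w : R * R) (l : E) (nu : R) : R :=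
  pmp_hamiltonian w nu (pairing l (fX1 F p)) (pairing l (fX2 F p)).

(* The pair (lam, nu) satisfies the Pontryagin maximum principle along [q]. *)
Definition pmp (q : R -> M) (a b : R) (F : R -> frame4 M) (u : R -> R * R)
    (lam : R -> E) (nu : R) : Prop :=
  [/\ lipschitz_lift q lam a b,
      nu <= 0,
      forall t, t \in `[a, b] -> (lam t, nu) != (0, 0),
      {ae mu, forall t, t \in `]a, b[ -> extremal_equation q lam F u nu t}
    & {ae mu, forall t, t \in `]a, b[ -> forall w : R * R,
         hamiltonian (F t) (q t) w (lam t) nu
           <= hamiltonian (F t) (q t) (u t) (lam t) nu}].

Definition abnormal (q : R -> M) (a b : R) (F : R -> frame4 M)
    (u : R -> R * R) : Prop :=
  exists lam : R -> E, pmp q a b F u lam 0.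

Definition normal (q : R -> M) (a b : R) (F : R -> frame4 M)
    (u : R -> R * R) : Prop :=
  exists (lam : R -> E) (nu : R), nu < 0 /\ pmp q a b F u lam nu.

Definition strictly_abnormal (q : R -> M) (a b : R) (F : R -> frame4 M)
    (u : R -> R * R) : Prop :=
  abnormal q a b F u /\ ~ normal q a b F u.

Definition nonconstant (q : R -> M) (a b : R) : Prop :=
  exists s t, [/\ s \in `[a, b], t \in `[a, b] & q s <> q t].

Definition integral_curve_X2 (q : R -> M) (a b : R) (F : R -> frame4 M) : Prop :=
  {within [set` `[a, b]], continuous q} /\
  forall t, t \in `]a, b[ -> has_velocity q t (fX2 (F t) (q t)).

(* Slowing [q] down by the constant factor [k] gives an integral curve of X2;
   [k < 0] occurs, as X2 is only defined up to sign. *)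
Definition integral_curve_X2_upto_speed (q : R -> M) (a b : R)
    (F : R -> frame4 M) : Prop :=
  exists2 k : R, k != 0 &
    integral_curve_X2 (fun s => q (s / k)) (Num.min (k * a) (k * b))
      (Num.max (k * a) (k * b)) (fun s => F (s / k)).

End Engel.

(* Main.v *)
Require Import Defs.
From mathcomp Require Import all_boot all_order all_algebra.
From mathcomp Require Import all_classical all_reals all_analysis.
From mathcomp Require Import ring lra.

Set Implicit Arguments.
Unset Strict Implicit.
Unset Printing Implicit Defensive.

Import Order.TTheory GRing.Theory Num.Theory.
Import numFieldNormedType.Exports.
Local Open Scope classical_set_scope.
Local Open Scope ring_scope.

(* Let h_i = <lam, X_i> along an abnormal extremal.  The maximum condition gives
   h1 = h2 = 0, hence h3 = 0 by differentiation, so that h4 <> 0; differentiating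
   h3 gives u1 h4 = 0.  The velocity is then u2 X2 with |u2| constant.  A control
   of this form could still switch sign; local minimality forbids it, as the curve
   would run back along the same integral curve.

   A normal extremal (with nu = -1) has h1 = 0, h2 = k, hence h3 = 0, and
   0 = h3' = k <lam, [X2, X3]> = k^2 T4.  Conversely, if T4 = 0 along the curve,
   then k X2^* + C lam0 is a normal extremal, where X2^* belongs to the dual frame,
   lam0 is the abnormal extremal and C is an antiderivative of
   k^2 <X2^*, [X2, X4]> / <lam0, X4>. *)

(** * Calculus almost everywhere *)

(** Controls are only bounded and measurable, so the equations hold almost everywhere. Two facts
    make them usable: increments of a Lipschitz function are bounded by its derivative almost
    everywhere, and the h_i are continuous, so identities valid almost everywhere extend to the
    closed segment. The obstacle is a control that switches sign: uniqueness for ODEs in time says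
    nothing about x' = w X2 with w merely measurable. Taking a transverse coordinate as parameter in
    place of time eliminates w. Minimality is used against a single competitor, the constant curve.
    The equation for C comes from testing the Hamiltonian equation on the frame: C' <lam0, X_i> =
    k^2 <X2^*, [X2, X_i]> for each i. As lam0 kills X1, X2 and X3, the first three equations say
    that [X2, X1] = - X3, [X2, X2] = 0 and [X2, X3] have no X2-component, which for the last one is
    T4 = 0; the fourth can be solved for C' because h4 does not vanish. Computations take place in a
    fixed chart with the frame of one time; real induction glues the local conclusions along the
    curve. *)

(** The supremum of the [t] with [P] on all of [a, t] satisfies [P] by the half of the local
    hypothesis that comes from the left; the other half carries [P] beyond it unless it is [b]. *)
Lemma real_induction (R : realType) (a b : R) (P : R -> Prop) :
  a <= b -> P a ->
  (forall t, a <= t <= b -> exists2 e : R, 0 < e &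
     forall s, a <= s <= b -> `|s - t| < e ->
       (s <= t -> P s -> P t) /\ (t <= s -> P t -> P s)) ->
  forall t, a <= t <= b -> P t.
Proof.
move=> ab Pa loc.
pose S := [set t | a <= t <= b /\ forall s, a <= s <= t -> P s].
have Sa : S a.
  split; first by rewrite lexx.
  by move=> s; rewrite -eq_le => /eqP <-.
have ubS : ubound S b by move=> t [/andP[]].
have supS : has_sup S by split; [exists a | exists b].
pose T := sup S.
have aT : a <= T by apply: ub_le_sup => //; exists b.
have Tb : T <= b by apply: ge_sup => //; exists a.
have TP s : a <= s -> s < T -> P s.
  move=> a_s sT; have Ts0 : 0 < T - s by lra.
  have [r [_ Pr] sr] := sup_adherent Ts0 supS.
  by apply: Pr; rewrite a_s /=; rewrite /T in sT sr; lra.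
have [e e0 Te] := loc T ltac:(lra).
have PT : P T.
  have [s Ss sT] := sup_adherent e0 supS; rewrite -/T in sT.
  have sT' : s <= T by apply: ub_le_sup => //; exists b.
  case: Ss => /andP[a_s sb] Ps.
  have [] := Te s ltac:(lra) ltac:(rewrite ltr_norml; lra).
  by move=> + _; apply => //; apply: Ps; lra.
have [bT|Tltb] := leP b T.
  have {bT Tb} bT : b = T by apply/eqP; rewrite eq_le bT Tb.
  move=> t /andP[a_t]; rewrite bT le_eqVlt => /orP[/eqP->//|]; exact: TP.
pose T' := Num.min (T + e / 2) b.
have TT' : T < T' by rewrite lt_min; apply/andP; split; lra.
have T'b : T' <= b by rewrite ge_min lexx orbT.
have T'e : T' <= T + e / 2 by rewrite ge_min lexx.
have /(ub_le_sup (E := S) ltac:(by exists b)) : S T'; last by rewrite -/T; lra.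
split; first by lra.
move=> s /andP[a_s sT']; have [sT|Ts] := ltP s T; first exact: TP.
have [] := Te s ltac:(lra) ltac:(rewrite ltr_norml; lra).
by move=> _; apply.
Qed.

(** Free of quotients, hence of punctured neighbourhoods, and suited to estimates of increments. *)
Lemma is_derive1P (R : realType) (V : normedModType R) (f : R -> V) (t : R) (v : V) :
  is_derive t (1 : R) f v <->
  forall e, 0 < e -> exists2 d : R, 0 < d &
    forall s, `|s - t| < d -> `|f s - f t - (s - t) *: v| <= e * `|s - t|.
Proof.
split.
  move=> [df fv] e e0.
  move/cvg_ex: (df) => [l fl].
  have lv : l = v by rewrite -fv /derive; apply/esym/cvg_lim.
  move: fl; rewrite lv => /cvgrPdist_le /(_ _ e0) /nbhs_ballP[d /= d0 dP].
  exists d => // s sd.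
  have [->|st] := eqVneq s t; first by rewrite !subrr scale0r subr0 !normr0 mulr0.
  have st0 : s - t != 0 by rewrite subr_eq0.
  have /= := dP (s - t) ltac:(by rewrite /ball /= sub0r normrN) st0.
  rewrite scaler1 subrK => H.
  rewrite -(ler_pM2l (x := `|(s - t)^-1|)) ?normr_gt0 ?invr_eq0//.
  rewrite -normrZ scalerBr scalerA mulVf// scale1r distrC.
  by rewrite normfV mulrCA mulVf ?mulr1// normr_eq0.
move=> H.
have fl : (fun h => h^-1 *: ((f \o shift t) (h *: (1:R)) - f t)) @ 0^' --> v.
  apply/cvgrPdist_le => e e0; have [d d0 dP] := H _ e0.
  apply/nbhs_ballP; exists d => //= h; rewrite /ball /= sub0r normrN => hd h0.
  have := dP (h + t); rewrite addrK => /(_ hd) {}dP.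
  rewrite scaler1 distrC -(ler_pM2l (x := `|h|)) ?normr_gt0//.
  by rewrite -normrZ scalerBr scalerA divff// scale1r mulrC.
split; first by apply/cvg_ex; exists v.
exact/cvg_lim.
Qed.

Section almost_everywhere.
Context d (T : measurableType d) (R : realFieldType).
Variable mu : {measure set T -> \bar R}.

Lemma ae_imp (P Q : T -> Prop) :
  {ae mu, forall x, P x} -> (forall x, P x -> Q x) -> {ae mu, forall x, Q x}.
Proof.
move=> aeP PQ; apply: filterS aeP => //; exact: (ae_filter_ringOfSetsType mu).
Qed.

Lemma ae_and (P Q : T -> Prop) :
  {ae mu, forall x, P x} -> {ae mu, forall x, Q x} ->
  {ae mu, forall x, P x /\ Q x}.
Proof.
by move=> aeP aeQ; apply: filterI => //; exact: (ae_filter_ringOfSetsType mu).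
Qed.

End almost_everywhere.

Section ae_increment.
Context {R : realType}.
Local Notation mu := (@lebesgue_measure R).

(* The exceptional null set is covered by an open [U] of measure at most [e], and
   [f t - (K + e) * t - C * mu (U `&` ]a, t])] is nonincreasing by real induction. *)
Lemma lipschitz_ae_derive_le (f : R -> R) (a b L K : R) : a <= b ->
  (forall s t, a <= s <= b -> a <= t <= b -> `|f s - f t| <= L * `|s - t|) ->
  {ae mu, forall t, t \in `]a, b[ -> exists2 d, is_derive t (1 : R) f d & d <= K} ->
  f b - f a <= K * (b - a).
Proof.
move=> ab fL [A [mA A0 NA]].
have L0 : a < b -> 0 <= L.
  move=> ltab; have := fL a b; rewrite !lexx /= ab => /(_ isT isT).
  move/(le_trans (normr_ge0 _)); rewrite pmulr_lge0// normr_gt0; lra.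
have [eqab|ltab] := leP b a.
  have -> : b = a by apply/eqP; rewrite eq_le ab eqab.
  by rewrite !subrr mulr0.
have {}L0 := L0 ltab.
pose C := L + `|K|.
have C0 : 0 <= C by rewrite addr_ge0.
apply/ler_addgt0Pr => e0 e0_gt0.
(* Chosen so that the errors [e * (b - a)] from the slope and [C * e] from the open cover add up to
   at most [e0]. *)
pose e := e0 / (b - a + C + 1).
have den : 0 < b - a + C + 1 by lra.
have e_gt0 : 0 < e by rewrite divr_gt0.
suff : f b - f a <= (K + e) * (b - a) + C * e.
  move/le_trans; apply; rewrite mulrDl -addrA lerD2l.
  have -> : e * (b - a) + C * e = e0 * ((b - a + C) / (b - a + C + 1)).
    by rewrite /e; field; lra.
  by rewrite ger_pMr// ler_pdivrMr//; lra.
(* The endpoints join the null set because the derivative is only given on the open interval. *)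
pose A' := A `|` ([set a] `|` [set b]).
have mA' : measurable A' by apply: measurableU => //; apply: measurableU.
have A'0 : mu A' = 0%E.
  apply: null_set_setU => //.
  - by apply: measurableU.
  - apply: null_set_setU => //; exact: lebesgue_measure_set1.
have A'fin : (mu A' < +oo)%E by rewrite A'0 ltry.
have [U [oU A'U UA']] := lebesgue_regularity_outer mA' A'fin e_gt0.
have mU : measurable U by exact: measurable_realfun.open_measurable.
have U_e : (mu U <= e%:E)%E.
  apply: (@le_trans _ _ (mu A' + mu (U `\` A'))%E).
    by rewrite -[in leLHS](setDUK A'U) measureU//; [exact: measurableD|rewrite setDIK].
  by rewrite A'0 add0e ltW.
have mI (s t : R) : measurable (U `&` `]s, t]) by apply: measurableI.
have muI (s t : R) : (mu (U `&` `]s, t]) <= e%:E)%E.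
  apply: le_trans U_e; apply: le_measure.
  - by rewrite inE; exact: mI.
  - by rewrite inE; exact: mU.
  - exact: subIsetl.
have finI (s t : R) : mu (U `&` `]s, t]) \is a fin_num.
  rewrite ge0_fin_numE//; apply: le_lt_trans (muI s t) _; exact: ltry.
pose m t := fine (mu (U `&` `]a, t])).
have m_a : m a = 0 by rewrite /m set_itv_ge ?bnd_simp ?ltxx// setI0 measure0.
have m_b : m b <= e by rewrite /m -lee_fin fineK.
have mD s t : a <= s -> s <= t -> m t = m s + fine (mu (U `&` `]s, t])).
  move=> a_s st; rewrite /m -fineD// -measureU; [|exact: mI|exact: mI|]; last first.
    rewrite setIACA setIid [X in _ `&` X](_ : _ = set0) ?setI0//.
    by rewrite -subset0 => x /= []; rewrite !in_itv /=; lra.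
  rewrite -setIUr -itv_bndbnd_setU// ?bnd_simp//.
pose G t := f t - (K + e) * t - C * m t.
suff : G b <= G a by rewrite /G m_a; have := ler_wpM2l C0 m_b; lra.
apply: (real_induction (P := fun t => G t <= G a) ab (lexx _)); last by rewrite lexx ab.
move=> t /andP[at_ tb].
suff [d d0 dP] : exists2 d : R, 0 < d & forall r s, a <= r -> r <= s -> s <= b ->
    r = t \/ s = t -> `|r - s| < d -> G s <= G r.
  exists d => // s /andP[a_s sb] sd; split => [st|ts].
    by apply: le_trans; apply: dP => //; right.
  by apply: le_trans; apply: dP => //; [left|rewrite distrC].
case: (pselect (U t)) => [Ut|nUt].
  (* Inside [U] the function [m] grows at unit rate, so [C = L + |K|] times its growth absorbs the
     Lipschitz increment. *)
  have /nbhs_ballP[d /= d0 dU] := open_nbhs_nbhs (conj oU Ut).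
  exists d => // r s ar rs sb rst rsd.
  have rsU : `]r, s] `<=` U.
    move=> x /=; rewrite in_itv /= => xrs; apply: dU; rewrite /ball /= ltr_norml.
    by move: rsd; rewrite ltr_norml; case: rst => rst; lra.
  rewrite /G (mD r s)// setIC setIidl// lebesgue_measure_itv /= lte_fin.
  have fsr := fL s r ltac:(lra) ltac:(lra).
  have srE : `|s - r| = s - r by rewrite ger0_norm ?subr_ge0.
  rewrite srE in fsr.
  have := ler_norm (f s - f r).
  have := ler_norm (- K); rewrite normrN => KK.
  case: ltP => [rs'|sr] /=; rewrite /C.
    have sr0 : 0 <= s - r by lra.
    have := ler_wpM2r sr0 KK.
    have := mulr_ge0 (ltW e_gt0) sr0; clear -fsr; lra.
  have -> : s = r by apply/eqP; rewrite eq_le sr rs.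
  rewrite mulrDr mulr0 addr0; lra.
(* Outside [U] the derivative exists and is at most [K]; the slack [e] in the slope pays for the
   remainder. *)
have tab : t \in `]a, b[.
  rewrite in_itv /=; apply/andP; split; rewrite lt_neqAle.
    rewrite at_ andbT; apply/eqP => ta; apply: nUt; apply: A'U; right; left.
    by rewrite ta.
  by rewrite tb andbT; apply/eqP => ta; apply: nUt; apply: A'U; right; right.
have [d /is_derive1P/(_ _ e_gt0)[r r0 rP] dK] :
    exists2 d, is_derive t (1 : R) f d & d <= K.
  apply: contrapT => H; apply: nUt; apply: A'U; left; apply: NA => /= /(_ tab).
  exact: H.
exists r => // x y ax xy yb xyt xyr.
have mxy : 0 <= fine (mu (U `&` `]x, y])) by rewrite fine_ge0.
have := mulr_ge0 C0 mxy => CM.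
have yx0 : 0 <= y - x by lra.
have yxE : `|y - x| = y - x by rewrite ger0_norm.
have xyE : `|x - y| = y - x by rewrite distrC.
have dKxy := ler_wpM2r yx0 dK.
rewrite /G (mD x y)// mulrDr.
case: xyt => xyt; subst t.
  have yxr : `|y - x| < r by rewrite distrC.
  have := rP y yxr; rewrite yxE =>  /(le_trans (ler_norm _)); rewrite /GRing.scale /=; lra.
have := rP x xyr.
rewrite distrC (ler0_norm (x := x - y)) ?subr_le0// opprB ler_norml.
move=> /andP[_]; rewrite /GRing.scale /=; lra.
Qed.

Lemma lipschitz_ae_norm_derive_le (f : R -> R) (a b L K : R) : a <= b ->
  (forall s t, a <= s <= b -> a <= t <= b -> `|f s - f t| <= L * `|s - t|) ->
  {ae mu, forall t, t \in `]a, b[ -> exists2 d, is_derive t (1 : R) f d & `|d| <= K} ->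
  `|f b - f a| <= K * (b - a).
Proof.
move=> ab fL fK; rewrite ler_norml lerNl; apply/andP; split.
  have := @lipschitz_ae_derive_le (- f) a b L K ab.
  rewrite !fctE !opprB opprK addrC; apply.
    by move=> s t sab tab; rewrite -opprD normrN; apply: fL.
  apply: (ae_imp fK) => t /[apply] -[d fd dK]; exists (- d).
    exact: is_deriveN.
  by rewrite lerNl; move: dK; rewrite ler_norml => /andP[].
apply: lipschitz_ae_derive_le fL _ => //.
apply: (ae_imp fK) => t /[apply] -[d fd dK]; exists d => //.
exact: le_trans (ler_norm _) dK.
Qed.

End ae_increment.

Lemma coord_norm_le (R : realType) m n (A : 'M[R]_(m, n)) i j : `|A i j| <= `|A|.
Proof.
rewrite [leRHS]/Num.Def.normr/= mx_normrE.
by apply: le_trans; last exact: (le_bigmax _ _ (i, j)).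
Qed.

Lemma mx_norm_le (R : realType) m n (A : 'M[R]_(m, n)) (K : R) :
  0 <= K -> (forall i j, `|A i j| <= K) -> `|A| <= K.
Proof.
move=> K0 AK; rewrite [leLHS]/Num.Def.normr/= mx_normrE.
by apply: bigmax_le => // -[i j] _; exact: AK.
Qed.

Lemma mx_continuous (R : realType) (T : topologicalType) m n (f : T -> 'M[R]_(m, n)) x :
  (forall i j, {for x, continuous (fun y => f y i j)}) -> {for x, continuous f}.
Proof.
move=> fc; apply/cvgrPdist_le => e e0.
have fe i : \forall y \near x, forall j, `|f x i j - f y i j| <= e.
  have fie j : \forall y \near x, `|f x i j - f y i j| <= e.
    exact: (cvgrPdist_le _ _).1 (fc i j) e e0.
  exact: filter_forall fie.
have : \forall y \near x, forall i j, `|f x i j - f y i j| <= e.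
  exact: filter_forall fe.
apply: filterS => y fy; apply: mx_norm_le; first exact: ltW.
by move=> i j; rewrite !mxE.
Qed.

Section derivative_tools.
Context {R : realType}.

Lemma is_derive_coord (V : normedModType R) m n (f : V -> 'M[R]_(m, n)) (x v : V) df i j :
  is_derive x v f df -> is_derive x v (fun y => f y i j) (df i j).
Proof.
move=> [fx <-]; split; first exact: ((derivable_mxP f x v).1 fx i j).
by rewrite derive_mx// mxE.
Qed.

Lemma is_derive_mx (V : normedModType R) m n (f : V -> 'M[R]_(m, n)) (x v : V)
    (df : 'M[R]_(m, n)) :
  (forall i j, is_derive x v (fun y => f y i j) (df i j)) -> is_derive x v f df.
Proof.
move=> H; have fx : derivable f x v.
  by apply/derivable_mxP => i j; have [] := H i j.
split => //; rewrite derive_mx//; apply/matrixP => i j; rewrite mxE.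
by have [] := H i j.
Qed.

Lemma is_derive_comp (V W : normedModType R) (x : R -> V) (g : V -> W) t v :
  is_derive t (1 : R) x v -> differentiable g (x t) ->
  is_derive t (1 : R) (g \o x) ('d g (x t) v).
Proof.
move=> [/derivable1_diffP xt <-] gx.
have gxt : differentiable (g \o x) t by exact: differentiable_comp.
split; first exact/derivable1_diffP.
by rewrite !deriveE// diff_comp.
Qed.

Lemma is_derive_comp_scalar (V : normedModType R) (g : R -> V) (x : R -> R) t dx dg :
  is_derive t (1 : R) x dx -> is_derive (x t) (1 : R) g dg ->
  is_derive t (1 : R) (g \o x) (dx *: dg).
Proof.
move=> xt gx; have gd : differentiable g (x t) by exact/derivable1_diffP.
apply: is_derive_eq; first exact: is_derive_comp xt gd.
rewrite -[X in _ X = _]mulr1 [LHS]linearZ /= -deriveE//.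
by rewrite (@derive_val _ _ _ _ _ _ _ gx).
Qed.

Lemma is_derive_line (V W : normedModType R) (f : V -> W) (x v : V) (s : R) :
  differentiable f (x + s *: v) ->
  is_derive s (1 : R) (fun r => f (x + r *: v)) ('D_v f (x + s *: v)).
Proof.
move=> fx; have lin : is_derive s (1 : R) (fun r : R => x + r *: v) v.
  apply/is_derive1P => e e0; exists 1 => // r _.
  rewrite opprD addrACA subrr add0r -scalerBl subrr normr0.
  by rewrite mulr_ge0// ltW.
apply: is_derive_eq; first exact: (is_derive_comp lin fx).
by rewrite deriveE.
Qed.

(** Real induction with the slope [K + e] replaces the mean value theorem, whose equality form fails
    for vector values. *)
Lemma is_derive_increment_le (V : normedModType R) (f : R -> V) (df : R -> V) (a b K : R) :
  a <= b ->
  (forall t, a <= t <= b -> is_derive t (1 : R) f (df t) /\ `|df t| <= K) ->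
  `|f b - f a| <= K * (b - a).
Proof.
move=> ab fK; apply/ler_addgt0Pr => e0 e0_gt0.
pose e := e0 / (b - a + 1).
have den : 0 < b - a + 1 by lra.
have e_gt0 : 0 < e by rewrite divr_gt0.
suff : `|f b - f a| <= (K + e) * (b - a).
  move/le_trans; apply; rewrite mulrDl lerD2l /e mulrAC.
  by rewrite ler_pdivrMr// ler_pM2l//; lra.
apply: (real_induction (P := fun t => `|f t - f a| <= (K + e) * (t - a)) ab).
- by rewrite !subrr normr0 mulr0.
- move=> t tab; have [ft dftK] := fK t tab.
  have [d d0 dP] := (is_derive1P f t (df t)).1 ft e e_gt0.
  exists d => // s sab sd.
  have key : `|f s - f t| <= (K + e) * `|s - t|.
    rewrite -[_ - _](subrK ((s - t) *: df t)).
    apply: (le_trans (ler_normD _ _)); rewrite normrZ mulrDl [X in _ <= X]addrC lerD//.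
      exact: dP.
    by rewrite mulrC ler_wpM2r.
  split=> st fs.
    rewrite -(subrKA (f s)); apply: (le_trans (ler_normD _ _)).
    have -> : t - a = (t - s) + (s - a) by ring.
    rewrite mulrDr lerD//; rewrite distrC (le_trans key)// distrC ger0_norm//.
    by rewrite subr_ge0.
  rewrite -(subrKA (f t)); apply: (le_trans (ler_normD _ _)).
  have -> : s - a = (s - t) + (t - a) by ring.
  by rewrite mulrDr lerD// (le_trans key)// ger0_norm// subr_ge0.
- by rewrite lexx ab.
Qed.

Local Notation mu := (@lebesgue_measure R).

Lemma lipschitz_ae_mx_derive_le m n (f : R -> 'M[R]_(m, n)) (a b L K : R) :
  a <= b -> 0 <= K ->
  (forall s t, a <= s <= b -> a <= t <= b -> `|f s - f t| <= L * `|s - t|) ->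
  {ae mu, forall t, t \in `]a, b[ -> exists2 d, is_derive t (1 : R) f d & `|d| <= K} ->
  `|f b - f a| <= K * (b - a).
Proof.
move=> ab K0 fL fK; apply: mx_norm_le; first by rewrite mulr_ge0// subr_ge0.
move=> i j; rewrite 2!mxE.
apply: (@lipschitz_ae_norm_derive_le _ (fun t => f t i j) a b L K ab).
  move=> s t sab tab; apply: le_trans (fL s t sab tab).
  by apply: le_trans (coord_norm_le _ i j); rewrite !mxE.
apply: (ae_imp fK) => t /[apply] -[d fd dK]; exists (d i j).
  exact: is_derive_coord.
exact: le_trans (coord_norm_le _ _ _) dK.
Qed.

(** After subtraction of the linear map of slope [df t0], the derivative near [t0] is small almost
    everywhere by continuity of [df], hence so are the increments. This promotes a velocity known
    almost everywhere to one at every time. *)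
Lemma lipschitz_ae_is_derive m n (f : R -> 'M[R]_(m, n)) (df : R -> 'M[R]_(m, n)) (t0 d L : R) :
  0 < d ->
  (forall s t, `|s - t0| < d -> `|t - t0| < d -> `|f s - f t| <= L * `|s - t|) ->
  {ae mu, forall t, `|t - t0| < d -> is_derive t (1 : R) f (df t)} ->
  {for t0, continuous df} -> is_derive t0 (1 : R) f (df t0).
Proof.
move=> d0 fL fdf /cvgrPdist_le dfc; apply/is_derive1P => e e0.
have /nbhs_ballP[r /= r0 rP] := dfc e e0.
pose d' := Num.min d r.
have d'0 : 0 < d' by rewrite lt_min d0.
have key s t : `|s - t0| < d' -> `|t - t0| < d' -> s <= t ->
    `|f t - f s - (t - s) *: df t0| <= e * (t - s).
  move=> sd td st.
  have -> : f t - f s - (t - s) *: df t0 = (f t - t *: df t0) - (f s - s *: df t0).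
    rewrite scalerBl !opprD !opprK !addrA addrAC -!addrA; congr (_ + _).
    by rewrite [RHS]addrC -!addrA.
  have near_d u : s <= u <= t -> `|u - t0| < d'.
    by move=> ust; move: sd td; rewrite !ltr_norml; lra.
  have near_dd u : s <= u <= t -> `|u - t0| < d.
    by move/near_d => /lt_le_trans; apply; rewrite ge_min lexx.
  apply: (@lipschitz_ae_mx_derive_le _ _ (fun u => f u - u *: df t0) s t (L + `|df t0|) e) => //.
  - exact: ltW.
  - move=> u v ust vst.
    rewrite opprD opprK addrACA [- _ + _]addrC -scalerBl mulrDl.
    apply: (le_trans (ler_normD _ _)); rewrite lerD//.
      by apply: fL; exact: near_dd.
    by rewrite normrZ mulrC distrC.
  - apply: (ae_imp fdf) => u udf; rewrite in_itv /= => ust.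
    have usta : s <= u <= t by lra.
    exists (df u - df t0).
      apply: is_deriveB; first exact/udf/near_dd.
      apply/is_derive1P => e1 e10; exists 1 => // v _.
      by rewrite -scalerBl subrr normr0 mulr_ge0// ltW.
    rewrite distrC; apply: rP; rewrite /ball /= distrC.
    by apply: lt_le_trans (near_d _ usta) _; rewrite ge_min lexx orbT.
exists d' => // s sd; have t0d : `|t0 - t0| < d' by rewrite subrr normr0.
have [st|ts] := leP s t0.
  have -> : f s - f t0 - (s - t0) *: df t0 = - (f t0 - f s - (t0 - s) *: df t0).
    by rewrite [RHS]opprB [RHS]addrC opprB -scaleNr opprB.
  by rewrite normrN [`|s - t0|]distrC ger0_norm ?subr_ge0//; exact: key.
have := key _ _ t0d sd (ltW ts).
by rewrite (ger0_norm (x := s - t0)) ?subr_ge0// ltW.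
Qed.

End derivative_tools.

Lemma within_segment_continuousP (R : realType) (T : topologicalType) (f : R -> T)
    (a b : R) :
  {within [set` `[a, b]], continuous f} <->
  forall t, a <= t <= b -> forall W, nbhs (f t) W ->
    exists2 d : R, 0 < d & forall s, a <= s <= b -> `|s - t| < d -> W (f s).
Proof.
split=> [/subspace_continuousP fc t tab W fW|H].
  have tI : [set` `[a, b]] t by rewrite /= in_itv.
  have /nbhs_ballP[d /= d0 dP] := fc t tI W fW.
  exists d => // s sab sd; apply: dP; last by rewrite /= in_itv.
  by rewrite /ball /= distrC.
apply/subspace_continuousP => t; rewrite /= in_itv => tab W /(H t tab)[d d0 dP].
apply/nbhs_ballP; exists d => //= s; rewrite /ball /= distrC => sd.
by rewrite in_itv => sab; exact: dP.
Qed.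

Section ae_dense.
Context {R : realType}.
Local Notation mu := (@lebesgue_measure R).

Lemma ae_interval_exists (a b : R) (P : R -> Prop) : a < b ->
  {ae mu, forall t, t \in `]a, b[ -> P t} -> exists2 t, a < t < b & P t.
Proof.
move=> ab [N [mN N0 PN]]; apply: contrapT => H.
have abN : `]a, b[ `<=` N.
  move=> t tab; apply: PN => /= Pt; apply: H; exists t; last exact: Pt.
  by move: tab; rewrite /= in_itv.
have : (mu `]a, b[ <= mu N)%E.
  by apply: le_measure => //; rewrite inE.
rewrite N0 lebesgue_measure_itv /= lte_fin ab lee_fin; lra.
Qed.

(** Every relative neighbourhood of a point of the closed segment, endpoints included, has positive
    measure. Identities drawn from the maximum condition reach all times in this way. *)
Lemma ae_within_continuous_eq (a b : R) (f : R -> R) (v : R) : a < b ->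
  {within [set` `[a, b]], continuous f} ->
  {ae mu, forall t, t \in `]a, b[ -> f t = v} -> forall t, t \in `[a, b] -> f t = v.
Proof.
move=> ab fc fv t tab; apply/eqP; rewrite -subr_eq0 -normr_le0.
apply/ler_addgt0Pr => e e0; rewrite add0r.
move: tab; rewrite in_itv /= => tab.
have [d d0 dP] := (within_segment_continuousP f a b).1 fc t tab _ (nbhsx_ballx (f t) e e0).
(* A window next to [t] inside the open interval: to the right of [t], or to the left when
   [t = b]. *)
have [c [c' [cc' cP]]] : exists c c', c < c' /\ forall s, c < s < c' -> a < s < b /\ `|t - s| < d.
  have [tb|bt] := ltP t b.
    exists t, (Num.min b (t + d)); split; first by rewrite lt_min tb; lra.
    by move=> s; rewrite lt_min => /and3P[ts sb sd]; rewrite ltr_norml; split; lra.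
  exists (Num.max a (t - d)), t; split; first by rewrite gt_max; lra.
  by move=> s; rewrite gt_max => /andP[/andP[ts sb] sd]; rewrite ltr_norml; split; lra.
have [s sc fsv] : exists2 s, c < s < c' & f s = v.
  apply: ae_interval_exists => //; apply: (ae_imp fv) => s fs.
  by rewrite in_itv /= => /cP[sab _]; apply: fs; rewrite in_itv.
have [sab std] := cP s sc.
have sab' : a <= s <= b by lra.
by rewrite -fsv ltW//; apply: (dP s sab'); rewrite distrC.
Qed.

End ae_dense.

Lemma subrACA (V : zmodType) (x y z t : V) : x - y - (z - t) = x - z - (y - t).
Proof. by rewrite 2!opprB [LHS]addrACA [RHS]addrACA [- y + _]addrC. Qed.

Section clamp.
Context {R : realType}.

(** The 1-Lipschitz retraction onto [a, b], used to extend functions beyond a segment. *)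
Definition clamp (a b x : R) : R :=
  if x < a then a else if b < x then b else x.

Lemma clamp_itv a b x : a <= b -> a <= clamp a b x <= b.
Proof. by rewrite /clamp => ab; case: ltP => ax; [lra|case: ltP; lra]. Qed.

Lemma clamp_id a b x : a <= x <= b -> clamp a b x = x.
Proof.
by move=> xab; rewrite /clamp; case: ltP => ax; [lra|case: ltP => // bx; lra].
Qed.

Lemma clamp_lipschitz a b x y : a <= b -> `|clamp a b x - clamp a b y| <= `|x - y|.
Proof.
move=> ab; have := ler_norm (x - y); have := ler_norm (y - x).
rewrite (distrC y x) => h1 h2.
by rewrite /clamp; case: (ltP x a); case: (ltP b x); case: (ltP y a); case: (ltP b y);
  move=> *; rewrite ler_norml; lra.
Qed.

Lemma clamp_continuous a b : a <= b -> continuous (clamp a b : R -> R).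
Proof.
move=> ab x; apply/cvgrPdist_le => e e0; apply/nbhs_ballP; exists e => //= y yx.
exact: le_trans (clamp_lipschitz _ _ _) (ltW _).
Qed.

End clamp.

Section antiderivative.
Context {R : realType}.

Lemma antiderivative_exists (g : R -> R) (a b : R) : a <= b -> continuous g ->
  exists H : R -> R, continuous H /\
    forall v, a < v < b -> is_derive v (1 : R) H (g v).
Proof.
move=> ab gc.
(* Starting at [a - 1] makes all of [a, b] interior to the range of integration, so derivatives are
   two-sided there. *)
pose H0 (x : R) : R := Rintegral lebesgue_measure `[a - 1, x] g.
have H0d v : a <= v <= b -> is_derive v (1 : R) H0 (g v).
  move=> vab.
  have vb1 : v < b + 1 by lra.
  have a1v : a - 1 < v by lra.
  have gi : (@lebesgue_measure R).-integrable `[a - 1, b + 1] (EFin \o g).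
    apply: continuous_compact_integrable; first exact: segment_compact.
    exact: continuous_subspaceT.
  have [Hd HE] := continuous_FTC1_closed vb1 gi a1v (gc v).
  by split; [exact: Hd | rewrite -derive1E].
(* Clamping leaves [H0] unchanged on ]a, b[ and makes it continuous on the line, so that the
   construction can be iterated. *)
exists (H0 \o clamp a b); split.
  move=> x; apply: continuous_comp; first exact: clamp_continuous.
  have [Hd _] := H0d _ (clamp_itv x ab).
  exact/differentiable_continuous/derivable1_diffP.
move=> v vab; apply: near_eq_is_derive (H0d v _); last by lra.
have : \forall y \near v, a < y < b.
  by near=> y; apply/andP; split; near: y; [apply: lt_nbhsr|apply: lt_nbhsl]; lra.
by apply: filterS => y yab /=; rewrite clamp_id//; lra.
Unshelve. all: by end_near. Qed.

Lemma antiderivative_mx_exists m n (g : R -> 'M[R]_(m, n)) (a b : R) : a <= b ->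
  (forall i j, continuous (fun v => g v i j)) ->
  exists H : R -> 'M[R]_(m, n), (forall i j, continuous (fun v => H v i j)) /\
    forall v, a < v < b -> is_derive v (1 : R) H (g v).
Proof.
move=> ab gc.
pose P (ij : 'I_m * 'I_n) (h : R -> R) := continuous h /\
    forall v, a < v < b -> is_derive v (1 : R) h (g v ij.1 ij.2).
have /choice[h hP] : forall ij, exists h, P ij h.
  by move=> ij; exact: antiderivative_exists.
exists (fun v => \matrix_(i, j) h (i, j) v); split => [i j|v vab].
  by have [] := hP (i, j); under [X in _ -> _ -> continuous X]eq_fun do rewrite mxE.
apply: is_derive_mx => i j; have [_ /(_ v vab)] := hP (i, j).
by under [X in _ -> is_derive _ _ X _]eq_fun do rewrite mxE.
Qed.

End antiderivative.

(** * Curves tangent to a line field *)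

Section line_field.
Context {R : realType}.
Local Notation E := 'rV[R]_4.
Local Notation mu := (@lebesgue_measure R).

(* A curve tangent to a line field is a function of any coordinate [j]
   transverse to it: with [z] that coordinate, [x' = z' P x], and Picard iterates
   [G (n+1) v = x s + \int P (G n)], composed with [z], converge to [x]. *)
Lemma line_field_curve_eq (P : E -> E) (x : R -> E) (z : R -> R) (s t L B K Lz : R) :
  s <= t -> 0 <= L -> 0 <= K ->
  (forall y y', `|P y - P y'| <= L * `|y - y'|) -> (forall y, `|P y| <= B) ->
  (forall r r', s <= r <= t -> s <= r' <= t -> `|x r - x r'| <= Lz * `|r - r'|) ->
  (forall r r', s <= r <= t -> s <= r' <= t -> `|z r - z r'| <= Lz * `|r - r'|) ->
  {ae mu, forall r, r \in `]s, t[ -> exists w : R,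
     [/\ `|w| <= K, is_derive r (1 : R) z w & is_derive r (1 : R) x (w *: P (x r))]} ->
  K * L * (t - s) <= 2^-1 -> z s = z t -> x s = x t.
Proof.
move=> st L0 K0 PL PB xL zL xz KL zst.
have B0 : 0 <= B by apply: le_trans (PB 0).
have Lz0 : s < t -> 0 <= Lz.
  move=> ltst; have := xL s t; rewrite !lexx /= st => /(_ isT isT).
  move/(le_trans (normr_ge0 _)); rewrite pmulr_lge0// normr_gt0; lra.
have [lets|ltst] := leP t s; first by have -> : s = t by apply/eqP; rewrite eq_le st.
have {}Lz0 := Lz0 ltst.
pose D := Lz * (t - s).
have D0 : 0 <= D by rewrite mulr_ge0//; lra.
have zD r : s <= r <= t -> z s - D <= z r <= z s + D.
  move=> rst; have s_st : s <= s <= t by lra.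
  have := zL r s rst s_st; rewrite (ger0_norm (x := r - s)); last by lra.
  have rs_ts : r - s <= t - s by lra.
  have := ler_wpM2l Lz0 rs_ts; rewrite -/D ler_norml; lra.
have key n : exists G : R -> E, (forall i j, continuous (fun v => G v i j)) /\
    forall r, s <= r <= t -> `|x r - G (z r)| <= D * 2^-1 ^+ n.
  elim: n => [|n [G [Gc xG]]].
    exists (fun=> x s); split=> [i j|r rst]; first exact: cst_continuous.
    have s_st : s <= s <= t by lra.
    rewrite expr0 mulr1; apply: (le_trans (xL r s rst s_st)).
    by rewrite ler_wpM2l// ger0_norm; lra.
  have Gcont : continuous G.
    by move=> v; apply: mx_continuous => i j; exact: Gc.
  have PG i j : continuous (fun v => P (G v) i j).
    move=> v; apply/cvgrPdist_le => e e0.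
    have e'0 : 0 < e / (L + 1) by rewrite divr_gt0// ltr_wpDl.
    have Gv : \forall w \near v, `|G v - G w| <= e / (L + 1).
      exact: (cvgrPdist_le _ _).1 (Gcont v) _ e'0.
    move: Gv; apply: filterS => w Gw.
    have -> : P (G v) i j - P (G w) i j = (P (G v) - P (G w)) i j by rewrite !mxE.
    apply: (le_trans (coord_norm_le _ i j)); apply: (le_trans (PL _ _)).
    apply: (le_trans (ler_wpM2l L0 Gw)).
    rewrite mulrCA ger_pMr// ler_pdivrMr ?ltr_wpDl//; lra.
  (* The margin 1 puts the closed range of [z] inside the open interval where the antiderivative is
     differentiable. *)
  have zab : z s - D - 1 <= z s + D + 1 by lra.
  have [H0 [H0c H0d]] := antiderivative_mx_exists zab PG.
  (* Normalised by [H (z s) = x s]: the difference [x - H \o z] starts at 0 and has derivative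
     [w *: (P x - P (G z))] almost everywhere, of norm at most [K * L] times the previous error. As
     [K * L * (t - s) <= 2^-1], the error is halved. *)
  pose H v := H0 v + (x s - H0 (z s)).
  have Hd v : z s - D <= v <= z s + D -> is_derive v (1 : R) H (P (G v)).
    move=> vD; rewrite -[P (G v)]addr0; apply: is_deriveD.
    by apply: H0d; lra.
  have HL v v' : z s - D <= v <= z s + D -> z s - D <= v' <= z s + D ->
      `|H v - H v'| <= B * `|v - v'|.
    wlog : v v' / v <= v' => [W vD v'D|vv' vD v'D].
      by case: (leP v v') => [|/ltW] vv'; [|rewrite distrC [`|v - _|]distrC]; apply: W.
    rewrite distrC [`|v - _|]distrC (ger0_norm (x := v' - v)) ?subr_ge0//.
    apply: (is_derive_increment_le (df := P \o G)) => // r rv.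
    by split; [apply: Hd; lra | exact: PB].
  exists H; split=> [i j v|r rst].
    rewrite (_ : (fun _ => _) = (fun v => H0 v i j + (x s - H0 (z s)) i j)).
      by apply: cvgD; [exact: H0c | exact: cvg_cst].
    by apply/funext => v'; rewrite /H mxE.
  have s_st : s <= s <= t by lra.
  have -> : x r - H (z r) = (x r - H (z r)) - (x s - H (z s)).
    by rewrite [H (z s)]addrC subrK subrr subr0.
  pose K' := D * 2^-1 ^+ n.
  have K'0 : 0 <= K' by rewrite mulr_ge0// exprn_ge0// invr_ge0.
  have le_sr : s <= r by lra.
  have KLK' : 0 <= K * (L * K') by apply: mulr_ge0 => //; apply: mulr_ge0.
  apply: (@le_trans _ _ (K * (L * K') * (r - s))).
    apply: (@lipschitz_ae_mx_derive_le _ _ _ (fun u => x u - H (z u)) s r (Lz + B * Lz)) => //.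
      move=> u v us vs; have ust : s <= u <= t by lra.
      have vst : s <= v <= t by lra.
      rewrite subrACA mulrDl.
      apply: (le_trans (ler_normB _ _)); rewrite lerD//; first exact: xL.
      apply: (le_trans (HL _ _ (zD _ ust) (zD _ vst))).
      by rewrite -mulrA ler_wpM2l//; exact: zL.
    apply: (ae_imp xz) => u uH us.
    have us' : s < u < r by move: us; rewrite in_itv.
    have ust : s <= u <= t by lra.
    have [|w [wK zu xu]] := uH; first by rewrite in_itv /=; lra.
    exists (w *: P (x u) - w *: P (G (z u))).
      by apply: is_deriveB; apply: is_derive_comp_scalar zu (Hd _ (zD _ ust)).
    rewrite -scalerBr normrZ; apply: ler_pM => //.
    by apply: (le_trans (PL _ _)); rewrite ler_wpM2l//; exact: xG.
  rewrite exprS [leRHS]mulrCA -/K'.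
  have -> : K * (L * K') * (r - s) = (K * L * (r - s)) * K' by ring.
  rewrite ler_wpM2r//; apply: le_trans KL.
  by rewrite ler_wpM2l ?mulr_ge0//; lra.
apply/eqP; rewrite -subr_eq0 -normr_le0.
apply/ler_addgt0Pr => e e0; rewrite add0r.
have half0 : 0 < (2^-1 : R) by rewrite invr_gt0.
have [n nP] : exists n, 2 * D * 2^-1 ^+ n <= e.
  have : (fun n => 2 * D * 2^-1 ^+ n : R) @ \oo --> (0 : R).
    rewrite -[X in _ --> X](mulr0 (2 * D)); apply: cvgMr.
    by apply: cvg_expr; rewrite ger0_norm; lra.
  move/cvgrPdist_le => /(_ e e0)[n _ /(_ n (leqnn n))].
  rewrite sub0r normrN => /(le_trans (ler_norm _)); by exists n.
(* As [z s = z t], one and the same value of [G] is close to both [x s] and [x t]. *)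
have [G [_ xG]] := key n.
have s_st : s <= s <= t by lra.
have t_st : s <= t <= t by lra.
rewrite -(subrKA (G (z s))); apply: (le_trans (ler_normD _ _)).
rewrite {2}zst [X in _ + X]distrC; apply: (le_trans (lerD (xG _ s_st) (xG _ t_st))).
by apply: le_trans nP; rewrite -mulrA mulr2n mulrDl !mul1r.
Qed.

End line_field.

Lemma continuous_atP (R : realType) (V W : normedModType R) (f : V -> W) (x : V) :
  {for x, continuous f} <->
  forall e, 0 < e -> exists2 d : R, 0 < d & forall y, `|y - x| < d -> `|f y - f x| <= e.
Proof.
split=> [/cvgrPdist_le fc e e0|H].
  have /nbhs_ballP[d /= d0 dP] := fc e e0.
  by exists d => // y yd; rewrite distrC; apply: dP; rewrite -ball_normE /= distrC.
apply/cvgrPdist_le => e e0; have [d d0 dP] := H e e0.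
apply/nbhs_ballP; exists d => //= y; rewrite -ball_normE /= distrC => yd.
by rewrite distrC; exact: dP.
Qed.

(** * Differentiable and locally Lipschitz maps *)

Section tame.
Context {R : realType} {V : normedModType R}.

Definition locally_lipschitz_at (W : normedModType R) (f : V -> W) (x0 : V) :=
  exists L d : R, [/\ 0 <= L, 0 < d & forall x y, `|x - x0| < d -> `|y - x0| < d ->
    `|f x - f y| <= L * `|x - y|].

(** Differentiability at the point feeds the chain rule, the Lipschitz bound around it feeds Picard
    iteration and the regularity of lifts. The class is stable under the operations of Cramer's
    formula, which yields the dual frame. *)
Definition tame (W : normedModType R) (f : V -> W) (x0 : V) :=
  differentiable f x0 /\ locally_lipschitz_at f x0.

Lemma locally_lipschitz_bounded (W : normedModType R) (f : V -> W) x0 :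
  locally_lipschitz_at f x0 -> exists L d B : R,
  [/\ 0 <= L, 0 < d, 0 <= B, forall x, `|x - x0| < d -> `|f x| <= B &
    forall x y, `|x - x0| < d -> `|y - x0| < d -> `|f x - f y| <= L * `|x - y|].
Proof.
move=> [L [d [L0 d0 fL]]]; exists L, d, (`|f x0| + L * d); split => //.
  by rewrite addr_ge0// mulr_ge0// ltW.
move=> x xd; rewrite -[f x](subrK (f x0)) addrC; apply: (le_trans (ler_normD _ _)).
rewrite lerD2l; apply: (le_trans (fL _ _ xd _)); first by rewrite subrr normr0.
by rewrite ler_wpM2l// ltW.
Qed.

Lemma tame_cst (W : normedModType R) (w : W) x0 : tame (fun=> w) x0.
Proof.
split; first exact: differentiable_cst.
by exists 0, 1; split => // x y _ _; rewrite subrr normr0 mul0r.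
Qed.

Lemma tameD (W : normedModType R) (f g : V -> W) x0 :
  tame f x0 -> tame g x0 -> tame (fun x => f x + g x) x0.
Proof.
move=> [df [L [d [L0 d0 fL]]]] [dg [M [e [M0 e0 gM]]]].
split; first exact: differentiableD.
exists (L + M), (Num.min d e); split; [exact: addr_ge0|by rewrite lt_min d0|].
move=> x y; rewrite !lt_min => /andP[xd xe] /andP[yd ye].
rewrite opprD addrACA mulrDl; apply: (le_trans (ler_normD _ _)).
by rewrite lerD// ?fL ?gM.
Qed.

Lemma tameM (f g : V -> R) x0 : tame f x0 -> tame g x0 -> tame (fun x => f x * g x) x0.
Proof.
move=> [df /locally_lipschitz_bounded[L [d [B [L0 d0 B0 fB fL]]]]].
move=> [dg /locally_lipschitz_bounded[M [e [C [M0 e0 C0 gC gM]]]]].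
split; first exact: differentiableM.
exists (B * M + L * C), (Num.min d e); split.
- by rewrite addr_ge0// mulr_ge0.
- by rewrite lt_min d0.
move=> x y; rewrite !lt_min => /andP[xd xe] /andP[yd ye].
have -> : f x * g x - f y * g y = f x * (g x - g y) + (f x - f y) * g y by ring.
apply: (le_trans (ler_normD _ _)); rewrite !normrM mulrDl lerD//.
  by rewrite -mulrA ler_pM ?normr_ge0 ?fB ?gM.
by rewrite mulrAC ler_pM ?normr_ge0 ?gC ?fL.
Qed.

Lemma locally_lipschitz_continuous (W : normedModType R) (f : V -> W) x0 :
  locally_lipschitz_at f x0 -> {for x0, continuous f}.
Proof.
move=> [L [d [L0 d0 fL]]]; apply/cvgrPdist_le => e e0.
have e'0 : 0 < e / (L + 1) by rewrite divr_gt0// ltr_wpDl.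
apply/nbhs_ballP; exists (Num.min d (e / (L + 1))); first by rewrite /= lt_min d0.
move=> x; rewrite -ball_normE /= lt_min => /andP[xd xe].
apply: (le_trans (fL _ _ _ _)); rewrite ?subrr ?normr0 1?distrC//.
rewrite distrC; apply: (le_trans (ler_wpM2l L0 (ltW xe))).
by rewrite mulrCA ger_pMr// ler_pdivrMr ?ltr_wpDl//; lra.
Qed.

Lemma tame_continuous (W : normedModType R) (f : V -> W) x0 :
  tame f x0 -> {for x0, continuous f}.
Proof. by case=> _; exact: locally_lipschitz_continuous. Qed.

Lemma tameV (f : V -> R) x0 : tame f x0 -> f x0 != 0 -> tame (fun x => (f x)^-1) x0.
Proof.
move=> ft fx0; have /cvgrPdist_lt fc := tame_continuous ft.
case: ft => [df [L [d [L0 d0 fL]]]].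
split; first exact: differentiableV.
pose m := `|f x0| / 2.
have m0 : 0 < m by rewrite divr_gt0// normr_gt0.
have /nbhs_ballP[e /= e0 eP] := fc _ m0.
have fm x : `|x - x0| < e -> m <= `|f x|.
  move=> xe; have := eP x; rewrite -ball_normE /= distrC => /(_ xe).
  have := ler_normB (f x0) (f x0 - f x); rewrite subKr.
  have := ler_normD (f x0 - f x) (f x); rewrite subrK /m; lra.
exists (L / (m * m)), (Num.min d e); split.
- by rewrite divr_ge0// ltW// mulr_gt0.
- by rewrite lt_min d0.
move=> x y; rewrite !lt_min => /andP[xd xe] /andP[yd ye].
have fxm := fm x xe; have fym := fm y ye.
have fx0' : f x != 0 by rewrite -normr_gt0; exact: lt_le_trans fxm.
have fy0' : f y != 0 by rewrite -normr_gt0; exact: lt_le_trans fym.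
have -> : (f x)^-1 - (f y)^-1 = - (f x - f y) / (f x * f y).
  by field; rewrite fx0' fy0'.
rewrite normrM normrN normfV normrM mulrAC ler_pM ?invr_ge0 ?mulr_ge0//.
  exact: fL.
by rewrite lef_pV2 ?posrE ?mulr_gt0 ?normr_gt0// ler_pM// ltW.
Qed.

Lemma tame_coord m n (f : V -> 'M[R]_(m, n)) x0 i j :
  tame f x0 -> tame (fun x => f x i j) x0.
Proof.
move=> [df [L [d [L0 d0 fL]]]]; split.
  exact: (differentiable_comp (g := fun M : 'M[R]_(m, n) => M i j) df
    (differentiable_coord _ _ _)).
exists L, d; split => // x y xd yd; apply: le_trans (fL x y xd yd).
by apply: le_trans (coord_norm_le _ i j); rewrite !mxE.
Qed.

Lemma tame_sum (I : Type) (r : seq I) (P : pred I) (F : I -> V -> R) x0 :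
  (forall i, tame (F i) x0) -> tame (fun x => \sum_(i <- r | P i) F i x) x0.
Proof.
move=> Ft; elim: r => [|i r IH].
  by under eq_fun do rewrite big_nil; exact: tame_cst.
under eq_fun do rewrite big_cons; case: (P i) => //; exact: tameD.
Qed.

Lemma tame_prod (I : Type) (r : seq I) (P : pred I) (F : I -> V -> R) x0 :
  (forall i, tame (F i) x0) -> tame (fun x => \prod_(i <- r | P i) F i x) x0.
Proof.
move=> Ft; elim: r => [|i r IH].
  by under eq_fun do rewrite big_nil; exact: tame_cst.
under eq_fun do rewrite big_cons; case: (P i) => //; exact: tameM.
Qed.

Lemma tame_det n (A : V -> 'M[R]_n) x0 :
  (forall i j, tame (fun x => A x i j) x0) -> tame (fun x => \det (A x)) x0.
Proof.
move=> At; apply: tame_sum => s; apply: tameM; first exact: tame_cst.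
by apply: tame_prod => i; exact: At.
Qed.

(** Cramer's formula involves only sums, products and the reciprocal of the determinant. *)
Lemma tame_invmx n (A : V -> 'M[R]_n) x0 i j :
  (forall i j, tame (fun x => A x i j) x0) -> \det (A x0) != 0 ->
  tame (fun x => ((\det (A x))^-1 *: \adj (A x)) i j) x0.
Proof.
move=> At detA; under eq_fun do rewrite !mxE.
apply: tameM; first by apply: tameV => //; exact: tame_det.
apply: tameM; first exact: tame_cst.
by apply: tame_det => k l; under eq_fun do rewrite !mxE; exact: At.
Qed.

End tame.

(** * Smooth maps: Lipschitz bounds and symmetry of second derivatives *)

Section smooth.
Context {R : realType}.
Local Notation E := 'rV[R]_4.

Lemma differential_delta (V : normedModType R) (f : E -> V) x v :
  'd f x v = \sum_(j < 4) v 0 j *: 'd f x (delta_mx 0 j).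
Proof.
rewrite {1}[v]row_sum_delta linear_sum.
by apply: eq_bigr => j _; rewrite linearZ.
Qed.

Lemma smooth_on_differentiable (V : normedModType R) (U : set E) (f : E -> V) x :
  smooth_on U f -> U x -> differentiable f x.
Proof. by move=> fs Ux; have [df _] := fs 1%N; exact: df. Qed.

Lemma smooth_on_continuous (V : normedModType R) (U : set E) (f : E -> V) x :
  smooth_on U f -> U x -> {for x, continuous f}.
Proof. by move=> fs Ux; exact: (fs 0%N). Qed.

Lemma smooth_on_derive (V : normedModType R) (U : set E) (f : E -> V) v :
  smooth_on U f -> smooth_on U (fun x => 'D_v f x).
Proof. by move=> fs k; have [_] := fs k.+1; exact. Qed.

Lemma open_ball_sub (V : normedModType R) (U : set V) x : open U -> U x ->
  exists2 d : R, 0 < d & forall y, `|y - x| < d -> U y.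
Proof.
move=> oU Ux; have /nbhs_ballP[d /= d0 dU] := open_nbhs_nbhs (conj oU Ux).
by exists d => // y yx; apply: dU; rewrite -ball_normE /= distrC.
Qed.

(** The partial derivatives are continuous, hence bounded on a ball, and the mean value inequality
    applies along the chords of that convex set. *)
Lemma smooth_on_tame (V : normedModType R) (U : set E) (f : E -> V) x0 :
  open U -> smooth_on U f -> U x0 -> tame f x0.
Proof.
move=> oU fs Ux0; split; first exact: smooth_on_differentiable fs Ux0.
have [d d0 dU] := open_ball_sub oU Ux0.
pose De y (j : 'I_4) := 'D_(delta_mx 0 j) f y.
(* Packing the four differences into one row yields a single radius for all partial derivatives. *)
have DeC : {for x0, continuous (fun y => \row_j `|De y j - De x0 j|)}.
  apply: mx_continuous => i j.
  rewrite (_ : (fun y => _) = (fun y => `|De y j - De x0 j|)); last first.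
    by apply/funext => y; rewrite mxE.
  have Dc := smooth_on_continuous (smooth_on_derive (delta_mx 0 j) fs) Ux0.
  apply/continuous_atP => e e0; have [r r0 rP] := (continuous_atP _ _).1 Dc e e0.
  by exists r => // y yr; rewrite subrr normr0 subr0 normr_id; exact: rP.
have [e e0 eP] := (continuous_atP _ _).1 DeC 1 ltr01.
have {}eP y j : `|y - x0| < e -> `|De y j - De x0 j| <= 1.
  move=> ye; have := le_trans (coord_norm_le _ 0 j) (eP y ye).
  by rewrite !mxE subrr normr0 subr0 normr_id.
pose C := \sum_(j < 4) (`|De x0 j| + 1).
have C0 : 0 <= C by apply: sumr_ge0 => j _; rewrite addr_ge0.
exists C, (Num.min d e); split => //; first by rewrite lt_min d0.
move=> x y xd yd.
have convex s : 0 <= s <= 1 -> `|y + s *: (x - y) - x0| < Num.min d e.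
  move=> s01; have -> : y + s *: (x - y) - x0 = (1 - s) *: (y - x0) + s *: (x - x0).
    by apply/matrixP => i j; rewrite !mxE; ring.
  apply: (le_lt_trans (ler_normD _ _)); rewrite !normrZ.
  rewrite !ger0_norm; try lra.
  have [->|s0] := eqVneq s 0; first by rewrite subr0 mul1r mul0r addr0.
  have s_gt0 : 0 < s by rewrite lt_neqAle eq_sym s0; lra.
  have -> : Num.min d e = (1 - s) * Num.min d e + s * Num.min d e by ring.
  apply: ler_ltD; last by rewrite ltr_pM2l.
  by apply: ler_wpM2l; [lra | exact: ltW].
have -> : f x - f y = (fun s => f (y + s *: (x - y))) 1 - (fun s => f (y + s *: (x - y))) 0.
  by rewrite scale1r scale0r addr0 [y + _]addrC subrK.
rewrite -[X in _ <= X]mulr1 -[X in _ * X](subr0 1).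
apply: (@is_derive_increment_le _ _ (fun s => f (y + s *: (x - y)))
  (fun s => 'D_(x - y) f (y + s *: (x - y))) 0 1) => // s s01.
have := convex s s01; rewrite lt_min => /andP[sd se].
have fd : differentiable f (y + s *: (x - y)).
  by apply: smooth_on_differentiable fs _; exact: dU.
split; first exact: is_derive_line.
rewrite deriveE// differential_delta mulr_suml.
apply: (le_trans (ler_norm_sum _ _ _)); apply: ler_sum => j _.
rewrite normrZ mulrC ler_pM// ?coord_norm_le//.
rewrite -deriveE//.
rewrite -/(De _ j) -[De _ j](subrK (De x0 j)) addrC; apply: (le_trans (ler_normD _ _)).
by rewrite lerD2l; exact: eP.
Qed.

(** Two nested mean value inequalities, along [v] and along [w]. A linear correction by [A] is
    subtracted at each level, so that only the oscillation of the mixed derivative about its value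
    at [x] remains to be bounded. *)
Lemma second_difference (V : normedModType R) (U : set E) (f : E -> V) (x v w : E) (e : R) :
  open U -> smooth_on U f -> U x -> 0 < e ->
  exists2 d : R, 0 < d & forall h, 0 < h -> h < d ->
    `|f (x + h *: v + h *: w) - f (x + h *: v) - (f (x + h *: w) - f x)
      - (h * h) *: 'D_w (fun y => 'D_v f y) x| <= e * (h * h).
Proof.
move=> oU fs Ux e0.
have [d d0 dU] := open_ball_sub oU Ux.
set A := 'D_w _ x.
have Ac : {for x, continuous (fun y => 'D_w (fun y => 'D_v f y) y)}.
  exact: smooth_on_continuous (smooth_on_derive w (smooth_on_derive v fs)) Ux.
have [r r0 rP] := (continuous_atP _ _).1 Ac e e0.
pose m := Num.min d r.
have m0 : 0 < m by rewrite lt_min d0.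
pose N := `|v| + `|w| + 1.
have N0 : 0 < N by rewrite ltr_wpDl// addr_ge0.
exists (m / N); first exact: divr_gt0.
move=> h h0 hm.
have inU s t : 0 <= s <= h -> 0 <= t <= h -> `|x + s *: v + t *: w - x| < m.
  move=> sh th; have -> : x + s *: v + t *: w - x = s *: v + t *: w.
    by rewrite -(addrA x) (addrC x) addrK.
  apply: (le_lt_trans (ler_normD _ _)); rewrite !normrZ.
  rewrite (ger0_norm (x := s)); last by lra.
  rewrite (ger0_norm (x := t)); last by lra.
  move: hm; rewrite ltr_pdivlMr// => hm; apply: le_lt_trans hm.
  have sv : s * `|v| <= h * `|v| by apply: ler_wpM2r => //; lra.
  have tw : t * `|w| <= h * `|w| by apply: ler_wpM2r => //; lra.
  by rewrite /N; move: sv tw h0; clear; lra.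
have Ud y : `|y - x| < m -> `|y - x| < d by rewrite lt_min => /andP[].
pose phi s := f (x + s *: v + h *: w) - f (x + s *: v) - (s * h) *: A.
have -> : f (x + h *: v + h *: w) - f (x + h *: v) - (f (x + h *: w) - f x)
      - (h * h) *: A = phi h - phi 0.
  by rewrite /phi mul0r !scale0r subr0 addr0 addrAC.
rewrite mulrA -[X in _ <= _ * X](subr0 h).
pose chi s r := 'D_v f (x + s *: v + r *: w) - r *: A.
have hh : 0 <= h <= h by rewrite lexx ltW.
have h00 : (0 : R) <= 0 <= h by rewrite lexx ltW.
apply: (is_derive_increment_le (df := fun s => chi s h - chi s 0)); first exact: ltW.
move=> s sh; split.
  rewrite /phi (_ : chi s h - chi s 0 =
    'D_v f (x + s *: v + h *: w) - 'D_v f (x + s *: v) - h *: A); last first.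
    by rewrite /chi !scale0r subr0 addr0 addrAC.
  apply: is_deriveB; first apply: is_deriveB.
  - have -> : (fun s => f (x + s *: v + h *: w)) = (fun s => f ((x + h *: w) + s *: v)).
      by apply/funext => u; rewrite addrAC.
    rewrite (addrAC x); apply: is_derive_line.
    apply: smooth_on_differentiable fs _; apply/dU/Ud.
    by rewrite (addrAC x); exact: (inU s h sh hh).
  - apply: is_derive_line.
    apply: smooth_on_differentiable fs _; apply/dU/Ud.
    by have := inU s 0 sh h00; rewrite scale0r addr0.
  - apply/is_derive1P => e1 e10; exists 1 => // u _.
    by rewrite -scalerBl -mulrBl -scalerA subrr normr0 mulr_ge0// ltW.
rewrite -[X in _ <= _ * X](subr0 h).
apply: (is_derive_increment_le (df := fun r =>
  'D_w (fun y => 'D_v f y) (x + s *: v + r *: w) - A)); first exact: ltW.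
move=> t th; have st := inU s t sh th; split.
  apply: is_deriveB.
    apply: is_derive_line.
    apply: smooth_on_differentiable (smooth_on_derive v fs) _.
    exact/dU/Ud.
  apply/is_derive1P => e1 e10; exists 1 => // u _.
  by rewrite -scalerBl subrr normr0 mulr_ge0// ltW.
by apply: rP; apply: lt_le_trans st _; rewrite ge_min lexx orbT.
Qed.

(** The second difference is symmetric in [v] and [w], and divided by [h * h] it lies within [e / 2]
    of either mixed derivative. *)
Lemma derive_symmetric (V : normedModType R) (U : set E) (f : E -> V) (x v w : E) :
  open U -> smooth_on U f -> U x ->
  'D_w (fun y => 'D_v f y) x = 'D_v (fun y => 'D_w f y) x.
Proof.
move=> oU fs Ux; apply/eqP; rewrite -subr_eq0 -normr_le0.
apply/ler_addgt0Pr => e e0; rewrite add0r.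
have e20 : 0 < e / 2 by rewrite divr_gt0.
have [d d0 dP] := second_difference v w oU fs Ux e20.
have [d' d'0 d'P] := second_difference w v oU fs Ux e20.
pose h := Num.min d d' / 2.
have m0 : 0 < Num.min d d' by rewrite lt_min d0.
have h0 : 0 < h by rewrite divr_gt0.
have hd : h < d.
  by apply: lt_le_trans (_ : Num.min d d' <= d); rewrite ?ge_min ?lexx// /h; lra.
have hd' : h < d'.
  by apply: lt_le_trans (_ : Num.min d d' <= d'); rewrite ?ge_min ?lexx ?orbT// /h; lra.
have := d'P h h0 hd'; have := dP h h0 hd.
set A := 'D_w _ x; set B := 'D_v _ x.
have -> : f (x + h *: w + h *: v) - f (x + h *: w) - (f (x + h *: v) - f x) =
   f (x + h *: v + h *: w) - f (x + h *: v) - (f (x + h *: w) - f x).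
  by rewrite subrACA [x + h *: w + _]addrAC.
set D := _ - (_ - f x) => DA DB.
have hh0 : 0 < h * h by rewrite mulr_gt0.
rewrite -(ler_pM2l hh0) -{1}(gtr0_norm hh0) -normrZ scalerBr.
have -> : (h * h) *: A - (h * h) *: B = (D - (h * h) *: B) - (D - (h * h) *: A).
  by rewrite subrACA subrr sub0r opprB.
apply: (le_trans (ler_normB _ _)).
by apply: (le_trans (lerD DB DA)); rewrite -mulrDl -splitr mulrC.
Qed.

End smooth.

(** * Arcs tangent to a vector field *)

Section flow_lines.
Context {R : realType}.
Local Notation E := 'rV[R]_4.
Local Notation mu := (@lebesgue_measure R).

Lemma locally_lipschitz_mx (V : normedModType R) m n (f : V -> 'M[R]_(m, n)) x0 :
  (forall i j, locally_lipschitz_at (fun x => f x i j) x0) -> locally_lipschitz_at f x0.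
Proof.
move=> fL.
have /choice[L LP] : forall ij : 'I_m * 'I_n, exists L : R, exists d : R,
    [/\ 0 <= L, 0 < d & forall x y, `|x - x0| < d -> `|y - x0| < d ->
      `|f x ij.1 ij.2 - f y ij.1 ij.2| <= L * `|x - y|].
  by move=> ij; exact: fL.
have /choice[d dP] := LP.
(* [D^-1] is a radius below every [d ij]; the summand 1 keeps [D] positive for an empty matrix. *)
pose D := 1 + \sum_ij (d ij)^-1.
have d0 ij : 0 < d ij by have [] := dP ij.
have L0 ij : 0 <= L ij by have [] := dP ij.
have D0 : 0 < D by rewrite ltr_pwDl// sumr_ge0// => ij _; rewrite invr_ge0 ltW.
have Dd ij : D^-1 <= d ij.
  rewrite -[d ij]invrK lef_pV2 ?posrE ?invr_gt0//.
  rewrite /D (bigD1 ij)//= addrCA lerDl addr_ge0//.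
  by apply: sumr_ge0 => kl _; rewrite invr_ge0 ltW.
exists (\sum_ij L ij), D^-1; split; [exact: sumr_ge0 | by rewrite invr_gt0|].
move=> x y xD yD; apply: mx_norm_le.
  by apply: mulr_ge0 => //; exact: sumr_ge0.
move=> i j; have [_ _ /(_ x y)] := dP (i, j).
rewrite !mxE => /(_ (lt_le_trans xD (Dd _)) (lt_le_trans yD (Dd _))).
move/le_trans; apply; rewrite ler_wpM2r// (bigD1 (i, j))//= lerDl.
exact: sumr_ge0.
Qed.

(** Dividing the field by its component [j] makes that coordinate the parameter, and the measurable
    factor [w] disappears. The radius [d] depends on the field, the point and the bound [c] but not
    on the arc, so it serves all short arcs near the point. *)
Lemma flow_line_recurrence (f : E -> E) (x0 : E) (j : 'I_4) (c : R) :
  tame f x0 -> f x0 0 j != 0 -> 0 <= c ->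
  exists2 d : R, 0 < d & forall (x : R -> E) (s t L : R), s <= t -> t - s <= d ->
    (forall r, s <= r <= t -> `|x r - x0| < d) ->
    (forall r r', s <= r <= t -> s <= r' <= t -> `|x r - x r'| <= L * `|r - r'|) ->
    {ae mu, forall r, r \in `]s, t[ -> exists2 w : R, `|w| <= c &
       is_derive r (1 : R) x (w *: f (x r))} ->
    x s 0 j = x t 0 j -> x s = x t.
Proof.
move=> ft fj0 c0.
pose P0 y := (f y 0 j)^-1 *: f y.
have fjt : tame (fun y => f y 0 j) x0 by exact: tame_coord.
have P0L : locally_lipschitz_at P0 x0.
  apply: locally_lipschitz_mx => i k.
  rewrite (_ : (fun _ => _) = (fun y => (f y 0 j)^-1 * f y i k)); last first.
    by apply/funext => y; rewrite mxE.
  have [] // : tame (fun y => (f y 0 j)^-1 * f y i k) x0.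
  by apply: tameM; [exact: tameV | exact: tame_coord].
have [L [d1 [B [L0 d10 B0 PB PL]]]] := locally_lipschitz_bounded P0L.
have [_ [d2 [B2 [_ d20 B20 fB _]]]] := locally_lipschitz_bounded ft.2.
have nz0 : 0 < `|f x0 0 j| / 2 by rewrite divr_gt0// normr_gt0.
have [d3 d30 d3P] := (continuous_atP _ _).1 (tame_continuous fjt) _ nz0.
have nz y : `|y - x0| < d3 -> f y 0 j != 0.
  move=> /d3P; apply: contraTneq => ->; rewrite sub0r normrN -ltNge; lra.
(* Precomposing with [clampE] makes the locally Lipschitz [P0] globally Lipschitz. *)
pose clampE (y : E) : E := \row_i clamp (x0 0 i - d1 / 2) (x0 0 i + d1 / 2) (y 0 i).
have clampL y y' : `|clampE y - clampE y'| <= `|y - y'|.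
  apply: mx_norm_le => // i k; rewrite !mxE.
  apply: (le_trans (clamp_lipschitz _ _ _)); first by lra.
  by have := coord_norm_le (y - y') 0 k; rewrite !mxE.
have clampB y : `|clampE y - x0| < d1.
  have le1 : `|clampE y - x0| <= d1 / 2.
    apply: mx_norm_le => [|i k]; first by lra.
    rewrite !mxE (ord1 i).
    have le2 : x0 0 k - d1 / 2 <= x0 0 k + d1 / 2 by lra.
    by have := clamp_itv (y 0 k) le2; rewrite ler_norml; lra.
  by apply: le_lt_trans le1 _; lra.
have clampI y : `|y - x0| <= d1 / 2 -> clampE y = y.
  move=> yx; apply/rowP => k; rewrite !mxE clamp_id//.
  have := le_trans (coord_norm_le (y - x0) 0 k) yx.
  by rewrite !mxE ler_norml; lra.
(* Bounds the derivative of the transverse coordinate, which is [w] times component [j] of the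
   field. *)
pose K := c * B2.
have K0 : 0 <= K by exact: mulr_ge0.
have KL0 : 0 <= K * L by exact: mulr_ge0.
(* Makes [K * L * d4] at most 1/2, as the contraction requires. *)
pose d4 := (2 * (K * L + 1))^-1.
have d40 : 0 < d4 by rewrite invr_gt0 mulr_gt0// ltr_wpDl.
pose d := Num.min (Num.min (d1 / 2) d2) (Num.min d3 d4).
have dd1 : d <= d1 / 2 by rewrite !ge_min lexx.
have dd2 : d <= d2 by rewrite !ge_min lexx !orbT.
have dd3 : d <= d3 by rewrite !ge_min lexx !orbT.
have dd4 : d <= d4 by rewrite !ge_min lexx !orbT.
exists d; first by rewrite !lt_min d20 d30 d40 divr_gt0.
move=> x s t Lx st std xd xL xf xst.
apply: (@line_field_curve_eq _ (P0 \o clampE) x (fun r => x r 0 j) s t L B K Lx) => //.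
- by move=> y y' /=; apply: le_trans (PL _ _ _ _) _ => //; rewrite ler_wpM2l.
- by move=> y /=; exact: PB.
- move=> r r' rst rst'; apply: le_trans (xL r r' rst rst').
  by have := coord_norm_le (x r - x r') 0 j; rewrite !mxE.
- apply: (ae_imp xf) => r /[swap] rst.
  have rst' : s <= r <= t by move: rst; rewrite in_itv /=; lra.
  have xrd := xd r rst'.
  move=> /(_ rst)[w wc xr].
  exists (w * f (x r) 0 j); split.
  + rewrite normrM; apply: ler_pM => //; apply: le_trans (coord_norm_le _ _ _) _.
    by apply: fB; exact: lt_le_trans xrd dd2.
  + by apply: is_derive_eq; [exact: is_derive_coord xr | rewrite mxE].
  + rewrite (_ : (w * _) *: _ = w *: f (x r))//=.
    rewrite clampI; last by apply/ltW/(lt_le_trans xrd).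
    rewrite /P0 scalerA mulfK//; apply: nz; exact: lt_le_trans xrd dd3.
- have : K * L * (t - s) <= K * L * d4 by rewrite ler_wpM2l//; lra.
  move/le_trans; apply; rewrite /d4 invfM mulrCA ger_pMr ?invr_gt0//.
  by rewrite ler_pdivrMr ?ltr_wpDl// mul1r; lra.
Qed.

End flow_lines.

(** * Charts, brackets and covectors *)

Section pairing.
Context {R : realType}.
Local Notation E := 'rV[R]_4.

Lemma pairingE (l v : E) : pairing l v = (l *m v^T) 0 0.
Proof. by rewrite mxE; apply: eq_bigr => i _; rewrite mxE. Qed.

Lemma pairingDl (l l' v : E) : pairing (l + l') v = pairing l v + pairing l' v.
Proof. by rewrite !pairingE mulmxDl mxE. Qed.

Lemma pairingZl a (l v : E) : pairing (a *: l) v = a * pairing l v.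
Proof. by rewrite !pairingE -scalemxAl mxE. Qed.

Lemma pairingDr (l v v' : E) : pairing l (v + v') = pairing l v + pairing l v'.
Proof. by rewrite !pairingE linearD mulmxDr mxE. Qed.

Lemma pairingZr a (l v : E) : pairing l (a *: v) = a * pairing l v.
Proof. by rewrite !pairingE linearZ -scalemxAr mxE. Qed.

Lemma pairingNr (l v : E) : pairing l (- v) = - pairing l v.
Proof. by rewrite -scaleN1r pairingZr mulN1r. Qed.

Lemma pairing0l (v : E) : pairing 0 v = 0.
Proof. by rewrite pairingE mul0mx mxE. Qed.

Lemma pairing_delta (l : E) i : pairing l (delta_mx 0 i) = l 0 i.
Proof.
rewrite /pairing (bigD1 i)//= mxE !eqxx mulr1 big1 ?addr0// => j /negPf ji.
by rewrite mxE ji andbF mulr0.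
Qed.

Lemma pairing_ext (l l' : E) : (forall v, pairing l v = pairing l' v) -> l = l'.
Proof. by move=> H; apply/rowP => i; have := H (delta_mx 0 i); rewrite !pairing_delta. Qed.

End pairing.

Section calculus.
Context {R : realType}.
Local Notation E := 'rV[R]_4.

Lemma near_diff_eq (V W : normedModType R) (f g : V -> W) (x v : V) :
  differentiable f x -> differentiable g x -> (\near x, f x = g x) ->
  'd f x v = 'd g x v.
Proof. by move=> df dg fg; rewrite -!deriveE//; exact: near_eq_derive. Qed.

Lemma near_eq_continuous (V W : normedModType R) (f g : V -> W) (x : V) :
  {for x, continuous g} -> (\near x, f x = g x) -> {for x, continuous f}.
Proof.
move=> /continuous_atP gc fg; apply/continuous_atP => e e0.
have [d d0 dP] := gc e e0; have /nbhs_ballP[r /= r0 rP] := fg.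
exists (Num.min d r); first by rewrite lt_min d0.
move=> y; rewrite lt_min => /andP[yd yr].
rewrite (nbhs_singleton fg) rP; first exact: dP.
by rewrite -ball_normE /= distrC.
Qed.

Lemma is_derive_scale (V : normedModType R) m n (g : V -> R) (f : V -> 'M[R]_(m, n))
    (x v : V) (dg : R) (df : 'M[R]_(m, n)) :
  is_derive x v (g : V -> R^o) dg -> is_derive x v f df ->
  is_derive x v (fun y => g y *: f y) (dg *: f x + g x *: df).
Proof.
move=> gx fx; apply: is_derive_mx => i j.
rewrite (_ : (fun _ => _) = (g : V -> R^o) * (fun y => f y i j)); last first.
  by apply/funext => y; rewrite mxE.
have fij := is_derive_coord i j fx.
by apply: is_derive_eq; rewrite !mxE /GRing.scale /= addrC [f x i j * _]mulrC.
Qed.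

Lemma is_derive_sum_fun (V W : normedModType R) n (h : 'I_n -> V -> W) (x v : V)
    (dh : 'I_n -> W) :
  (forall i, is_derive x v (h i) (dh i)) ->
  is_derive x v (fun y => \sum_(i < n) h i y) (\sum_(i < n) dh i).
Proof.
move=> H; have -> : (fun y => \sum_(i < n) h i y) = \sum_(i < n) h i.
  by apply/funext => y; rewrite fct_sumE.
exact: is_derive_sum.
Qed.

Lemma is_derive_diff (V W : normedModType R) (f : V -> W) (x v : V) :
  differentiable f x -> is_derive x v f ('d f x v).
Proof. by move=> fx; split; [exact: diff_derivable | exact: deriveE]. Qed.

(** The second differential as a bilinear form, written with iterated partial derivatives since
    these are what [smooth_on] provides. *)
Definition hessian (f : E -> E) (y v w : E) : E :=
  \sum_(j < 4) \sum_(k < 4) (v 0 j * w 0 k) *: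
    'D_(delta_mx 0 k) (fun y => 'D_(delta_mx 0 j) f y) y.

Lemma hessianC (U : set E) (f : E -> E) (y v w : E) :
  open U -> smooth_on U f -> U y -> hessian f y v w = hessian f y w v.
Proof.
move=> oU fs Uy; rewrite /hessian exchange_big; apply: eq_bigr => j _.
by apply: eq_bigr => k _; rewrite mulrC (derive_symmetric _ _ oU fs Uy).
Qed.

(** Product rule. The Hessian term is the obstruction to differentiating vector fields independently
    of the chart; its symmetry makes it cancel in brackets. *)
Lemma derive_pushforward (U : set E) (f A : E -> E) (y w : E) :
  open U -> smooth_on U f -> U y -> differentiable A y ->
  'D_w (fun z => 'd f z (A z)) y = 'd f y ('d A y w) + hessian f y (A y) w.
Proof.
move=> oU fs Uy Ad.
have -> : 'D_w (fun z => 'd f z (A z)) y =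
    'D_w (fun z => \sum_(j < 4) A z 0 j *: 'D_(delta_mx 0 j) f z) y.
  apply: near_eq_derive; have := open_nbhs_nbhs (conj oU Uy).
  apply: filterS => z Uz; rewrite differential_delta; apply: eq_bigr => j _.
  by rewrite deriveE//; exact: smooth_on_differentiable fs Uz.
have H : is_derive y w (fun z => \sum_(j < 4) A z 0 j *: 'D_(delta_mx 0 j) f z)
  (\sum_(j < 4) (('d A y w) 0 j *: 'D_(delta_mx 0 j) f y +
     A y 0 j *: 'd (fun z => 'D_(delta_mx 0 j) f z) y w)).
  apply: is_derive_sum_fun => j; apply: is_derive_scale.
    exact/is_derive_coord/is_derive_diff.
  apply: is_derive_diff; exact: smooth_on_differentiable (smooth_on_derive _ fs) Uy.
rewrite (@derive_val _ _ _ _ _ _ _ H) big_split /=; congr (_ + _).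
  rewrite [RHS]differential_delta; apply: eq_bigr => j _.
  by rewrite deriveE//; exact: smooth_on_differentiable fs Uy.
apply: eq_bigr => j _; rewrite differential_delta scaler_sumr.
apply: eq_bigr => k _; rewrite scalerA deriveE//.
exact: smooth_on_differentiable (smooth_on_derive _ fs) Uy.
Qed.

End calculus.

Section charts.
Context {R : realType} {M : manifold4 R}.
Local Notation E := 'rV[R]_4.
Implicit Types (c : chart R M) (p : M).

Lemma chart_image_open c (U : set M) : open U -> open (cmap c @` (U `&` cdom c)).
Proof.
move=> oU; rewrite openE => x [p [Up cp] <-].
have im : (cmap c @` cdom c) (cmap c p) by exists p.
have n1 := open_nbhs_nbhs (conj (@cimg_open _ _ c) im).
have n2 : nbhs (cmap c p) (cinv c @^-1` U).
  apply: (cinv_continuous im); rewrite cmapK//.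
  exact: open_nbhs_nbhs.
apply: filterS (filterI n1 n2) => y [[r cr <-]] /=; rewrite cmapK// => Ur.
by exists r.
Qed.

Definition dtransition c c' p : E -> E := 'd (cmap c' \o cinv c) (cmap c p).

Lemma transition_domain_open c c' : open (cmap c @` (cdom c `&` cdom c')).
Proof. by rewrite setIC; apply: chart_image_open; exact: (@cdom_open _ _ c'). Qed.

Lemma transition_differentiable c c' p : atlas c -> atlas c' -> cdom c p -> cdom c' p ->
  differentiable (cmap c' \o cinv c) (cmap c p).
Proof.
by move=> ac ac' cp c'p; apply: smooth_on_differentiable (transition_smooth ac ac') _; exists p.
Qed.

Lemma dtransition_comp c1 c2 c3 p v : atlas c1 -> atlas c2 -> atlas c3 ->
  cdom c1 p -> cdom c2 p -> cdom c3 p ->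
  dtransition c2 c3 p (dtransition c1 c2 p v) = dtransition c1 c3 p v.
Proof.
move=> a1 a2 a3 p1 p2 p3; rewrite /dtransition.
have d12 := transition_differentiable a1 a2 p1 p2.
have d13 := transition_differentiable a1 a3 p1 p3.
have d23 : differentiable (cmap c3 \o cinv c2) ((cmap c2 \o cinv c1) (cmap c1 p)).
  by rewrite /= cmapK//; exact: transition_differentiable.
have H : 'd ((cmap c3 \o cinv c2) \o (cmap c2 \o cinv c1)) (cmap c1 p) v =
    'd (cmap c3 \o cinv c1) (cmap c1 p) v.
  apply: near_diff_eq => //; first exact: differentiable_comp.
  have im : (cmap c1 @` (cdom c1 `&` cdom c2)) (cmap c1 p) by exists p.
  apply: filterS (open_nbhs_nbhs (conj (@transition_domain_open c1 c2) im)).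
  by move=> _ [r [r1 r2] <-] /=; rewrite cmapK// cmapK.
have H2 := esym (congr1 (@^~ v) (diff_comp d12 d23)).
have E2 : (cmap c2 \o cinv c1) (cmap c1 p) = cmap c2 p by rewrite /= cmapK.
rewrite E2 /= in H2; exact: (etrans H2 H).
Qed.

Lemma dtransition_id c p v : atlas c -> cdom c p -> dtransition c c p v = v.
Proof.
move=> ac cp.
have H : dtransition c c p v = 'd (@id E) (cmap c p) v.
  apply: near_diff_eq; first exact: transition_differentiable.
    exact: ex_diff.
  have im : (cmap c @` cdom c) (cmap c p) by exists p.
  apply: filterS (open_nbhs_nbhs (conj (@cimg_open _ _ c) im)).
  by move=> _ [r cr <-] /=; rewrite cmapK.
by apply: (etrans H); rewrite diff_val.
Qed.

Lemma tcoordE c p v : tcoord c p v = dtransition (chart_at p) c p v.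
Proof. by []. Qed.

Lemma vf_inE c (X : vfield M) p : cdom c p -> vf_in c X (cmap c p) = tcoord c p (X p).
Proof. by move=> cp; rewrite /vf_in cmapK. Qed.

Lemma tcoord_chart_at p v : tcoord (chart_at p) p v = v.
Proof. by apply: dtransition_id; [exact: chart_at_atlas | exact: chart_at_dom]. Qed.

Lemma vf_in_chart_at (X : vfield M) p : vf_in (chart_at p) X (cmap (chart_at p) p) = X p.
Proof. by rewrite vf_inE ?tcoord_chart_at//; exact: chart_at_dom. Qed.

Lemma pairing_ccoord c p l w : pairing (ccoord c p l) w =
  pairing l (dtransition c (chart_at p) p w).
Proof.
rewrite !pairingE -mulmxA -trmx_mul; congr ((_ *m _^T) _ _).
by rewrite /jacobian mul_rV_lin1.
Qed.

Lemma pairing_ccoord_tcoord c p l v : atlas c -> cdom c p ->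
  pairing (ccoord c p l) (tcoord c p v) = pairing l v.
Proof.
move=> ac cp; rewrite pairing_ccoord tcoordE dtransition_comp//;
  try exact: chart_at_atlas; try exact: chart_at_dom.
by rewrite -tcoordE tcoord_chart_at.
Qed.

Lemma pairing_ccoord_vf_in c (X : vfield M) p l : atlas c -> cdom c p ->
  pairing (ccoord c p l) (vf_in c X (cmap c p)) = pairing l (X p).
Proof. by move=> ac cp; rewrite vf_inE// pairing_ccoord_tcoord. Qed.

Lemma ccoord_chart_at p l : ccoord (chart_at p) p l = l.
Proof.
apply: pairing_ext => v; rewrite pairing_ccoord dtransition_id//.
  exact: chart_at_atlas.
exact: chart_at_dom.
Qed.

Lemma ccoordD c p l l' : ccoord c p (l + l') = ccoord c p l + ccoord c p l'.
Proof. exact: mulmxDl. Qed.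

Lemma ccoordZ c p a l : ccoord c p (a *: l) = a *: ccoord c p l.
Proof. by rewrite /ccoord -scalemxAl. Qed.

Lemma smooth_vf_in c (U : set M) (X : vfield M) p : atlas c -> smooth_vf U X -> U p ->
  cdom c p -> smooth_on (cmap c @` (U `&` cdom c)) (vf_in c X) /\
    (cmap c @` (U `&` cdom c)) (cmap c p).
Proof. by move=> ac Xs Up cp; split; [exact: Xs | exists p]. Qed.

Lemma vf_in_tame c (U : set M) (X : vfield M) p : atlas c -> open U -> smooth_vf U X ->
  U p -> cdom c p -> tame (vf_in c X) (cmap c p).
Proof.
move=> ac oU Xs Up cp; have [Xc im] := smooth_vf_in ac Xs Up cp.
exact: smooth_on_tame (@chart_image_open c U oU) Xc im.
Qed.

(** The bracket in a chart that stays fixed while the point moves, whereas [lie_bracket] changes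
    chart with the point. *)
Definition bracket_in c (X Y : vfield M) (x : E) : E :=
  'd (vf_in c Y) x (vf_in c X x) - 'd (vf_in c X) x (vf_in c Y x).

Lemma vf_in_derivative_transition c c' (U : set M) (X Y : vfield M) p :
  atlas c -> atlas c' -> open U -> smooth_vf U X -> U p -> cdom c p -> cdom c' p ->
  'd (vf_in c X) (cmap c p) (tcoord c p (Y p)) =
  dtransition c' c p ('d (vf_in c' X) (cmap c' p) (tcoord c' p (Y p))) +
  hessian (cmap c \o cinv c') (cmap c' p) (tcoord c' p (X p)) (tcoord c' p (Y p)).
Proof.
move=> ac ac' oU Xs Up cp c'p.
have [X's im] := smooth_vf_in ac' Xs Up c'p.
have X'd := smooth_on_differentiable X's im.
have Xd : differentiable (vf_in c X) (cmap c p) := (vf_in_tame ac oU Xs Up cp).1.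
have td := transition_differentiable ac' ac c'p cp.
have im' : (cmap c' @` (cdom c' `&` cdom c)) (cmap c' p) by exists p.
have := derive_pushforward (tcoord c' p (Y p)) (@transition_domain_open c' c)
  (transition_smooth ac' ac) im' X'd.
rewrite (vf_inE X c'p) => <-.
have <- : dtransition c' c p (tcoord c' p (Y p)) = tcoord c p (Y p).
  by apply: dtransition_comp => //; [exact: chart_at_atlas|exact: chart_at_dom].
set w := tcoord c' p (Y p).
have E1 : (cmap c \o cinv c') (cmap c' p) = cmap c p by rewrite /= cmapK.
have Xd' : differentiable (vf_in c X) ((cmap c \o cinv c') (cmap c' p)) by rewrite E1.
have H := congr1 (@^~ w) (diff_comp td Xd').
have H2 := deriveE w (differentiable_comp td Xd').
rewrite E1 /= in H.
apply: (etrans (esym H)); apply: (etrans (esym H2)).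
apply: near_eq_derive.
have := open_nbhs_nbhs (conj (@transition_domain_open c' c) im').
apply: filterS => _ [r [r1 r2] <-] /=; rewrite cmapK// !vf_inE//.
rewrite !tcoordE -/(dtransition c' c r _) dtransition_comp//.
  exact: chart_at_atlas.
exact: chart_at_dom.
Qed.

(** A change of chart adds the same Hessian term to both directional derivatives, up to the order of
    its arguments, and symmetry cancels it in the difference. *)
Lemma lie_bracket_in c (U : set M) (X Y : vfield M) p :
  atlas c -> open U -> smooth_vf U X -> smooth_vf U Y -> U p -> cdom c p ->
  bracket_in c X Y (cmap c p) = tcoord c p (lie_bracket X Y p).
Proof.
move=> ac oU Xs Ys Up cp; rewrite /bracket_in !(vf_inE _ cp).
have ap := chart_at_atlas p; have dp := chart_at_dom p.
have dX := vf_in_derivative_transition Y ac ap oU Xs Up cp dp.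
have dY := vf_in_derivative_transition X ac ap oU Ys Up cp dp.
apply: (etrans (congr2 (fun v w => v - w) dY dX)).
have im' : (cmap (chart_at p) @` (cdom (chart_at p) `&` cdom c)) (cmap (chart_at p) p).
  by exists p.
have hC := hessianC (tcoord (chart_at p) p (Y p)) (tcoord (chart_at p) p (X p))
  (@transition_domain_open (chart_at p) c) (transition_smooth ap ac) im'.
rewrite hC opprD addrACA subrr addr0 (tcoord_chart_at p (X p)) (tcoord_chart_at p (Y p)).
rewrite /lie_bracket (vf_in_chart_at X) (vf_in_chart_at Y) tcoordE /dtransition.
by apply: esym; exact: linearB.
Qed.

Lemma lie_bracketC (X Y : vfield M) p : lie_bracket Y X p = - lie_bracket X Y p.
Proof. by rewrite /lie_bracket opprB. Qed.

Lemma lie_bracketXX (X : vfield M) p : lie_bracket X X p = 0.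
Proof. by rewrite /lie_bracket subrr. Qed.

(** In coordinates ['d f x (g x)] is a sum of components of [g] times partial derivatives of [f],
    each of them tame. *)
Lemma bracket_in_continuous c (U : set M) (X Y : vfield M) p :
  atlas c -> open U -> smooth_vf U X -> smooth_vf U Y -> U p -> cdom c p ->
  {for cmap c p, continuous (bracket_in c X Y)}.
Proof.
move=> ac oU Xs Ys Up cp.
have oI := @chart_image_open c U oU.
have [Xc im] := smooth_vf_in ac Xs Up cp.
have [Yc _] := smooth_vf_in ac Ys Up cp.
have half (f g : E -> E) : smooth_on (cmap c @` (U `&` cdom c)) f ->
    smooth_on (cmap c @` (U `&` cdom c)) g -> {for cmap c p, continuous (fun x => 'd f x (g x))}.
  move=> fs gs; apply: mx_continuous => i j.
  have H : {for cmap c p, continuous (fun x => \sum_(k < 4) g x 0 k * 'D_(delta_mx 0 k) f x i j)}.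
    apply: tame_continuous; apply: tame_sum => k; apply: tameM.
      exact/tame_coord/(smooth_on_tame oI gs im).
    exact/tame_coord/(smooth_on_tame oI (smooth_on_derive _ fs) im).
  apply: near_eq_continuous H _.
  apply: filterS (open_nbhs_nbhs (conj oI im)) => x ix.
  rewrite differential_delta summxE; apply: eq_bigr => k _.
  by rewrite mxE deriveE//; exact: smooth_on_differentiable fs ix.
exact: (cvgB (half _ _ Yc Xc) (half _ _ Xc Yc)).
Qed.

End charts.

(** * Hamilton's equations in coordinates *)

Section pair_calculus.
Context {R : realType}.
Local Notation E := 'rV[R]_4.

Lemma is_derive_unique (V W : normedModType R) (f : V -> W) (x v : V) (d d' : W) :
  is_derive x v f d -> is_derive x v f d' -> d = d'.
Proof. by move=> [_ <-] [_ <-]. Qed.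

Lemma norm_fst_le (V W : normedModType R) (z : V * W) : `|z.1| <= `|z|.
Proof. by rewrite prod_normE le_max lexx. Qed.

Lemma norm_snd_le (V W : normedModType R) (z : V * W) : `|z.2| <= `|z|.
Proof. by rewrite prod_normE le_max lexx orbT. Qed.

Lemma pairingC (l m : E) : pairing l m = pairing m l.
Proof. by apply: eq_bigr => i _; rewrite mulrC. Qed.

Lemma pairing0r (l : E) : pairing l 0 = 0.
Proof. by rewrite pairingC pairing0l. Qed.

Lemma is_derive_fst (V W : normedModType R) (f : R -> V * W) (t : R) (v : V * W) :
  is_derive t (1 : R) f v -> is_derive t (1 : R) (fun s => (f s).1) v.1.
Proof.
move=> /is_derive1P fv; apply/is_derive1P => e e0; have [d d0 dP] := fv e e0.
exists d => // s sd; apply: le_trans (dP s sd).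
exact: norm_fst_le (f s - f t - (s - t) *: v).
Qed.

Lemma is_derive_snd (V W : normedModType R) (f : R -> V * W) (t : R) (v : V * W) :
  is_derive t (1 : R) f v -> is_derive t (1 : R) (fun s => (f s).2) v.2.
Proof.
move=> /is_derive1P fv; apply/is_derive1P => e e0; have [d d0 dP] := fv e e0.
exists d => // s sd; apply: le_trans (dP s sd).
exact: norm_snd_le (f s - f t - (s - t) *: v).
Qed.

Lemma is_derive_pair (V W : normedModType R) (f : R -> V) (g : R -> W) (t : R) v w :
  is_derive t (1 : R) f v -> is_derive t (1 : R) g w ->
  is_derive t (1 : R) (fun s => (f s, g s)) (v, w).
Proof.
move=> /is_derive1P fv /is_derive1P gw; apply/is_derive1P => e e0.
have [d d0 dP] := fv e e0; have [d' d'0 d'P] := gw e e0.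
exists (Num.min d d'); first by rewrite lt_min d0.
move=> s; rewrite lt_min => /andP[sd sd'].
by rewrite prod_normE ge_max /= dP//= d'P.
Qed.

Lemma is_derive_pairing (V : normedModType R) (l m : V -> E) (x v : V) (dl dm : E) :
  is_derive x v l dl -> is_derive x v m dm ->
  is_derive x v (fun y => pairing (l y) (m y) : R^o) (pairing dl (m x) + pairing (l x) dm).
Proof.
move=> lx mx.
rewrite (_ : pairing dl (m x) + pairing (l x) dm =
  \sum_(i < 4) (dl 0 i * m x 0 i + l x 0 i * dm 0 i)); last by rewrite -big_split.
apply: is_derive_sum_fun => i.
rewrite (_ : (fun _ => _) = (fun y => l y 0 i : R^o) * (fun y => m y 0 i)) //.
have li := is_derive_coord 0 i lx; have mi := is_derive_coord 0 i mx.
by apply: is_derive_eq; rewrite /GRing.scale /= addrC [dl _ _ * _]mulrC.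
Qed.

Lemma coord_cvg (T : Type) (G : set_system T) {FG : Filter G} (f : T -> E) (f0 : E) i :
  f @ G --> f0 -> (fun t => f t 0 i) @ G --> (f0 0 i : R).
Proof.
move=> /cvgrPdist_le fc; apply/cvgrPdist_le => e e0.
move: (fc e e0); apply: filterS => t; apply: le_trans.
by have := coord_norm_le (f0 - f t) 0 i; rewrite !mxE.
Qed.

Lemma pairing_cvg (T : Type) (G : set_system T) {FG : Filter G} (l m : T -> E) (l0 m0 : E) :
  l @ G --> l0 -> m @ G --> m0 -> (fun t => pairing (l t) (m t)) @ G --> pairing l0 m0.
Proof.
move=> lc mc; have lm i : (fun t => l t 0 i * m t 0 i) @ G --> l0 0 i * m0 0 i.
  by apply: cvgM; exact: coord_cvg.
have -> : (fun t => pairing (l t) (m t)) = (fun t =>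
    l t 0 0 * m t 0 0 + (l t 0 1 * m t 0 1 + (l t 0 2 * m t 0 2 + l t 0 3 * m t 0 3))).
  apply/funext => t; rewrite /pairing !big_ord_recl big_ord0 addr0.
  by congr (_ * _ + (_ * _ + (_ * _ + _ * _))); congr (_ _ _); apply: val_inj.
have -> : pairing l0 m0 =
    l0 0 0 * m0 0 0 + (l0 0 1 * m0 0 1 + (l0 0 2 * m0 0 2 + l0 0 3 * m0 0 3)).
  rewrite /pairing !big_ord_recl big_ord0 addr0.
  by congr (_ * _ + (_ * _ + (_ * _ + _ * _))); congr (_ _ _); apply: val_inj.
by do 3?[apply: cvgD; first exact: lm].
Qed.

Lemma is_derive_fst_comp (V : E -> E) (z w : E * E) :
  differentiable V z.1 -> is_derive z w (fun y : E * E => V y.1) ('d V (z.1) w.1).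
Proof. by move=> Vd; have [H <-] := is_derive_diff w.1 Vd; split; [exact: H|]. Qed.

Lemma fst_differentiable (z : E * E) : differentiable (fun y : E * E => y.1) z.
Proof. by apply: (@linear_differentiable _ _ _ (@fst E E)) => ?; exact: cvg_fst. Qed.

Lemma snd_differentiable (z : E * E) : differentiable (fun y : E * E => y.2) z.
Proof. by apply: (@linear_differentiable _ _ _ (@snd E E)) => ?; exact: cvg_snd. Qed.

Lemma is_derive_snd_at (z w : E * E) : is_derive z w (fun y : E * E => y.2) w.2.
Proof.
have [H H2] := is_derive_id z.2 w.2.
by split; [exact: H | exact: H2].
Qed.

(** Testing on vectors with zero first part gives x' = dH/dxi, on vectors with zero second part xi'
    = - dH/dx. The equivalence serves both to exploit a given extremal and to construct one. *)
Lemma hamiltonian_vector_linear (H : E * E -> R^o) (u : R * R) (x xi x' xi' v1 v2 : E)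
    (D1 D2 : E -> E) :
  D1 0 = 0 -> D2 0 = 0 ->
  (forall w, 'd H (x, xi) w = u.1 * (pairing w.2 v1 + pairing xi (D1 w.1)) +
    u.2 * (pairing w.2 v2 + pairing xi (D2 w.1))) ->
  is_hamiltonian_vector H (x, xi) (x', xi') <->
  (x' = u.1 *: v1 + u.2 *: v2 /\
   forall w, pairing xi' w = - (u.1 * pairing xi (D1 w) + u.2 * pairing xi (D2 w))).
Proof.
move=> d1 d2 HE; split=> [Hv|[-> xiE] w].
  split.
    apply/rowP => i; rewrite -!pairing_delta ![pairing _ (delta_mx 0 i)]pairingC.
    have := Hv (0, delta_mx 0 i); rewrite HE /canonical_form /=.
    by rewrite d1 d2 !pairing0r subr0 !addr0 pairingDr !pairingZr.
  move=> w; have := Hv (w, 0); rewrite HE /canonical_form /= !pairing0l !add0r => <-.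
  by rewrite opprK.
rewrite HE /canonical_form /= xiE pairingDr !pairingZr opprK.
by ring.
Qed.

(** The term in [nu] is constant on the cotangent bundle, so abnormal and normal extremals with the
    same control obey the same linear equation. *)
Lemma hamiltonian_vectorP (V1 V2 : E -> E) (u : R * R) (nu : R) (x xi x' xi' : E) :
  differentiable V1 x -> differentiable V2 x ->
  is_hamiltonian_vector (fun z => pmp_hamiltonian u nu (pairing z.2 (V1 z.1))
    (pairing z.2 (V2 z.1))) (x, xi) (x', xi') <->
  (x' = u.1 *: V1 x + u.2 *: V2 x /\
  forall w, pairing xi' w = - (u.1 * pairing xi ('d V1 x w) + u.2 * pairing xi ('d V2 x w))).
Proof.
move=> V1d V2d; set H := (X in is_hamiltonian_vector X).
have coord_diff (f : E * E -> E) i : differentiable f (x, xi) ->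
    differentiable (fun z => f z 0 i : R^o) (x, xi).
  by move=> fd; exact: (differentiable_comp fd (differentiable_coord _ _ _)).
have pd (V : E -> E) : differentiable V x ->
    differentiable (fun z : E * E => pairing z.2 (V z.1) : R^o) (x, xi).
  move=> Vd.
  rewrite (_ : (fun z : E * E => _) =
      \sum_(i < 4) ((fun z : E * E => z.2 0 i : R^o) * (fun z => V z.1 0 i))); last first.
    by apply/funext => z; rewrite fct_sumE.
  apply: differentiable_sum => i; apply: differentiableM.
    exact/coord_diff/snd_differentiable.
  apply: (coord_diff (fun z => V z.1)).
  exact: (@differentiable_comp _ _ _ _ _ _ (x, xi) (fst_differentiable _) Vd).
have Hd : differentiable (H : E * E -> R^o) (x, xi).
  apply: differentiableD; last exact: differentiable_cst.
  by apply: differentiableD; apply: differentiableZ; exact: pd.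
have HE w : 'd (H : E * E -> R^o) (x, xi) w =
    u.1 * (pairing w.2 (V1 x) + pairing xi ('d V1 x w.1)) +
    u.2 * (pairing w.2 (V2 x) + pairing xi ('d V2 x w.1)).
  have p1 := is_derive_pairing (is_derive_snd_at (x, xi) w)
    (is_derive_fst_comp (z := (x, xi)) w V1d).
  have p2 := is_derive_pairing (is_derive_snd_at (x, xi) w)
    (is_derive_fst_comp (z := (x, xi)) w V2d).
  have q1 := @is_deriveZ _ _ _ _ u.1 _ _ _ p1.
  have q2 := @is_deriveZ _ _ _ _ u.2 _ _ _ p2.
  have q3 := is_derive_cst (nu / 2 * (u.1 ^+ 2 + u.2 ^+ 2) : R^o) (x, xi) w.
  have hw := is_deriveD (is_deriveD q1 q2) q3.
  rewrite -(deriveE w Hd); apply: (etrans (@derive_val _ _ _ _ _ _ _ hw)).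
  by rewrite addr0.
have d1 := linear0 ('d V1 x); have d2 := linear0 ('d V2 x).
exact: (@hamiltonian_vector_linear H u x xi x' xi' (V1 x) (V2 x) ('d V1 x) ('d V2 x) d1 d2 HE).
Qed.

End pair_calculus.

(** * Extremals in canonical frames *)

Lemma lipschitz_segmentP (R : realType) (V : normedModType R) (f : R -> V) (a b t e : R) :
  [lipschitz f s | s in [set` `[a, b]] `&` ball t e] <->
  exists2 L : R, 0 <= L & forall s r, a <= s <= b -> a <= r <= b ->
    `|s - t| < e -> `|r - t| < e -> `|f s - f r| <= L * `|s - r|.
Proof.
split.
  move=> /pinfty_ex_gt0[L L0 H]; exists L; first exact: ltW.
  move=> s r sab rab se re; apply: (H (s, r)); split => /=.
    by split; [rewrite /= in_itv | rewrite /ball /= distrC].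
  by split; [rewrite /= in_itv | rewrite /ball /= distrC].
move=> [L L0 H]; exists L; split; first exact: num_real.
move=> K LK [s r] [[/= sab se] [/= rab re]].
rewrite /ball /= distrC in se; rewrite /ball /= distrC in re.
rewrite in_itv in sab; rewrite in_itv in rab.
by apply: (le_trans (H s r sab rab se re)); rewrite ler_wpM2r// ltW.
Qed.

Lemma diff_linear2 (R : realType) (V W : normedModType R) (f : V -> W) x (a b : R) (v w : V) :
  'd f x (a *: v + b *: w) = a *: 'd f x v + b *: 'd f x w.
Proof. by rewrite linearD !linearZ. Qed.

Lemma lie_bracketE (R : realType) (M : manifold4 R) (X Y : vfield M) (p : M) :
  lie_bracket X Y p =
  'd (vf_in (chart_at p) Y) (cmap (chart_at p) p) (X p) -
  'd (vf_in (chart_at p) X) (cmap (chart_at p) p) (Y p).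
Proof. by rewrite /lie_bracket (vf_in_chart_at X) (vf_in_chart_at Y). Qed.

Lemma pairing_bracket_combination (R : realType) (l xi y x1y x2y yx1 yx2 : 'rV[R]_4) (u1 u2 : R) :
  pairing xi y = - (u1 * pairing l x1y + u2 * pairing l x2y) ->
  pairing xi y + pairing l (u1 *: yx1 + u2 *: yx2) =
  u1 * pairing l (yx1 - x1y) + u2 * pairing l (yx2 - x2y).
Proof. by move=> ->; rewrite !pairingDr !pairingZr !pairingNr; ring. Qed.

Section frames.
Context {R : realType} {M : manifold4 R}.
Local Notation E := 'rV[R]_4.

(** Indices start at 0: [frame_vf F 3] is X4. *)
Definition frame_vf (F : frame4 M) (i : 'I_4) : vfield M := fun p => tnth (frame_at F p) i.

Lemma frame_vf0 F : frame_vf F 0 = fX1 F.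
Proof. by apply/funext => p; rewrite /frame_vf (tnth_nth 0). Qed.

Lemma frame_vf1 F : frame_vf F 1 = fX2 F.
Proof. by apply/funext => p; rewrite /frame_vf (tnth_nth 0). Qed.

Lemma frame_vf2 F : frame_vf F 2 = fX3 F.
Proof. by apply/funext => p; rewrite /frame_vf (tnth_nth 0). Qed.

Lemma frame_vf3 F : frame_vf F 3 = fX4 F.
Proof. by apply/funext => p; rewrite /frame_vf (tnth_nth 0). Qed.

Lemma ord4P (P : 'I_4 -> Prop) : P 0 -> P 1 -> P 2 -> P 3 -> forall i, P i.
Proof.
move=> P0 P1 P2 P3 [[|[|[|[|//]]]] i4].
- by rewrite (_ : Ordinal i4 = 0)//; exact: val_inj.
- by rewrite (_ : Ordinal i4 = 1)//; exact: val_inj.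
- by rewrite (_ : Ordinal i4 = 2)//; exact: val_inj.
- by rewrite (_ : Ordinal i4 = 3)//; exact: val_inj.
Qed.

Variable S : engel_structure M.

Lemma frame_vf_smooth U F i : canonical_frame_on S U F -> smooth_vf U (frame_vf F i).
Proof.
move=> [[s1 s2 s3 s4] _]; move: i; apply: ord4P.
- by rewrite frame_vf0.
- by rewrite frame_vf1.
- by rewrite frame_vf2.
- by rewrite frame_vf3.
Qed.

Definition frame_near (F F' : frame4 M) (p : M) :=
  \forall x \near p, forall i, frame_vf F i x = frame_vf F' i x.

Lemma vf_in_near_eq c (X Y : vfield M) p : cdom c p ->
  (\forall x \near p, X x = Y x) -> \forall x \near cmap c p, vf_in c X x = vf_in c Y x.
Proof.
move=> cp XY; have im : (cmap c @` cdom c) (cmap c p) by exists p.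
have n2 : nbhs (cmap c p) (cinv c @^-1` [set x | X x = Y x]).
  by apply: (cinv_continuous im); rewrite cmapK.
by apply: filterS n2 => x /= XYx; rewrite /vf_in XYx.
Qed.

(** Brackets depend on germs only, so the frame of a nearby time may replace the current one even
    though each has its own domain. *)
Lemma lie_bracket_near_eq (U V : set M) (X Y X' Y' : vfield M) p :
  open U -> open V -> U p -> V p ->
  smooth_vf U X -> smooth_vf U Y -> smooth_vf V X' -> smooth_vf V Y' ->
  (\forall x \near p, X x = X' x) -> (\forall x \near p, Y x = Y' x) ->
  lie_bracket X Y p = lie_bracket X' Y' p.
Proof.
move=> oU oV Up Vp Xs Ys X's Y's XX YY; rewrite /lie_bracket.
have ap := chart_at_atlas p; have dp := chart_at_dom p.
have Xn := vf_in_near_eq dp XX; have Yn := vf_in_near_eq dp YY.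
have [Xd _] := vf_in_tame ap oU Xs Up dp; have [Yd _] := vf_in_tame ap oU Ys Up dp.
have [X'd _] := vf_in_tame ap oV X's Vp dp; have [Y'd _] := vf_in_tame ap oV Y's Vp dp.
rewrite (nbhs_singleton Xn) (nbhs_singleton Yn).
by apply: (congr2 (fun v w => v - w)); exact: near_diff_eq.
Qed.

Section along.
Variables (a b : R) (q : R -> M) (F : R -> frame4 M).
Hypothesis qc : {within [set` `[a, b]], continuous q}.
Hypothesis Fq : canonical_frame_along S q a b F.

Lemma curve_continuous t : a < t < b -> {for t, continuous q}.
Proof.
move=> tab W qW; have tab' : a <= t <= b by lra.
have [d d0 dP] := (within_segment_continuousP q a b).1 qc t tab' W qW.
apply/nbhs_ballP; exists (Num.min d (Num.min (t - a) (b - t))).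
  by rewrite /= !lt_min d0 !subr_gt0; lra.
move=> s; rewrite /ball /= !lt_min distrC => /and3P[sd sa sb].
by apply: dP => //; move: sa sb; rewrite !ltr_norml; lra.
Qed.

(** Near [t0] a single domain, chart and frame serve all times, which reduces statements along the
    curve to coordinates. *)
Lemma frame_along_local t0 : a <= t0 <= b -> exists (U : set M) (e : R),
  [/\ open U, U (q t0), canonical_frame_on S U (F t0), 0 < e &
   forall s, a <= s <= b -> `|s - t0| < e ->
     [/\ U (q s), cdom (chart_at (q t0)) (q s) & frame_near (F s) (F t0) (q s)]].
Proof.
move=> tab; have tI : t0 \in `[a, b] by rewrite in_itv.
have [[U [oU Uq UF]] Fn] := Fq tI.
have W : nbhs (q t0) (U `&` cdom (chart_at (q t0))).
  apply: filterI; apply: open_nbhs_nbhs; split => //; first exact: cdom_open.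
  exact: chart_at_dom.
have [d d0 dP] := (within_segment_continuousP q a b).1 qc t0 tab _ W.
have /nbhs_ballP[r /= r0 rP] := Fn.
exists U, (Num.min d r); split => //; first by rewrite lt_min d0.
move=> s sab; rewrite lt_min => /andP[sd sr]; have [Us cs] := dP s sab sd.
split => //.
have := rP s; rewrite /ball /= distrC in_itv => /(_ sr sab).
apply: filterS => x [x1 x2 x3 x4]; apply: ord4P.
- by rewrite !frame_vf0.
- by rewrite !frame_vf1.
- by rewrite !frame_vf2.
- by rewrite !frame_vf3.
Qed.

Lemma velocity_in_chart c t v : atlas c -> cdom c (q t) -> a < t < b ->
  has_velocity q t v -> is_derive t (1 : R) (cmap c \o q) (tcoord c (q t) v).
Proof.
move=> ac cq tab qv; have cc := curve_continuous tab.
have td := transition_differentiable (chart_at_atlas (q t)) ac (chart_at_dom (q t)) cq.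
have := is_derive_comp qv td; apply: near_eq_is_derive.
have W := open_nbhs_nbhs (conj (@cdom_open _ _ (chart_at (q t))) (chart_at_dom (q t))).
have W2 : \forall s \near t, cdom (chart_at (q t)) (q s) by exact: cc _ W.
by move: W2; apply: filterS => s /= cs; rewrite cmapK.
Qed.

Section extremal.
Variables (lam : R -> E) (u : R -> R * R) (nu : R).

Lemma extremal_equationE t : a < t < b -> extremal_equation q lam F u nu t ->
  has_velocity q t ((u t).1 *: fX1 (F t) (q t) + (u t).2 *: fX2 (F t) (q t)) /\
  exists xi' : E,
    is_derive t (1 : R) (fun s => ccoord (chart_at (q t)) (q s) (lam s)) xi' /\
    forall w, pairing xi' w = - (
      (u t).1 * pairing (lam t)
        ('d (vf_in (chart_at (q t)) (fX1 (F t))) (cmap (chart_at (q t)) (q t)) w) +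
      (u t).2 * pairing (lam t)
        ('d (vf_in (chart_at (q t)) (fX2 (F t))) (cmap (chart_at (q t)) (q t)) w)).
Proof.
move=> tab [[x' xi'] [lv]].
have tab' : a <= t <= b by lra.
have [U [e [oU Uq UF _ _]]] := frame_along_local tab'.
have ap := chart_at_atlas (q t); have dp := chart_at_dom (q t).
have [[s1 s2 _ _] _] := UF.
have V1d := (vf_in_tame ap oU s1 Uq dp).1.
have V2d := (vf_in_tame ap oU s2 Uq dp).1.
move/(hamiltonian_vectorP (u t) nu _ _ _ V1d V2d) => [xE xiE].
have xq := is_derive_fst lv; have xiq := is_derive_snd lv.
rewrite !(vf_in_chart_at) in xE.
split; first by rewrite -xE; exact: xq.
by exists xi'; split => // w; rewrite xiE ccoord_chart_at.
Qed.

(** The function h_(i+1) along the lift, read in the frame attached to the time [s]. *)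
Definition frame_pairing (i : 'I_4) (s : R) : R := pairing (lam s) (frame_vf (F s) i (q s)).

Lemma frame_pairing_local t0 i : a <= t0 <= b -> exists2 e : R, 0 < e &
  forall s, a <= s <= b -> `|s - t0| < e ->
   frame_pairing i s = pairing (ccoord (chart_at (q t0)) (q s) (lam s))
     (vf_in (chart_at (q t0)) (frame_vf (F t0) i) (cmap (chart_at (q t0)) (q s))).
Proof.
move=> tab; have [U [e [oU Uq UF e0 H]]] := frame_along_local tab.
exists e => // s sab se; have [Us cs Fs] := H s sab se.
rewrite pairing_ccoord_vf_in//; last exact: chart_at_atlas.
by rewrite /frame_pairing (nbhs_singleton Fs).
Qed.

(** The Poisson bracket formula: Hamilton's equation contributes minus the derivatives of X1 and X2,
    the motion of the point contributes the derivative of X_(i+1), and together they form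
    brackets. *)
Lemma frame_pairing_derive i t : a < t < b -> extremal_equation q lam F u nu t ->
  is_derive t (1 : R) (frame_pairing i)
   ((u t).1 * pairing (lam t) (lie_bracket (fX1 (F t)) (frame_vf (F t) i) (q t)) +
    (u t).2 * pairing (lam t) (lie_bracket (fX2 (F t)) (frame_vf (F t) i) (q t))).
Proof.
move=> tab ext; have tab' : a <= t <= b by lra.
have [U [_ [oU Uq UF _ _]]] := frame_along_local tab'.
have [qv [xi' [xid xiE]]] := extremal_equationE tab ext.
have [e e0 H] := frame_pairing_local i tab'.
have ap := chart_at_atlas (q t); have dp := chart_at_dom (q t).
have W := vf_in_tame ap oU (frame_vf_smooth i UF) Uq dp.
have dW := is_derive_comp qv W.1.
have := is_derive_pairing xid dW.
set d1 := (d in is_derive _ _ _ d -> _); set d2 := (d in _ -> is_derive _ _ _ d).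
have -> : d1 = d2.
  rewrite /d2 !lie_bracketE.
  set x1 := fX1 (F t) (q t); set x2 := fX2 (F t) (q t).
  have -> : d1 = pairing xi' (frame_vf (F t) i (q t)) + pairing (lam t)
      ((u t).1 *: 'd (vf_in (chart_at (q t)) (frame_vf (F t) i)) (cmap (chart_at (q t)) (q t)) x1
      + (u t).2 *: 'd (vf_in (chart_at (q t)) (frame_vf (F t) i)) (cmap (chart_at (q t)) (q t)) x2).
    rewrite /d1 ccoord_chart_at; congr (pairing _ _ + pairing _ _).
      exact: vf_in_chart_at.
    exact: diff_linear2.
  exact: pairing_bracket_combination (xiE _).
apply: near_eq_is_derive; apply/nbhs_ballP.
exists (Num.min e (Num.min (t - a) (b - t))).
  by rewrite /= !lt_min e0 !subr_gt0; lra.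
move=> s; rewrite /ball /= !lt_min distrC => /and3P[se sa sb].
by rewrite H//; move: sa sb; rewrite !ltr_norml; lra.
Qed.

Lemma frame_pairing_continuous i : lipschitz_lift q lam a b ->
  {within [set` `[a, b]], continuous (frame_pairing i)}.
Proof.
move=> [[_ qL] lamL]; apply/subspace_continuousP => t; rewrite /= in_itv => tab.
have tI : t \in `[a, b] by rewrite in_itv.
have [U [_ [oU Uq UF _ _]]] := frame_along_local tab.
have [e e0 H] := frame_pairing_local i tab.
have ap := chart_at_atlas (q t); have dp := chart_at_dom (q t).
have W := tame_continuous (vf_in_tame ap oU (frame_vf_smooth i UF) Uq dp).
have lip_cvg (f : R -> E) (r : R) : 0 < r -> [lipschitz f s | s in [set` `[a, b]] `&` ball t r] ->
    f @ within [set` `[a, b]] (nbhs t) --> f t.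
  move=> r0 /lipschitz_segmentP[L L0 fL]; apply/cvgrPdist_le => d d0.
  apply/nbhs_ballP; exists (Num.min r (d / (L + 1))).
    by rewrite /= lt_min r0 divr_gt0// ltr_wpDl.
  move=> s; rewrite /ball /= lt_min => /andP[sr sd]; rewrite in_itv => sab.
  apply: (le_trans (fL t s tab sab _ _)); rewrite ?subrr ?normr0 1?distrC//.
  rewrite distrC; apply: (le_trans (ler_wpM2l L0 (ltW sd))).
  by rewrite mulrCA ger_pMr// ler_pdivrMr ?ltr_wpDl//; lra.
have [r r0 xL] := qL t tI; have [r' r'0 xiL] := lamL t tI.
have xc := lip_cvg _ _ r0 xL; have xic := lip_cvg _ _ r'0 xiL.
have Wc := cvg_comp _ _ xc W.
have FG : Filter (within [set` `[a, b]] (nbhs t)) by exact: within_filter.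
have pc := pairing_cvg xic Wc.
suff : frame_pairing i @ within [set` `[a, b]] (nbhs t) --> frame_pairing i t by [].
have -> : frame_pairing i t = pairing (ccoord (chart_at (q t)) (q t) (lam t))
     (vf_in (chart_at (q t)) (frame_vf (F t) i) (cmap (chart_at (q t)) (q t))).
  by apply: H => //; rewrite subrr normr0.
apply: cvg_trans (pc FG); apply: (@near_eq_cvg _ _ _ FG).
apply/nbhs_ballP; exists e => //= s.
by rewrite /ball /= distrC => se; rewrite in_itv => sab; rewrite H.
Qed.

End extremal.
End along.
End frames.

(** [(g1, g2)] is the gradient in [u] of the Hamiltonian at the maximiser, hence zero. *)
Lemma maximum_condition (R : realType) (nu h1 h2 : R) (u : R * R) : nu <= 0 ->
  (forall w, pmp_hamiltonian w nu h1 h2 <= pmp_hamiltonian u nu h1 h2) ->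
  h1 = - nu * u.1 /\ h2 = - nu * u.2.
Proof.
move=> nu0 H; pose g1 := h1 + nu * u.1; pose g2 := h2 + nu * u.2.
(* The length of a gradient step whose gain [e * (1 + nu * e / 2)] times the squared gradient has a
   positive factor for every [nu <= 0], zero included: [nu * e = e - 1] exceeds -1. *)
pose e := (1 - nu)^-1.
have e0 : 0 < e by rewrite invr_gt0; lra.
have ee : e * (1 - nu) = 1 by rewrite mulVf//; lra.
have := H (u.1 + e * g1, u.2 + e * g2); rewrite /pmp_hamiltonian /= => He.
have key : e * (1 + nu * e / 2) * (g1 ^+ 2 + g2 ^+ 2) <= 0.
  move: He; rewrite -subr_le0; apply: le_trans; rewrite le_eqVlt; apply/orP; left.
  by apply/eqP; rewrite /g1 /g2; field.
have pos : 0 < e * (1 + nu * e / 2).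
  apply: mulr_gt0 => //; have -> : nu * e = e - 1 by lra.
  lra.
have gg : g1 ^+ 2 + g2 ^+ 2 <= 0 by move: key; rewrite pmulr_rle0.
have g1s := sqr_ge0 g1; have g2s := sqr_ge0 g2.
have g10 : g1 = 0 by apply/eqP; rewrite -sqrf_eq0; apply/eqP; lra.
have g20 : g2 = 0 by apply/eqP; rewrite -sqrf_eq0; apply/eqP; lra.
by move: g10 g20; rewrite /g1 /g2; split; lra.
Qed.

Lemma is_derive_interior_cst (R : realType) (f : R -> R) (a b v t : R) :
  (forall s, s \in `[a, b] -> f s = v) -> a < t < b -> is_derive t (1 : R) f 0.
Proof.
move=> fv tab; have := is_derive_cst v t (1 : R); apply: near_eq_is_derive.
apply/nbhs_ballP; exists (Num.min (t - a) (b - t)).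
  by rewrite /= lt_min !subr_gt0; lra.
move=> s; rewrite /ball /= lt_min distrC => /andP[sa sb].
by rewrite fv// in_itv /=; move: sa sb; rewrite !ltr_norml; lra.
Qed.

(** * Consequences of the maximum principle for abnormal extremals *)

Section canonical_frames.
Context {R : realType} {M : manifold4 R} (S : engel_structure M).
Local Notation E := 'rV[R]_4.
Local Notation mu := (@lebesgue_measure R).

Lemma frame_expand U F p (v : E) : canonical_frame_on S U F -> U p ->
  v = \sum_i coord (frame_at F p) i v *: frame_vf F i p.
Proof.
move=> [_ UF] Up; have [bF _ _ _ _] := UF p Up.
rewrite {1}(coord_basis bF (memvf v)); apply: eq_bigr => i _.
by rewrite /frame_vf (tnth_nth 0).
Qed.

Lemma coord_frame_vf U F p (i j : 'I_4) : canonical_frame_on S U F -> U p ->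
  coord (frame_at F p) i (frame_vf F j p) = (i == j)%:R.
Proof.
move=> [_ UF] Up; have [/andP[_ fF] _ _ _ _] := UF p Up.
by rewrite /frame_vf (tnth_nth 0) coord_free// eq_sym.
Qed.

Lemma pairing_frame_eq U F p (l l' : E) : canonical_frame_on S U F -> U p ->
  (forall i, pairing l (frame_vf F i p) = pairing l' (frame_vf F i p)) -> l = l'.
Proof.
move=> UF Up H; apply: pairing_ext => v; rewrite (frame_expand v UF Up).
rewrite !big_ord_recl big_ord0 !pairingDr !pairingZr !pairing0r.
by do !congr (_ + _); congr (_ * _); rewrite H.
Qed.

Lemma span3P (x y z v : E) : v \in <<[:: x; y; z]>>%VS ->
  exists a b c, v = a *: x + b *: y + c *: z.
Proof.
rewrite !span_cons span_nil addv0.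
move=> /memv_addP[_ /vlineP[a ->] [w /memv_addP[_ /vlineP[b ->] [_ /vlineP[c ->] ->]] ->]].
by exists a, b, c; rewrite addrA.
Qed.

Lemma T4E U F p : canonical_frame_on S U F -> U p -> exists al ga : R,
  lie_bracket (fX2 F) (fX3 F) p = al *: fX1 F p + T4 F p *: fX2 F p + ga *: fX3 F p.
Proof.
move=> UF Up; have [_ _ _ _ /span3P[al [be [ga vE]]]] := UF.2 p Up.
exists al, ga; rewrite {1}vE; congr (_ + _ *: _ + _).
rewrite /T4 vE !linearD !linearZ /= -frame_vf0 -frame_vf1 -frame_vf2.
rewrite !(coord_frame_vf _ _ UF Up) /= mulr0 mulr1 mulr0 addr0 add0r //.
Qed.

Section abnormal.
Variables (a b c : R) (q : R -> M) (F : R -> frame4 M) (u : R -> R * R).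
Hypothesis ab : a < b.
Hypothesis qad : admissible S q a b F u.
Hypothesis u_c : {ae mu, forall t, t \in `[a, b] -> speed u t = c}.
Hypothesis c0 : c != 0.

Let qc : {within [set` `[a, b]], continuous q}.
Proof. by case: qad => -[]. Qed.

Let Fq : canonical_frame_along S q a b F.
Proof. by case: qad. Qed.

Lemma pmp_pairings lam nu : pmp q a b F u lam nu ->
  {ae mu, forall t, t \in `]a, b[ ->
    [/\ extremal_equation q lam F u nu t,
        frame_pairing q F lam 0 t = - nu * (u t).1 &
        frame_pairing q F lam 1 t = - nu * (u t).2]}.
Proof.
move=> [_ nu0 _ ext mx]; apply: (ae_imp (ae_and ext mx)) => t [ext_t mx_t] tab.
have [|h1 h2] := @maximum_condition _ nu (frame_pairing q F lam 0 t)
  (frame_pairing q F lam 1 t) (u t) nu0.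
  move=> w; have := mx_t tab w.
  by rewrite /hamiltonian /frame_pairing frame_vf0 frame_vf1.
by split => //; exact: ext_t.
Qed.

Lemma bracket12 t : a < t < b -> lie_bracket (fX1 (F t)) (fX2 (F t)) (q t) = fX3 (F t) (q t).
Proof.
move=> tab; have tab' : a <= t <= b by lra.
have [U [_ [_ Uq UF _ _]]] := frame_along_local (@qc) (@Fq) tab'.
by have [_ _ -> _ _] := UF.2 _ Uq.
Qed.

Lemma bracket13 t : a < t < b -> lie_bracket (fX1 (F t)) (fX3 (F t)) (q t) = fX4 (F t) (q t).
Proof.
move=> tab; have tab' : a <= t <= b by lra.
have [U [_ [_ Uq UF _ _]]] := frame_along_local (@qc) (@Fq) tab'.
by have [_ _ _ -> _] := UF.2 _ Uq.
Qed.

Lemma speed_neq0 : {ae mu, forall t, t \in `[a, b] -> (u t).1 != 0 \/ (u t).2 != 0}.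
Proof.
apply: (ae_imp u_c) => t /[apply] uc.
have [u10|] := eqVneq (u t).1 0; last by left.
right; apply: contra_neq c0 => u20.
by rewrite -uc /speed u10 u20 expr0n addr0 sqrtr0.
Qed.

Lemma abnormal_pairings lam : pmp q a b F u lam 0 ->
  (forall t, t \in `[a, b] -> [/\ frame_pairing q F lam 0 t = 0,
     frame_pairing q F lam 1 t = 0, frame_pairing q F lam 2 t = 0 &
     frame_pairing q F lam 3 t != 0]) /\
  {ae mu, forall t, t \in `]a, b[ -> (u t).1 = 0}.
Proof.
move=> pm; have [lamL _ lam0 _ _] := pm.
have hc i : {within [set` `[a, b]], continuous (frame_pairing q F lam i)}.
  by apply: (@frame_pairing_continuous _ _ _ _ _ _ _ qc (@Fq)).
have pp := pmp_pairings pm.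
have h0 : forall t, t \in `[a, b] -> frame_pairing q F lam 0 t = 0.
  apply: (ae_within_continuous_eq ab (hc 0)).
  by apply: (ae_imp pp) => t /[apply] -[_ -> _]; rewrite oppr0 mul0r.
have h1 : forall t, t \in `[a, b] -> frame_pairing q F lam 1 t = 0.
  apply: (ae_within_continuous_eq ab (hc 1)).
  by apply: (ae_imp pp) => t /[apply] -[_ _ ->]; rewrite oppr0 mul0r.
(* Differentiating h1 = 0 and h2 = 0 gives u2 h3 = 0 and u1 h3 = 0, and the control does not vanish,
   as its norm is [c != 0]. *)
have h2 : forall t, t \in `[a, b] -> frame_pairing q F lam 2 t = 0.
  apply: (ae_within_continuous_eq ab (hc 2)).
  apply: (ae_imp (ae_and pp speed_neq0)) => t [pt ut] tI.
  have [ext _ _] := pt tI; move: (tI); rewrite in_itv /= => tab.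
  have tI' : t \in `[a, b] by rewrite in_itv /=; lra.
  have d0 := frame_pairing_derive (@qc) (@Fq) 0 tab ext.
  have d1 := frame_pairing_derive (@qc) (@Fq) 1 tab ext.
  have := is_derive_unique d0 (is_derive_interior_cst h0 tab).
  have := is_derive_unique d1 (is_derive_interior_cst h1 tab).
  rewrite frame_vf0 frame_vf1 !lie_bracketXX (lie_bracketC (fX1 (F t)) (fX2 (F t))).
  rewrite (bracket12 tab) pairing0r !mulr0 pairingNr addr0 add0r mulrN.
  rewrite -frame_vf2 -/(frame_pairing q F lam 2 t) => u1h /eqP; rewrite oppr_eq0 => /eqP u2h.
  have [u0|u0] := ut tI'; apply: (mulfI u0); by rewrite ?u1h ?u2h mulr0.
(* Otherwise the covector would kill the whole frame, against nontriviality of [(lam t, 0)]. *)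
have h3 : forall t, t \in `[a, b] -> frame_pairing q F lam 3 t != 0.
  move=> t tI; have tab : a <= t <= b by move: tI; rewrite in_itv.
  have [U [_ [_ Uq UF _ _]]] := frame_along_local (@qc) (@Fq) tab.
  apply: contraTneq (lam0 t tI) => h30.
  apply/negPn/eqP; congr (_, _); apply: (pairing_frame_eq UF Uq).
  move=> i; rewrite pairing0l; move: i; apply: ord4P.
  - exact: h0.
  - exact: h1.
  - exact: h2.
  - exact: h30.
split; first by move=> t tI; split; [exact: h0|exact: h1|exact: h2|exact: h3].
apply: (ae_imp pp) => t pt tI; have [ext _ _] := pt tI.
move: (tI); rewrite in_itv /= => tab.
have tab' : a <= t <= b by lra.
have tI' : t \in `[a, b] by rewrite in_itv.
(* The derivative is u1 h4 + u2 <lam, [X2, X3]>, and the covector kills [X2, X3], which lies in the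
   span of X1, X2, X3. *)
have d2 := frame_pairing_derive (@qc) (@Fq) 2 tab ext.
have := is_derive_unique d2 (is_derive_interior_cst h2 tab).
have [U [_ [_ Uq UF _ _]]] := frame_along_local (@qc) (@Fq) tab'.
have [al [ga br]] := T4E UF Uq.
rewrite frame_vf2 br (bracket13 tab) !pairingDr !pairingZr.
rewrite -frame_vf0 -frame_vf1 -frame_vf2 -frame_vf3.
rewrite -!/(frame_pairing q F lam _ t) h0// h1// h2// !mulr0 !addr0 mulr0 addr0.
by move=> /eqP; rewrite mulf_eq0 (negPf (h3 t tI')) orbF => /eqP.
Qed.

End abnormal.

End canonical_frames.

(** * Velocity of abnormal geodesics *)

Lemma is_derive_nondecreasing_ge0 (R : realType) (z : R -> R) (t d e : R) :
  0 < e -> (forall s, t <= s -> s < t + e -> z t <= z s) ->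
  is_derive t (1 : R) z d -> 0 <= d.
Proof.
move=> e0 zi /is_derive1P zd; apply/ler_addgt0Pr => r r0.
have [h h0 hP] := zd r r0.
pose s := t + Num.min e h / 2.
have m0 : 0 < Num.min e h by rewrite lt_min e0.
have me : Num.min e h <= e by rewrite ge_min lexx.
have mh : Num.min e h <= h by rewrite ge_min lexx orbT.
have st : s - t = Num.min e h / 2 by rewrite /s addrAC subrr add0r.
have := hP s; rewrite st ger0_norm; last by lra.
move=> /(_ ltac:(lra)); rewrite ler_norml /GRing.scale /= => /andP[_ H].
have zs : z t <= z s by apply: zi; rewrite /s; lra.
have m20 : 0 < Num.min e h / 2 by lra.
rewrite -(ler_pM2l m20) mulr0 mulrDr; lra.
Qed.

Lemma segment_in_ball (R : realType) (s t r t0 e : R) :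
  `|s - t0| < e -> `|t - t0| < e -> s <= r <= t -> `|r - t0| < e.
Proof. by rewrite !ltr_norml; lra. Qed.

Lemma ball_half_sub_lt (R : realType) (s t t0 d : R) :
  `|s - t0| < d / 2 -> `|t - t0| < d / 2 -> t - s < d.
Proof. by rewrite !ltr_norml; lra. Qed.

Lemma ball_right_gt0 (R : realType) (t t0 e : R) : `|t - t0| < e -> 0 < t0 + e - t.
Proof. by rewrite ltr_norml; lra. Qed.

Lemma ball_right_itv (R : realType) (s t t0 e : R) : `|t - t0| < e -> t <= s ->
  s < t + (t0 + e - t) -> s \in `]t0 - e, t0 + e[.
Proof. by rewrite in_itv /= ltr_norml; lra. Qed.

Lemma lt_itv_le (R : realType) (a b t : R) : a < t < b -> a <= t <= b.
Proof. by move=> /andP[/ltW -> /ltW ->]. Qed.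

Lemma eq_sg_mul (R : realType) (k v c : R) : k != 0 -> 0 <= k * v -> `|v| = c ->
  v = Num.sg k * c.
Proof.
move=> k0 kv <-; case: (ltgtP k 0) k0 => [kneg _|kpos _|//].
  by rewrite ltr0_sg// mulN1r ler0_norm ?opprK// -(nmulr_rge0 _ kneg).
by rewrite gtr0_sg// mul1r ger0_norm// -(pmulr_rge0 _ kpos).
Qed.

Lemma sg_mul_or (R : realType) (k c : R) : k != 0 -> Num.sg k * c = c \/ Num.sg k * c = - c.
Proof.
case: (ltgtP k 0) => [kneg _|kpos _|//]; [right|left].
  by rewrite ltr0_sg// mulN1r.
by rewrite gtr0_sg// mul1r.
Qed.

Lemma tcoord0 (R : realType) (M : manifold4 R) (c : chart R M) (p : M) : tcoord c p 0 = 0.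
Proof. exact: linear0 ('d (cmap c \o cinv (chart_at p)) (cmap (chart_at p) p)). Qed.

Lemma tcoordZ (R : realType) (M : manifold4 R) (c : chart R M) (p : M) k v :
  tcoord c p (k *: v) = k *: tcoord c p v.
Proof. exact: linearZZ ('d (cmap c \o cinv (chart_at p)) (cmap (chart_at p) p)) k v. Qed.

Section geodesics.
Context {R : realType} {M : manifold4 R} (S : engel_structure M).
Local Notation E := 'rV[R]_4.
Local Notation mu := (@lebesgue_measure R).

(** The competitor of length zero. It lives on [0, 1] because [length_minimizer] compares with
    curves on nondegenerate intervals. *)
Lemma constant_curve_admissible (p : M) (U : set M) (F0 : frame4 M) :
  open U -> U p -> canonical_frame_on S U F0 ->
  admissible S (fun=> p) 0 1 (fun=> F0) (fun=> (0, 0)).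
Proof.
move=> oU Up UF.
have Lc (v : R) : Linfty_on 0 1 (fun=> v).
  split; first exact: measurable_cst.
  by exists `|v|; apply: aeW => t _.
split.
- split; first by move=> x; exact: cvg_cst.
  move=> t _; exists 1 => //; apply/lipschitz_segmentP; exists 0 => // s r _ _ _ _.
  by rewrite subrr normr0 mul0r.
- move=> t _; split; first by exists U.
  by apply: nearW => s; apply: nearW.
- exact: Lc.
- exact: Lc.
- apply: aeW => t _; rewrite /= !scale0r addr0.
  exact: is_derive_cst.
Qed.

Lemma constant_speed_length (a b s t c : R) (u : R -> R * R) :
  a <= s -> s < t -> t <= b ->
  Linfty_on a b (fun t => (u t).1) -> Linfty_on a b (fun t => (u t).2) ->
  {ae mu, forall t, t \in `[a, b] -> speed u t = c} ->
  curve_length s t u = (c * (t - s))%:E.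
Proof.
move=> as_ st tb [m1 _] [m2 _] uc; rewrite /curve_length.
have sub : [set` `[s, t]] `<=` [set` `[a, b]].
  by move=> x; rewrite /= !in_itv /=; lra.
have mI : measurable [set` `[s, t]] by exact: measurable_itv.
have mI' : measurable [set` `[a, b]] by exact: measurable_itv.
rewrite (@ae_eq_integral _ _ _ mu [set` `[s, t]] (fun=> c%:E)).
- rewrite (@integral_cst _ _ _ mu _ mI c%:E) /=.
  by rewrite lebesgue_measure_itv /= lte_fin st -EFinB -EFinM.
- exact: mI.
- apply/measurable_realfun.measurable_EFinP; rewrite /speed.
  apply: (@measurableT_comp _ _ _ _ _ _ (@Num.sqrt R)).
    apply: measurable_realfun.continuous_measurable_fun; exact: sqrt_continuous.
  apply: measurable_realfun.measurable_funD; apply: measurable_realfun.measurable_funX.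
    exact: measurable_funS mI' sub m1.
  exact: measurable_funS mI' sub m2.
- exact: measurable_cst.
- apply: (ae_imp uc) => x ux /sub xab; congr (_%:E); exact: ux.
Qed.

(** A closed arc has length [c * (t - s) > 0], while the constant curve joins the same endpoints
    with length 0. *)
Lemma minimizer_no_return (a b s t c : R) q F u :
  admissible S q a b F u -> {ae mu, forall t, t \in `[a, b] -> speed u t = c} -> 0 < c ->
  a <= s -> s < t -> t <= b -> length_minimizer S q s t u -> q s <> q t.
Proof.
move=> [[qc _] Fq L1 L2 _] uc c0 as_ st tb qmin qst.
have sab : a <= s <= b by lra.
have [U [_ [oU Uq UF _ _]]] := frame_along_local qc Fq sab.
have adm := constant_curve_admissible oU Uq UF.
have := qmin _ 0 1 _ _ ltr01 adm erefl qst.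
rewrite (constant_speed_length as_ st tb L1 L2 uc) /curve_length.
rewrite integral0_eq => [|x _]; last by rewrite /speed /= expr0n addr0 sqrtr0.
by rewrite lee_fin pmulr_rle0// subr_le0 leNgt st.
Qed.

Section curve.
Variables (a b c : R) (q : R -> M) (F : R -> frame4 M) (u : R -> R * R).
Hypothesis ab : a < b.
Hypothesis qad : admissible S q a b F u.
Hypothesis u_c : {ae mu, forall t, t \in `[a, b] -> speed u t = c}.

Let qc : {within [set` `[a, b]], continuous q}.
Proof. by case: qad => -[]. Qed.

Let Fq : canonical_frame_along S q a b F.
Proof. by case: qad. Qed.

Lemma speed_ge0 : 0 <= c.
Proof.
have [t _ <-] : exists2 t, a < t < b & speed u t = c.
  apply: ae_interval_exists => //; apply: (ae_imp u_c) => t ut tI.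
  by apply: ut; move: tI; rewrite !in_itv /=; lra.
exact: sqrtr_ge0.
Qed.

Lemma curve_chart_local t0 : a <= t0 <= b -> exists (U : set M) (e L : R),
  [/\ open U, U (q t0), canonical_frame_on S U (F t0), 0 < e &
  [/\ 0 <= L,
   forall s, a <= s <= b -> `|s - t0| < e -> [/\ U (q s), cdom (chart_at (q t0)) (q s) &
     frame_near (F s) (F t0) (q s)] &
   forall s r, a <= s <= b -> a <= r <= b -> `|s - t0| < e -> `|r - t0| < e ->
     `|cmap (chart_at (q t0)) (q s) - cmap (chart_at (q t0)) (q r)| <= L * `|s - r|]].
Proof.
move=> tab; have [U [e [oU Uq UF e0 H]]] := frame_along_local (@qc) (@Fq) tab.
have tI : t0 \in `[a, b] by rewrite in_itv.
case: qad => -[_ qL] _ _ _ _; have [r r0 /lipschitz_segmentP[L L0 xL]] := qL t0 tI.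
exists U, (Num.min e r), L; split => //; first by rewrite lt_min e0.
split => //.
  by move=> s sab; rewrite lt_min => /andP[se _]; exact: H.
move=> s s' sab sab'; rewrite !lt_min => /andP[_ sr] /andP[_ sr']; exact: xL.
Qed.

(** With zero speed the velocity vanishes almost everywhere, so the curve, being Lipschitz in
    charts, is locally constant; real induction passes from chart to chart. *)
Lemma nonconstant_speed_gt0 : nonconstant q a b -> 0 < c.
Proof.
move=> [s0 [t0 [s0I t0I qst]]]; rewrite lt_neqAle speed_ge0 andbT.
apply/eqP => c0; apply: qst.
have qa : forall t, a <= t <= b -> q t = q a.
  apply: (real_induction (P := fun t => q t = q a) (ltW ab) erefl).
  move=> t tab; have [U [e [L [oU Uq UF e0 [L0 H xL]]]]] := curve_chart_local tab.
  have key r r' : a <= r -> r <= r' -> r' <= b -> `|r - t| < e -> `|r' - t| < e -> q r = q r'.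
    move=> ar rr' rb re re'.
    have sub x : r <= x <= r' -> a <= x <= b /\ `|x - t| < e.
      by move: re re'; rewrite !ltr_norml; lra.
    have := @lipschitz_ae_mx_derive_le _ _ _ (fun s => cmap (chart_at (q t)) (q s))
      r r' L 0 rr' (lexx _).
    case: qad => _ _ _ _ vel.
    move=> /(_ _ _)/=; rewrite mul0r normr_le0 subr_eq0 => xE.
    have [_ cr _] := H r ltac:(lra) re.
    have [_ cr' _] := H r' ltac:(lra) re'.
    rewrite -(cmapK cr) -(cmapK cr'); congr (cinv _ _); apply/esym/eqP/xE.
      move=> s s' sr sr'; have [sa se] := sub s sr; have [sa' se'] := sub s' sr'.
      exact: xL.
    apply: (ae_imp (ae_and vel u_c)) => s [sv su] sr.
    move: (sr); rewrite in_itv /= => sr1.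
    have [sa se] := sub s ltac:(lra).
    have sab : a < s < b by lra.
    have [_ cs _] := H s sa se.
    exists 0; last by rewrite normr0.
    have u0 : (u s).1 = 0 /\ (u s).2 = 0.
      have : speed u s = 0 by rewrite su// in_itv.
      move/eqP; rewrite sqrtr_eq0 => uu.
      have g1s := sqr_ge0 (u s).1; have g2s := sqr_ge0 (u s).2.
      by split; apply/eqP; rewrite -sqrf_eq0; apply/eqP; lra.
    have := sv; rewrite in_itv /= => /(_ sab); rewrite u0.1 u0.2 !scale0r addr0 => v0.
    have := velocity_in_chart (@qc) (chart_at_atlas (q t)) cs sab v0.
    by rewrite tcoord0.
  exists e => // s sab se; have te : `|t - t| < e by rewrite subrr normr0.
  case/andP: sab => a_s sb; case/andP: tab => a_t t_b.
  by split=> st <-; [apply/esym; exact: key|apply/esym; exact: key].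
move: s0I t0I; rewrite !in_itv /= => s0I t0I.
by rewrite (qa _ s0I) (qa _ t0I).
Qed.

Lemma has_velocity_of_chart ch t v : atlas ch -> cdom ch (q t) -> a < t < b ->
  is_derive t (1 : R) (cmap ch \o q) (tcoord ch (q t) v) -> has_velocity q t v.
Proof.
move=> ach chq tab qv; have cc := curve_continuous (@qc) tab.
have ap := chart_at_atlas (q t); have dp := chart_at_dom (q t).
have td := transition_differentiable ach ap chq dp.
have vE : dtransition ch (chart_at (q t)) (q t) (tcoord ch (q t) v) = v.
  by rewrite tcoordE dtransition_comp// dtransition_id.
rewrite -[v]vE.
have := is_derive_comp qv td; apply: near_eq_is_derive.
have W := open_nbhs_nbhs (conj (@cdom_open _ _ ch) chq).
have W2 : \forall s \near t, cdom ch (q s) by exact: cc _ W.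
by move: W2; apply: filterS => s /= cs; rewrite cmapK.
Qed.

Section no_return.
Variable eg : R.
Hypothesis c_gt0 : 0 < c.
Hypothesis eg_gt0 : 0 < eg.
Hypothesis qmin : forall s t, a <= s -> s < t -> t <= b -> t - s < eg -> length_minimizer S q s t u.
Hypothesis u1_0 : {ae mu, forall t, t \in `]a, b[ -> (u t).1 = 0}.

Lemma control2_norm : {ae mu, forall t, t \in `]a, b[ -> `|(u t).2| = c}.
Proof.
apply: (ae_imp (ae_and u_c u1_0)) => t [ut u1t] tI.
have tI' : t \in `[a, b] by move: tI; rewrite !in_itv /=; lra.
by rewrite -(ut tI') /speed (u1t tI) expr0n add0r sqrtr_sqr.
Qed.

(* By minimality [q] is injective near [t0]; since a curve tangent to X2 is
   determined by a transverse coordinate [z], [z] is injective as well, hence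
   monotone, and this fixes the sign of the control. *)
Lemma local_velocity t0 : a < t0 < b -> exists e k : R, [/\ 0 < e, k = c \/ k = - c &
  forall t, `|t - t0| < e -> a < t < b /\ has_velocity q t (k *: fX2 (F t) (q t))].
Proof.
move=> tab0; have tab : a <= t0 <= b by exact: lt_itv_le.
have [U [e1 [L [oU Uq UF e10 [L0 H xL]]]]] := curve_chart_local tab.
pose ch := chart_at (q t0); pose x s := cmap ch (q s).
pose V := vf_in ch (fX2 (F t0)).
have ap := chart_at_atlas (q t0); have dp := chart_at_dom (q t0).
have V_s : smooth_vf U (fX2 (F t0)) by rewrite -frame_vf1; exact: frame_vf_smooth UF.
have Vt p : U p -> cdom ch p -> tame V (cmap ch p) by move=> Up cp; exact: vf_in_tame oU V_s Up cp.
have VE s : a <= s <= b -> `|s - t0| < e1 -> tcoord ch (q s) (fX2 (F s) (q s)) = V (x s).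
  move=> sab se; have [Us cs Fs] := H s sab se.
  by rewrite /V /x vf_inE// -!frame_vf1 (nbhs_singleton Fs).
(* X2 is part of a basis, so it does not vanish and some coordinate is transverse to it. *)
have [j Vj] : exists j, V (x t0) 0 j != 0.
  have /eqP : V (x t0) <> 0.
    rewrite /V /x vf_in_chart_at => X20.
    have := coord_frame_vf 1 1 UF Uq; rewrite frame_vf1 X20 linear0 /= => /eqP.
    by rewrite eq_sym oner_eq0.
  apply: contra_neqP => nV; apply/rowP => j; rewrite mxE.
  by apply/eqP/negPn/negP => Vj; apply: nV; exists j.
have [d d0 rec] := flow_line_recurrence (Vt _ Uq dp) Vj (ltW c_gt0).
have half0 : 0 < `|V (x t0) 0 j| / 2 by rewrite divr_gt0// normr_gt0.
(* Within [d2] component [j] of [V] keeps the sign it has at [x t0]. *)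
have [d2 d20 d2P] := (continuous_atP _ _).1 (tame_continuous (tame_coord 0 j (Vt _ Uq dp))) _ half0.
have [d3 [d30 d3d d3d2]] : exists d3 : R, [/\ 0 < d3, d3 <= d & d3 <= d2].
  by exists (Num.min d d2); rewrite lt_min d0 d20 !ge_min !lexx orbT.
have L10 : 0 < L + 1 by rewrite ltr_wpDl.
have [e [e0 eP]] : exists e : R, 0 < e /\ forall s, `|s - t0| < e ->
  [/\ `|s - t0| < e1, a < s < b, `|s - t0| < d / 2, `|s - t0| < eg / 2 & `|x s - x t0| < d3].
  (* Halved radii [d / 2] and [eg / 2]: two times in the ball are only as close as its diameter. *)
  exists (Num.min (Num.min e1 (Num.min (t0 - a) (b - t0)))
    (Num.min (Num.min (d / 2) (eg / 2)) (d3 / (L + 1)))).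
  split; first by rewrite !lt_min e10 !divr_gt0// !subr_gt0 !andbT.
  move=> s; rewrite !lt_min => /andP[/andP[se1 /andP[sa sb]] /andP[/andP[sd sg] sL]].
  have sab : a < s < b by move: sa sb; rewrite !ltr_norml; lra.
  have sabw : a <= s <= b by exact: lt_itv_le.
  have t0e1 : `|t0 - t0| < e1 by rewrite subrr normr0.
  split => //; apply: le_lt_trans (xL s t0 sabw tab se1 t0e1) _.
  move: sL; rewrite ltr_pdivlMr// => sL; apply: le_lt_trans sL.
  by rewrite mulrDr mulr1 mulrC lerDl.
have xLe s r : `|s - t0| < e -> `|r - t0| < e -> `|x s - x r| <= L * `|s - r|.
  by move=> /eP[? ? _ _ _] /eP[? ? _ _ _]; apply: xL => //; exact: lt_itv_le.
have between s t r : `|s - t0| < e -> `|t - t0| < e -> s <= r <= t -> `|r - t0| < e.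
  exact: segment_in_ball.
have xd : {ae mu, forall t, `|t - t0| < e ->
    is_derive t (1 : R) x ((u t).2 *: V (x t)) /\ `|(u t).2| = c}.
  case: qad => _ _ _ _ vel.
  apply: (ae_imp (ae_and (ae_and vel u1_0) control2_norm)) => t [[vt u1t] u2t] te.
  have [te1 tab' _ _ _] := eP t te; have tabw : a <= t <= b by exact: lt_itv_le.
  have tI : t \in `]a, b[ by rewrite in_itv.
  have [_ ct _] := H t tabw te1.
  have := vt tI; rewrite (u1t tI) scale0r add0r => vt'.
  have := velocity_in_chart (@qc) ap ct tab' vt'.
  by rewrite tcoordZ (VE t tabw te1); split => //; exact: u2t.
pose z s := x s 0 j.
pose I := `]t0 - e, t0 + e[.
have IP s : s \in I -> `|s - t0| < e by rewrite in_itv /= ltr_norml; lra.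
have zc : {within [set` I], continuous z}.
  apply: continuous_in_subspaceT => s; rewrite inE => /IP se.
  apply/continuous_atP => r r0; pose r' := Num.min (e - `|s - t0|) (r / (L + 1)).
  exists r'; first by rewrite lt_min divr_gt0// subr_gt0 se.
  move=> y; rewrite lt_min => /andP[ys yr].
  have ye : `|y - t0| < e.
    by rewrite -(subrKA s); apply: (le_lt_trans (ler_normD _ _)); lra.
  rewrite /z; have := coord_norm_le (x y - x s) 0 j; rewrite !mxE => /le_trans; apply.
  apply: (le_trans (xLe _ _ ye se)); apply: (le_trans (ler_wpM2l L0 (ltW yr))).
  by rewrite mulrCA ger_pMr// ler_pdivrMr//; lra.
have zinj s t : `|s - t0| < e -> `|t - t0| < e -> s < t -> z s <> z t.
  move=> se te st zst.
  have [se1 sab sd sg sx] := eP s se; have [te1 tab1 td tg tx] := eP t te.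
  have sab' : a <= s <= b by exact: lt_itv_le.
  have tab' : a <= t <= b by exact: lt_itv_le.
  have [_ cs _] := H s sab' se1; have [_ ct _] := H t tab' te1.
  have tsd : t - s <= d := ltW (ball_half_sub_lt sd td).
  have tsg : t - s < eg := ball_half_sub_lt sg tg.
  have /andP[as_ _] := sab'.
  have /andP[_ tb] := tab'.
  (* Equal values of [z] force equal points of the arc, which a minimizing arc excludes. *)
  apply: (minimizer_no_return qad u_c c_gt0 as_ st tb (qmin as_ st tb tsg)).
  rewrite -(cmapK cs) -(cmapK ct); congr (cinv _ _).
  apply: (rec x s t L) => //; first exact: ltW.
  - move=> r srt; have [_ _ _ _] := eP r (between _ _ _ se te srt).
    by move/lt_le_trans; apply.
  - by move=> r r' srt srt'; apply: xLe; exact: between se te _.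
  - apply: (ae_imp xd) => r xr; rewrite in_itv /= => srt.
    have srt' : s <= r <= t by exact: lt_itv_le.
    have [xr1 u2r] := xr (between _ _ _ se te srt').
    by exists (u r).2 => //; rewrite u2r.
have zinjI : {in I &, injective z}.
  move=> s t /IP se /IP te zst; apply/eqP; rewrite -[_ == _]negbK; apply/negP.
  by rewrite neq_lt => /orP[st|ts]; [exact: (zinj s t)|exact: (zinj t s)].
have [tau [tau0 zmono]] : exists tau : R, tau != 0 /\
    forall s t, s \in I -> t \in I -> s <= t -> 0 <= tau * (z t - z s).
  have [zm|zm] := itv_continuous_inj_mono zc zinjI.
    exists 1; split; first exact: oner_neq0.
    move=> s t sI tI; rewrite mul1r subr_ge0 le_eqVlt => /orP[/eqP->//|st].
    exact/ltW/zm.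
  exists (- 1); split; first by rewrite oppr_eq0 oner_neq0.
  move=> s t sI tI; rewrite mulN1r opprB subr_ge0 le_eqVlt => /orP[/eqP->//|st].
  exact/ltW/zm.
(* The derivative of [z] is u2 times component [j] of [V]; it has the sign of [tau] or vanishes, and
   that component has the sign it has at [x t0]. Since |u2| = [c], the sign of [kap] determines
   u2. *)
pose kap := tau * V (x t0) 0 j.
have kap0 : kap != 0 by rewrite mulf_neq0.
pose k := Num.sg kap * c.
have u2k : {ae mu, forall t, `|t - t0| < e -> is_derive t (1 : R) x (k *: V (x t))}.
  apply: (ae_imp xd) => t xt te; have [xt1 u2t] := xt te.
  suff <- : (u t).2 = k by [].
  have [_ _ _ _ /lt_le_trans/(_ d3d2) td2] := eP t te.
  have tI : t \in I by move: te; rewrite in_itv /= ltr_norml; lra.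
  have pos : 0 <= tau * ((u t).2 * V (x t) 0 j).
    have dz : is_derive t (1 : R) (fun s => tau *: z s : R^o) (tau *: ((u t).2 * V (x t) 0 j)).
      apply: is_deriveZ; have := is_derive_coord 0 j xt1; by rewrite mxE.
    apply: is_derive_nondecreasing_ge0 (ball_right_gt0 te) _ dz => s ts ste.
    rewrite -subr_ge0 /GRing.scale /= -mulrBr.
    exact: (zmono t s tI (ball_right_itv te ts ste) ts).
  have := d2P (x t) td2; rewrite -/(V _) => Vclose.
  have same : 0 < V (x t) 0 j * V (x t0) 0 j.
    move: Vclose Vj; rewrite /x -/ch; set v := V _ 0 j; set w := V _ 0 j => Vc Vj.
    have w2 : 0 < w ^+ 2 by rewrite exprn_even_gt0.
    have : `|(v - w) * w| <= w ^+ 2 / 2.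
      rewrite normrM; apply: (le_trans (ler_wpM2r _ Vc)) => //.
      by rewrite mulrAC -expr2 real_normK ?num_real.
    by rewrite ler_norml mulrBl -expr2; lra.
  have ku : 0 <= kap * (u t).2.
    have : 0 <= (tau * ((u t).2 * V (x t) 0 j)) * (V (x t) 0 j * V (x t0) 0 j).
      by rewrite mulr_ge0// ltW.
    have -> : tau * ((u t).2 * V (x t) 0 j) * (V (x t) 0 j * V (x t0) 0 j) =
       (V (x t) 0 j) ^+ 2 * (kap * (u t).2) by rewrite /kap; ring.
    have Vt0 : V (x t) 0 j != 0 by apply: contraTneq same => ->; rewrite mul0r ltxx.
    by rewrite pmulr_rge0// exprn_even_gt0.
  exact: eq_sg_mul.
exists e, k; split => //.
  exact: sg_mul_or.
move=> t te; have [te1 tab1 _ _ _] := eP t te; split => //.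
have tab' : a <= t <= b by exact: lt_itv_le.
have [Ut ct _] := H t tab' te1.
apply: (has_velocity_of_chart ap ct tab1).
rewrite tcoordZ (VE t tab' te1).
have r0 : 0 < e - `|t - t0| by rewrite subr_gt0.
have near_e s : `|s - t| < e - `|t - t0| -> `|s - t0| < e.
  by move=> st; rewrite -(subrKA t); apply: (le_lt_trans (ler_normD _ _)); lra.
(* With the coefficient constant the right-hand side is continuous, so the equation holds at every
   time. *)
apply: (@lipschitz_ae_is_derive _ _ _ x (fun s => k *: V (x s)) t _ L r0).
- by move=> s r st rt; apply: xLe; exact: near_e.
- by apply: (ae_imp u2k) => s xs st; apply: xs; exact: near_e.
- have xc : {for t, continuous x}.
    apply: locally_lipschitz_continuous; exists L, (e - `|t - t0|); split => //.
    by move=> s r st rt; apply: xLe; exact: near_e.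
  have Vc := tame_continuous (Vt _ Ut ct).
  have VxC : {for t, continuous (V \o x)} := cvg_comp _ _ xc Vc.
  apply/continuous_atP => r r1; have k1 : 0 < `|k| + 1 by rewrite ltr_wpDl.
  have [h h0 hP] := (continuous_atP _ _).1 VxC (r / (`|k| + 1)) (divr_gt0 r1 k1).
  exists h => // s sh; rewrite -scalerBr normrZ.
  apply: (le_trans (ler_wpM2l (normr_ge0 k) (hP s sh))).
  by rewrite mulrCA ger_pMr// ler_pdivrMr// mul1r lerDl.
Qed.

End no_return.

End curve.
End geodesics.

Lemma midpoint_itv (R : realType) (a b : R) : a < b -> a < (a + b) / 2 < b.
Proof. by move=> ab; apply/andP; split; lra. Qed.

(** * The dual frame *)

Section dual_frame.
Context {R : realType} {M : manifold4 R} (S : engel_structure M).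
Local Notation E := 'rV[R]_4.

Definition frame_mx (c : chart R M) (F : frame4 M) (x : E) : 'M[R]_4 :=
  \matrix_(i, j) vf_in c (frame_vf F i) x 0 j.

(** Column [i] of the inverse of the frame matrix, in Cramer's form so that its regularity follows
    from that of the frame. *)
Definition dual_in (c : chart R M) (F : frame4 M) (i : 'I_4) (x : E) : E :=
  \row_j ((\det (frame_mx c F x))^-1 *: \adj (frame_mx c F x)) j i.

Definition dual_covector (F : frame4 M) (i : 'I_4) (p : M) : E :=
  dual_in (chart_at p) F i (cmap (chart_at p) p).

Lemma tcoord_sum (c : chart R M) p n (v : 'I_n -> E) :
  tcoord c p (\sum_i v i) = \sum_i tcoord c p (v i).
Proof. exact: (linear_sum ('d (cmap c \o cinv (chart_at p)) (cmap (chart_at p) p))). Qed.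

Lemma frame_mx_det U F c p : canonical_frame_on S U F -> U p -> atlas c -> cdom c p ->
  \det (frame_mx c F (cmap c p)) != 0.
Proof.
move=> UF Up ac cp; apply/negP => /det0P[v v0 vA].
have tv : tcoord c p (\sum_i v 0 i *: frame_vf F i p) = 0.
  rewrite tcoord_sum; apply/rowP => j; rewrite -[in RHS]vA !mxE summxE.
  by apply: eq_bigr => i _; rewrite tcoordZ !mxE vf_inE.
(* Coordinate vectors in [c] determine tangent vectors: each pairing of a covector with a vector can
   be computed in [c]. *)
have v_0 : \sum_i v 0 i *: frame_vf F i p = 0.
  apply/rowP => j; rewrite -pairing_delta pairingC -(pairing_ccoord_tcoord _ _ ac cp).
  by rewrite tv pairing0r mxE.
case/eqP: v0; apply/rowP => i; rewrite mxE.
have [_ /(_ p Up)[/andP[_ /freeP fF] _ _ _ _]] := UF.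
apply: (fF (fun i => v 0 i)); rewrite -[RHS]v_0; apply: eq_bigr => k _.
by rewrite /frame_vf (tnth_nth 0).
Qed.

Lemma pairing_dual_in c F i j x : \det (frame_mx c F x) != 0 ->
  pairing (dual_in c F i x) (vf_in c (frame_vf F j) x) = (i == j)%:R.
Proof.
move=> dA; have /matrixP/(_ j i) := mul_mx_adj (frame_mx c F x).
rewrite !mxE => H; have := congr1 (fun r => (\det (frame_mx c F x))^-1 * r) H.
rewrite /= [in RHS]mulrnAr mulVf// eq_sym => <-.
rewrite mulr_sumr pairingC; apply: eq_bigr => k _; rewrite !mxE.
by rewrite mulrCA.
Qed.

Lemma pairing_dual_tcoord U F c i p v : canonical_frame_on S U F -> U p -> atlas c ->
  cdom c p -> pairing (dual_in c F i (cmap c p)) (tcoord c p v) = coord (frame_at F p) i v.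
Proof.
move=> UF Up ac cp; rewrite {1}(frame_expand v UF Up) tcoord_sum.
have dA := frame_mx_det UF Up ac cp.
have H j : pairing (dual_in c F i (cmap c p)) (tcoord c p (frame_vf F j p)) = (i == j)%:R.
  by rewrite -(vf_inE _ cp) pairing_dual_in.
rewrite (big_morph _ (pairingDr _) (pairing0r _)) (bigD1 i)//= tcoordZ pairingZr H eqxx mulr1.
rewrite big1 ?addr0// => k /negPf ki.
by rewrite tcoordZ pairingZr H eq_sym ki mulr0.
Qed.

Lemma pairing_dual_covector U F i p v : canonical_frame_on S U F -> U p ->
  pairing (dual_covector F i p) v = coord (frame_at F p) i v.
Proof.
move=> UF Up; rewrite -(pairing_dual_tcoord i v UF Up (chart_at_atlas p) (chart_at_dom p)).
by rewrite tcoord_chart_at.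
Qed.

Lemma tcoord_surj (c : chart R M) p w : atlas c -> cdom c p ->
  w = tcoord c p (dtransition c (chart_at p) p w).
Proof.
move=> ac cp; rewrite tcoordE dtransition_comp ?dtransition_id//.
  exact: chart_at_atlas.
exact: chart_at_dom.
Qed.

Lemma ccoord_dual_covector U F c i p : canonical_frame_on S U F -> U p -> atlas c ->
  cdom c p -> ccoord c p (dual_covector F i p) = dual_in c F i (cmap c p).
Proof.
move=> UF Up ac cp; apply: pairing_ext => w; rewrite (tcoord_surj w ac cp).
rewrite pairing_ccoord_tcoord// (pairing_dual_covector _ _ UF Up).
by rewrite (pairing_dual_tcoord _ _ UF Up).
Qed.

Lemma dual_in_tame U F c i j p : open U -> canonical_frame_on S U F -> U p -> atlas c ->
  cdom c p -> tame (fun x => dual_in c F i x 0 j) (cmap c p).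
Proof.
move=> oU UF Up ac cp.
have H : tame (fun x => ((\det (frame_mx c F x))^-1 *: \adj (frame_mx c F x)) j i) (cmap c p).
  apply: tame_invmx; last exact: frame_mx_det UF Up ac cp.
  move=> k l; rewrite (_ : (fun _ => _) = (fun x => vf_in c (frame_vf F k) x 0 l)); last first.
    by apply/funext => x; rewrite mxE.
  apply: tame_coord; exact: vf_in_tame ac oU (frame_vf_smooth k UF) Up cp.
rewrite (_ : (fun _ => _) = (fun x => ((\det (frame_mx c F x))^-1 *: \adj (frame_mx c F x)) j i))//.
by apply/funext => x; rewrite mxE.
Qed.

Lemma dual_in_lipschitz U F c i p : open U -> canonical_frame_on S U F -> U p -> atlas c ->
  cdom c p -> locally_lipschitz_at (dual_in c F i) (cmap c p).
Proof.
move=> oU UF Up ac cp; apply: locally_lipschitz_mx => k j; rewrite (ord1 k).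
by have [] := dual_in_tame i j oU UF Up ac cp.
Qed.

Section along.
Variables (a b : R) (q : R -> M) (F : R -> frame4 M).
Hypothesis qc : {within [set` `[a, b]], continuous q}.
Hypothesis Fq : canonical_frame_along S q a b F.

(** With the frame and chart of one time, the coordinate is a continuous function of the chart
    composed with the curve. It is applied to T4 and to the X2-component of [X2, X4]. *)
Lemma bracket_coord_continuous (i j l : 'I_4) :
  {within [set` `[a, b]], continuous (fun s => coord (frame_at (F s) (q s)) l
     (lie_bracket (frame_vf (F s) i) (frame_vf (F s) j) (q s)))}.
Proof.
set f := (f in {within _, continuous f}).
apply/within_segment_continuousP => t tab W fW.
have [U [e [oU Uq UF e0 H]]] := frame_along_local qc Fq tab.
have ap := chart_at_atlas (q t); have dp := chart_at_dom (q t).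
pose ch := chart_at (q t).
pose g x := pairing (dual_in ch (F t) l x) (bracket_in ch (frame_vf (F t) i) (frame_vf (F t) j) x).
have fE s : a <= s <= b -> `|s - t| < e -> f s = g (cmap ch (q s)).
  move=> sab se; have [Us cs Fs] := H s sab se.
  rewrite /g (lie_bracket_in ap oU (frame_vf_smooth i UF) (frame_vf_smooth j UF) Us cs).
  rewrite (pairing_dual_tcoord _ _ UF Us ap cs) /f.
  have [V [_ [oV Vq VF _ _]]] := frame_along_local qc Fq sab.
  have Fsi : \forall x \near q s, frame_vf (F s) i x = frame_vf (F t) i x.
    by move: Fs; apply: filterS => x /(_ i).
  have Fsj : \forall x \near q s, frame_vf (F s) j x = frame_vf (F t) j x.
    by move: Fs; apply: filterS => x /(_ j).
  rewrite (lie_bracket_near_eq oV oU Vq Us (frame_vf_smooth i VF) (frame_vf_smooth j VF)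
    (frame_vf_smooth i UF) (frame_vf_smooth j UF) Fsi Fsj).
  congr (coord _ _ _); apply: val_inj => /=.
  have := nbhs_singleton Fs => Fsq.
  move: (Fsq 0) (Fsq 1) (Fsq 2) (Fsq 3).
  by rewrite !frame_vf0 !frame_vf1 !frame_vf2 !frame_vf3 => -> -> -> ->.
have gc : {for cmap ch (q t), continuous g}.
  have Dc : {for cmap ch (q t), continuous (dual_in ch (F t) l)}.
    exact: locally_lipschitz_continuous (dual_in_lipschitz l oU UF Uq ap dp).
  have Bc := bracket_in_continuous ap oU (frame_vf_smooth i UF) (frame_vf_smooth j UF) Uq dp.
  have FG : Filter (nbhs (cmap ch (q t))) by exact: nbhs_filter.
  exact: (pairing_cvg Dc Bc).
have te : `|t - t| < e by rewrite subrr normr0.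
rewrite fE// in fW.
have Wg : nbhs (q t) ((g \o cmap ch) @^-1` W).
  have Wg := gc W fW.
  exact: (cmap_continuous dp Wg).
have [d d0 dP] := (within_segment_continuousP q a b).1 qc t tab _ Wg.
exists (Num.min e d); first by rewrite lt_min e0.
move=> s sab; rewrite lt_min => /andP[se sd]; rewrite fE//.
exact: (dP s sab sd).
Qed.

End along.

Local Notation mu := (@lebesgue_measure R).

Lemma integral_curve_of_velocity (a b k : R) (q : R -> M) (F : R -> frame4 M) :
  a < b -> k != 0 -> {within [set` `[a, b]], continuous q} ->
  (forall t, a < t < b -> has_velocity q t (k *: fX2 (F t) (q t))) ->
  integral_curve_X2_upto_speed q a b F.
Proof.
move=> ab k0 qc vel; exists k => //.
(* For [k < 0] scaling exchanges the endpoints, hence the minimum and maximum. *)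
have inv_itv (s : R) : (Num.min (k * a) (k * b) < s < Num.max (k * a) (k * b)) = (a < s / k < b).
  case: (ltgtP k 0) k0 => [kn|kp|//] _.
    have kba : k * b <= k * a by rewrite ler_wnM2l ?ltW.
    rewrite (min_r kba) (max_l kba).
    by rewrite ltr_ndivlMr// ltr_ndivrMr// andbC [_ * k]mulrC [b * k]mulrC.
  have kab : k * a <= k * b by rewrite ler_wpM2l ?ltW.
  rewrite (min_l kab) (max_r kab).
  by rewrite ltr_pdivlMr// ltr_pdivrMr// [_ * k]mulrC [b * k]mulrC.
have inv_itvW (s : R) :
    (Num.min (k * a) (k * b) <= s <= Num.max (k * a) (k * b)) = (a <= s / k <= b).
  case: (ltgtP k 0) k0 => [kn|kp|//] _.
    have kba : k * b <= k * a by rewrite ler_wnM2l ?ltW.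
    rewrite (min_r kba) (max_l kba).
    by rewrite ler_ndivlMr// ler_ndivrMr// andbC [_ * k]mulrC [b * k]mulrC.
  have kab : k * a <= k * b by rewrite ler_wpM2l ?ltW.
  rewrite (min_l kab) (max_r kab).
  by rewrite ler_pdivlMr// ler_pdivrMr// [_ * k]mulrC [b * k]mulrC.
split.
  apply/within_segment_continuousP => t; rewrite inv_itvW => tab W qW.
  have [d d0 dP] := (within_segment_continuousP q a b).1 qc _ tab W qW.
  exists (d * `|k|); first by rewrite mulr_gt0// normr_gt0.
  move=> s; rewrite inv_itvW => sab st; apply: dP => //.
  by rewrite -mulrBl normrM normfV ltr_pdivrMr// normr_gt0.
move=> s; rewrite in_itv /= inv_itv => sab.
have divd : is_derive s (1 : R) (fun r : R => r / k) k^-1.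
  apply/is_derive1P => e e0; exists 1 => // r _.
  by rewrite -mulrBl subrr normr0 mulr_ge0// ltW.
have := is_derive_comp_scalar divd (vel _ sab).
by rewrite scalerA mulVf// scale1r.
Qed.

(** * Constant velocity, and T4 along normal extremals *)

Section velocity.
Variables (a b c : R) (q : R -> M) (F : R -> frame4 M) (u : R -> R * R).
Hypothesis ab : a < b.
Hypothesis qad : admissible S q a b F u.
Hypothesis u_c : {ae mu, forall t, t \in `[a, b] -> speed u t = c}.
Hypothesis c_gt0 : 0 < c.
Variable eg : R.
Hypothesis eg_gt0 : 0 < eg.
Hypothesis qmin : forall s t, a <= s -> s < t -> t <= b -> t - s < eg -> length_minimizer S q s t u.
Hypothesis u1_0 : {ae mu, forall t, t \in `]a, b[ -> (u t).1 = 0}.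

Let qc : {within [set` `[a, b]], continuous q}.
Proof. by case: qad => -[]. Qed.

Let Fq : canonical_frame_along S q a b F.
Proof. by case: qad. Qed.

Lemma frame_vf_neq0 t i : a <= t <= b -> frame_vf (F t) i (q t) != 0.
Proof.
move=> tab; have [U [_ [_ Uq UF _ _]]] := frame_along_local (@qc) (@Fq) tab.
apply/eqP => Xi0; have := coord_frame_vf i i UF Uq.
by rewrite Xi0 linear0 eqxx => /eqP; rewrite eq_sym oner_eq0.
Qed.

(** X2 does not vanish, so the coefficient is unique at each time; it is therefore locally constant,
    and real induction propagates it. *)
Lemma constant_velocity : exists k : R, [/\ k != 0, `|k| = c &
  forall t, a < t < b -> has_velocity q t (k *: fX2 (F t) (q t))].
Proof.
have loc := local_velocity qad u_c c_gt0 eg_gt0 qmin u1_0.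
pose P k t := has_velocity q t (k *: fX2 (F t) (q t)).
have P_inj k k' t : a < t < b -> P k t -> P k' t -> k = k'.
  move=> tab Pk Pk'; have := is_derive_unique Pk Pk'.
  move=> /eqP; rewrite -subr_eq0 -scalerBl scaler_eq0 subr_eq0 -frame_vf1.
  by rewrite (negPf (frame_vf_neq0 1 (lt_itv_le tab))) orbF => /eqP.
have fwd k s t : a < s -> s <= t -> t < b -> P k s -> P k t.
  move=> as_ st tb Ps.
  apply: (real_induction (P := P k) st Ps); last by rewrite st lexx.
  move=> r /andP[sr rt]; have rab : a < r < b.
    by rewrite (lt_le_trans as_ sr) (le_lt_trans rt tb).
  have [e [k' [e0 _ ek']]] := loc r rab.
  have re : `|r - r| < e by rewrite subrr normr0.
  have [_ Pr] := ek' r re.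
  exists e => // x _ xe; have [xab Px] := ek' x xe.
  by split=> _ Pk; [rewrite (P_inj _ _ _ xab Pk Px)|rewrite (P_inj _ _ _ rab Pk Pr)].
have m_ab := midpoint_itv ab.
have [e [k [e0 kc ek]]] := loc _ m_ab.
have me : `|(a + b) / 2 - (a + b) / 2| < e by rewrite subrr normr0.
have [_ Pm] := ek _ me; exists k.
have k_c : `|k| = c by case: kc => ->; rewrite ?normrN gtr0_norm.
split => //; first by rewrite -normr_gt0 k_c.
move=> t tab; have [/andP[am mb] /andP[at_ tb]] := (m_ab, tab).
(* Propagation goes forward only: for [t] before the midpoint, the coefficient at [t] is carried to
   the midpoint and compared there. *)
have [tm|mt] := leP t ((a + b) / 2); last exact: fwd am (ltW mt) tb Pm.
have [e' [k' [e'0 _ ek']]] := loc t tab.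
have te' : `|t - t| < e' by rewrite subrr normr0.
have [_ Pt] := ek' t te'.
by rewrite (P_inj _ _ _ m_ab Pm (fwd _ _ _ at_ tm mb Pt)).
Qed.

Lemma control_eq k : (forall t, a < t < b -> has_velocity q t (k *: fX2 (F t) (q t))) ->
  {ae mu, forall t, t \in `]a, b[ -> u t = (0, k)}.
Proof.
move=> vel; case: qad => _ _ _ _ velu.
apply: (ae_imp (ae_and velu u1_0)) => t [vt u1t] tI.
have tab : a < t < b by move: tI; rewrite in_itv.
rewrite [u t]surjective_pairing (u1t tI); congr (_, _).
have := vt tI; rewrite (u1t tI) scale0r add0r => vt'.
have := is_derive_unique vt' (vel t tab).
move=> /eqP; rewrite -subr_eq0 -scalerBl scaler_eq0 subr_eq0 -frame_vf1.
by rewrite (negPf (frame_vf_neq0 1 (lt_itv_le tab))) orbF => /eqP.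
Qed.

Section normal_extremal.
Variable k : R.
Hypothesis k0 : k != 0.
Hypothesis vel : forall t, a < t < b -> has_velocity q t (k *: fX2 (F t) (q t)).

(** For general [nu] the computation reads 0 = h3' = - nu k^2 T4, where neither [nu] nor [k]
    vanishes. *)
Lemma normal_T4 lam nu : nu < 0 -> pmp q a b F u lam nu ->
  forall t, t \in `[a, b] -> T4 (F t) (q t) = 0.
Proof.
move=> nu0 pm; have [lamL _ _ _ _] := pm.
have hc i : {within [set` `[a, b]], continuous (frame_pairing q F lam i)}.
  exact: (@frame_pairing_continuous _ _ _ _ _ _ _ (@qc) (@Fq)).
have pp := ae_and (pmp_pairings pm) (control_eq vel).
have h0 : forall t, t \in `[a, b] -> frame_pairing q F lam 0 t = 0.
  apply: (ae_within_continuous_eq ab (hc 0)).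
  by apply: (ae_imp pp) => t [pt ut] tI; have [_ -> _] := pt tI; rewrite (ut tI) mulr0.
have h1 : forall t, t \in `[a, b] -> frame_pairing q F lam 1 t = - nu * k.
  apply: (ae_within_continuous_eq ab (hc 1)).
  by apply: (ae_imp pp) => t [pt ut] tI; have [_ _ ->] := pt tI; rewrite (ut tI).
have h2 : forall t, t \in `[a, b] -> frame_pairing q F lam 2 t = 0.
  apply: (ae_within_continuous_eq ab (hc 2)).
  apply: (ae_imp pp) => t [pt ut] tI; have [ext _ _] := pt tI.
  have tab : a < t < b by move: tI; rewrite in_itv.
  have d0 := frame_pairing_derive (@qc) (@Fq) 0 tab ext.
  have := is_derive_unique d0 (is_derive_interior_cst h0 tab).
  rewrite (ut tI) frame_vf0 (lie_bracketC (fX1 (F t)) (fX2 (F t))) mul0r add0r /=.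
  rewrite (bracket12 qad tab) pairingNr mulrN -frame_vf2 => /eqP.
  by rewrite oppr_eq0 mulf_eq0 (negPf k0) => /eqP.
(* Continuity of T4 along the curve brings the identity from almost every time to all times. *)
have T4c := @bracket_coord_continuous a b q F (@qc) (@Fq) 1 2 1.
suff : forall t, t \in `[a, b] ->
    coord (frame_at (F t) (q t)) 1 (lie_bracket (frame_vf (F t) 1) (frame_vf (F t) 2) (q t)) = 0.
  by move=> H t tI; rewrite /T4 -(H t tI) frame_vf1 frame_vf2.
apply: (ae_within_continuous_eq ab T4c).
apply: (ae_imp pp) => t [pt ut] tI; have [ext _ _] := pt tI.
have tab : a < t < b by move: tI; rewrite in_itv.
have tI' : t \in `[a, b] by rewrite in_itv; exact: lt_itv_le.
have [U [_ [_ Uq UF _ _]]] := frame_along_local (@qc) (@Fq) (lt_itv_le tab).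
have d2 := frame_pairing_derive (@qc) (@Fq) 2 tab ext.
have := is_derive_unique d2 (is_derive_interior_cst h2 tab).
have [al [ga br]] := T4E UF Uq.
rewrite (ut tI) mul0r add0r frame_vf1 frame_vf2 -/(T4 (F t) (q t)) br !pairingDr !pairingZr.
rewrite -frame_vf0 -frame_vf1 -frame_vf2.
rewrite -!/(frame_pairing q F lam _ t) h0// h1// h2// !mulr0 addr0 add0r => /eqP.
by rewrite /= !mulf_eq0 oppr_eq0 (negPf k0) (lt_eqF nu0) /= orbF => /eqP.
Qed.

End normal_extremal.
End velocity.
End dual_frame.

(** * Normal lifts *)

Section segment_lipschitz.
Context {R : realType}.
Variables (a b t : R).

Definition segment_lipschitz (V : normedModType R) (f : R -> V) := exists e L : R,
  [/\ 0 < e, 0 <= L & forall s r, a <= s <= b -> a <= r <= b ->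
    `|s - t| < e -> `|r - t| < e -> `|f s - f r| <= L * `|s - r|].

Lemma segment_lipschitz_near_eq (V : normedModType R) (f g : R -> V) (e : R) : 0 < e ->
  (forall s, a <= s <= b -> `|s - t| < e -> f s = g s) ->
  segment_lipschitz g -> segment_lipschitz f.
Proof.
move=> e0 fg [d [L [d0 L0 gL]]]; exists (Num.min e d), L; split=> //.
  by rewrite lt_min e0.
move=> s r sab rab; rewrite !lt_min => /andP[se sd] /andP[re rd].
by rewrite !fg//; exact: gL.
Qed.

Lemma segment_lipschitzD (V : normedModType R) (f g : R -> V) :
  segment_lipschitz f -> segment_lipschitz g -> segment_lipschitz (fun s => f s + g s).
Proof.
move=> [e [L [e0 L0 fL]]] [d [K [d0 K0 gK]]]; exists (Num.min e d), (L + K); split.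
- by rewrite lt_min e0.
- exact: addr_ge0.
- move=> s r sab rab; rewrite !lt_min => /andP[se sd] /andP[re rd].
  rewrite opprD addrACA mulrDl; apply: (le_trans (ler_normD _ _)).
  by rewrite lerD//; [exact: fL|exact: gK].
Qed.

Lemma segment_lipschitz_scale (V : normedModType R) (g : R -> R) (f : R -> V) :
  a <= t <= b -> segment_lipschitz g -> segment_lipschitz f ->
  segment_lipschitz (fun s => g s *: f s).
Proof.
move=> tab [e [L [e0 L0 gL]]] [d [K [d0 K0 fK]]].
(* A radius of at most 1 bounds [f] by [|f t| + K] and [g] by [|g t| + L]. *)
exists (Num.min 1 (Num.min e d)), (L * (`|f t| + K) + K * (`|g t| + L)); split.
- by rewrite !lt_min ltr01 e0.
- by rewrite addr_ge0// mulr_ge0// addr_ge0.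
- move=> s r sab rab; rewrite !lt_min => /and3P[s1 se sd] /and3P[r1 re rd].
  have te : `|t - t| < e by rewrite subrr normr0.
  have td : `|t - t| < d by rewrite subrr normr0.
  have fs : `|f s| <= `|f t| + K.
    rewrite -[f s](subrK (f t)) addrC; apply: (le_trans (ler_normD _ _)); rewrite lerD2l.
    apply: (le_trans (fK s t sab tab sd td)).
    by rewrite -[leRHS]mulr1 ler_wpM2l// ltW.
  have gr : `|g r| <= `|g t| + L.
    rewrite -[g r](subrK (g t)) addrC; apply: (le_trans (ler_normD _ _)); rewrite lerD2l.
    apply: (le_trans (gL r t rab tab re te)).
    by rewrite -[leRHS]mulr1 ler_wpM2l// ltW.
  have -> : g s *: f s - g r *: f r = (g s - g r) *: f s + g r *: (f s - f r).
    by rewrite scalerBl scalerBr addrA subrK.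
  apply: (le_trans (ler_normD _ _)); rewrite !normrZ mulrDl; apply: lerD.
    rewrite mulrAC; apply: ler_pM => //; exact: gL.
  rewrite mulrAC [leRHS]mulrC; apply: ler_pM => //; exact: fK.
Qed.

Lemma segment_lipschitz_cst (V : normedModType R) (v : V) : segment_lipschitz (fun=> v).
Proof. by exists 1, 0; split=> // s r _ _ _ _; rewrite subrr normr0 mul0r. Qed.

Lemma segment_lipschitz_comp (V W : normedModType R) (g : V -> W) (f : R -> V) :
  a <= t <= b -> locally_lipschitz_at g (f t) -> segment_lipschitz f ->
  segment_lipschitz (g \o f).
Proof.
move=> tab [L [d [L0 d0 gL]]] [e [K [e0 K0 fK]]].
have K1 : 0 < K + 1 by rewrite ltr_wpDl.
exists (Num.min e (d / (K + 1))), (L * K); split.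
- by rewrite lt_min e0 divr_gt0.
- exact: mulr_ge0.
- have te : `|t - t| < e by rewrite subrr normr0.
  have fd s : a <= s <= b -> `|s - t| < e -> `|s - t| < d / (K + 1) -> `|f s - f t| < d.
    move=> sab se; rewrite ltr_pdivlMr// => sd.
    apply: le_lt_trans (fK s t sab tab se te) _; apply: le_lt_trans sd.
    by rewrite mulrDr mulr1 mulrC lerDl.
  move=> s r sab rab; rewrite !lt_min => /andP[se sd] /andP[re rd].
  apply: (le_trans (gL _ _ (fd s sab se sd) (fd r rab re rd))).
  by rewrite -mulrA ler_wpM2l//; exact: fK.
Qed.

Lemma segment_lipschitzP (V : normedModType R) (f : R -> V) :
  (exists2 e : R, 0 < e & [lipschitz f s | s in [set` `[a, b]] `&` ball t e]) <->
  segment_lipschitz f.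
Proof.
split=> [[e e0 /lipschitz_segmentP[L L0 fL]]|[e [L [e0 L0 fL]]]].
  by exists e, L.
by exists e => //; apply/lipschitz_segmentP; exists L.
Qed.

End segment_lipschitz.

(** Clamping extends [g] continuously to the line, so an antiderivative on a larger interval has
    two-sided derivatives even at [a] and [b]. *)
Lemma antiderivative_segment (R : realType) (a b : R) (g : R -> R) : a <= b ->
  {within [set` `[a, b]], continuous g} -> exists H : R -> R,
  forall t, a <= t <= b -> is_derive t (1 : R) H (g t) /\ segment_lipschitz a b t H.
Proof.
move=> ab gc.
have gcl : continuous (g \o clamp a b).
  move=> t; apply/continuous_atP => e e0.
  have [d d0 dP] := (within_segment_continuousP g a b).1 gc _ (clamp_itv t ab) _
    (nbhsx_ballx (g (clamp a b t)) e e0).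
  exists d => // s sd; rewrite distrC; apply/ltW/(dP _ (clamp_itv s ab)).
  exact: le_lt_trans (clamp_lipschitz s t ab) sd.
have ab1 : a - 1 <= b + 1 by lra.
have [H [_ Hd]] := antiderivative_exists ab1 gcl.
exists H => t tab; have Hg s : a <= s <= b -> is_derive s (1 : R) H (g s).
  by move=> sab; have := Hd s ltac:(lra); rewrite /= clamp_id.
split; first exact: Hg.
have [d d0 dP] := (within_segment_continuousP g a b).1 gc t tab _
  (nbhsx_ballx (g t) 1 ltr01).
have gt0 : 0 <= `|g t| + 1 by rewrite addr_ge0.
exists d, (`|g t| + 1); split=> //.
have key s r : a <= s -> s <= r -> r <= b -> `|s - t| < d -> `|r - t| < d ->
    `|H r - H s| <= (`|g t| + 1) * (r - s).
  move=> as_ sr rb sd rd; apply: (@is_derive_increment_le _ _ H g s r _ sr) => v vsr.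
  have vab : a <= v <= b by lra.
  split; first exact: Hg.
  have := dP v vab (segment_in_ball sd rd vsr); rewrite /ball /= distrC => gv.
  by rewrite -[g v](subrK (g t)) addrC; apply: (le_trans (ler_normD _ _)); rewrite lerD2l ltW.
move=> s r /andP[as_ sb] /andP[ar rb] sd rd; have [sr|/ltW rs] := leP s r.
  by rewrite distrC [`|s - r|]distrC (ger0_norm (x := r - s)) ?subr_ge0//; exact: key.
by rewrite (ger0_norm (x := s - r)) ?subr_ge0//; exact: key.
Qed.

Section normal_lift.
Context {R : realType} {M : manifold4 R} (S : engel_structure M).
Local Notation E := 'rV[R]_4.
Local Notation mu := (@lebesgue_measure R).

(** The transpose of the differential applied to [l]. Having it as a covector allows Hamilton's
    equation, which quantifies over all directions, to be tested on the frame alone. *)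
Lemma pairing_differential (f : E -> E) (x l : E) :
  exists eta : E, forall w, pairing eta w = pairing l ('d f x w).
Proof.
exists (\row_i pairing l ('d f x (delta_mx 0 i))) => w.
rewrite [in RHS]differential_delta (big_morph _ (pairingDr l) (pairing0r l)).
by apply: eq_bigr => i _; rewrite mxE pairingZr mulrC.
Qed.

(** In its use [A] is the derivative of X_i along X2 and [B] that of X2 along X_i, so [A - B] is
    [X2, X_i] and [A'] the derivative of X_i along the velocity. *)
Lemma pairing_lift_identity (l A A' B : E) (k c e : R) : A' = k *: A ->
  k * - pairing l A' + (k * k * pairing l (A - B) + c * (- k * e)) =
  - k * (k * pairing l B + c * e).
Proof. by move=> ->; rewrite pairingDr pairingZr pairingNr; ring. Qed.

Variables (a b : R) (q : R -> M) (F : R -> frame4 M).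
Hypothesis qc : {within [set` `[a, b]], continuous q}.
Hypothesis Fq : canonical_frame_along S q a b F.

(** Differentiating the constant pairings of the dual frame with the frame determines [D'] without a
    formula for the derivative of an inverse matrix. *)
Lemma dual_in_curve_derive i t v : a < t < b -> has_velocity q t v ->
  exists D' : E,
    is_derive t (1 : R)
      (fun s => dual_in (chart_at (q t)) (F t) i (cmap (chart_at (q t)) (q s))) D' /\
    forall j, pairing D' (frame_vf (F t) j (q t)) =
      - pairing (dual_covector (F t) i (q t))
          ('d (vf_in (chart_at (q t)) (frame_vf (F t) j)) (cmap (chart_at (q t)) (q t)) v).
Proof.
move=> tab qv; have tabw := lt_itv_le tab.
have [U [_ [oU Uq UF _ _]]] := frame_along_local (@qc) (@Fq) tabw.
have ap := chart_at_atlas (q t); have dp := chart_at_dom (q t).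
pose ch := chart_at (q t); pose x s := cmap ch (q s).
pose D' : E := \row_j 'd (fun y => dual_in ch (F t) i y 0 j) (x t) v.
have dD : is_derive t (1 : R) (fun s => dual_in ch (F t) i (x s)) D'.
  apply: is_derive_mx => k j; rewrite (ord1 k) mxE.
  exact: (is_derive_comp qv (dual_in_tame i j oU UF Uq ap dp).1).
exists D'; split; first exact: dD.
move=> j; have dV := is_derive_comp qv (vf_in_tame ap oU (frame_vf_smooth j UF) Uq dp).1.
have d1 := is_derive_pairing dD dV.
have d0 : is_derive t (1 : R)
    (fun s => pairing (dual_in ch (F t) i (x s)) ((vf_in ch (frame_vf (F t) j) \o x) s) : R^o) 0.
  have := is_derive_cst ((i == j)%:R : R^o) t (1 : R); apply: near_eq_is_derive.
  have W : nbhs (q t) (U `&` cdom ch).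
    apply: filterI; apply: open_nbhs_nbhs; split=> //; exact: cdom_open.
  have W2 : \forall s \near t, U (q s) /\ cdom ch (q s) by exact: (curve_continuous (@qc) tab) _ W.
  move: W2; apply: filterS => s [Us cs]; apply/esym/pairing_dual_in.
  exact: frame_mx_det UF Us ap cs.
have := is_derive_unique d1 d0; rewrite /= /x vf_in_chart_at => /eqP.
by rewrite addr_eq0 => /eqP.
Qed.

Section lift.
Variables (lam0 : R -> E) (C : R -> R) (k : R).

(** In its use [lam0] vanishes on X1 and X2, so h1 = 0 and h2 = k, as the maximum condition with nu
    = -1 demands, whatever [C] is; this leaves [C] free for the Hamiltonian equation. *)
Definition normal_lift (s : R) : E := k *: dual_covector (F s) 1 (q s) + C s *: lam0 s.

Lemma normal_lift_local t : a <= t <= b -> exists2 e : R, 0 < e &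
  forall s, a <= s <= b -> `|s - t| < e ->
    ccoord (chart_at (q t)) (q s) (normal_lift s) =
    k *: dual_in (chart_at (q t)) (F t) 1 (cmap (chart_at (q t)) (q s)) +
    C s *: ccoord (chart_at (q t)) (q s) (lam0 s).
Proof.
move=> tab; have [U [e [oU Uq UF e0 H]]] := frame_along_local (@qc) (@Fq) tab.
exists e => // s sab se; have [Us cs Fs] := H s sab se.
have [V [_ [_ Vq VF _ _]]] := frame_along_local (@qc) (@Fq) sab.
rewrite ccoordD !ccoordZ (ccoord_dual_covector 1 VF Vq (chart_at_atlas (q t)) cs).
congr (_ *: _ + _); rewrite /dual_in.
suff -> : frame_mx (chart_at (q t)) (F s) (cmap (chart_at (q t)) (q s)) =
  frame_mx (chart_at (q t)) (F t) (cmap (chart_at (q t)) (q s)) by [].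
by apply/matrixP => i j; rewrite !mxE !(vf_inE _ cs) (nbhs_singleton Fs).
Qed.

Lemma normal_lift_lipschitz : (forall t, a <= t <= b -> segment_lipschitz a b t C) ->
  lipschitz_lift q lam0 a b -> lipschitz_lift q normal_lift a b.
Proof.
move=> CL [qL lamL]; split=> // t tI; apply/segment_lipschitzP.
have tab : a <= t <= b by move: tI; rewrite in_itv.
have [U [_ [oU Uq UF _ _]]] := frame_along_local (@qc) (@Fq) tab.
have ap := chart_at_atlas (q t); have dp := chart_at_dom (q t).
have [e e0 H] := normal_lift_local tab.
apply: segment_lipschitz_near_eq e0 H _; apply: segment_lipschitzD.
  apply: (segment_lipschitz_scale tab); first exact: segment_lipschitz_cst.
  apply: (segment_lipschitz_comp (f := fun s => cmap (chart_at (q t)) (q s)) tab).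
    exact: dual_in_lipschitz oU UF Uq ap dp.
  by apply/segment_lipschitzP; case: qL => _; exact.
apply: (segment_lipschitz_scale tab); first exact: CL.
by apply/segment_lipschitzP; exact: lamL.
Qed.

(** The terms proportional to [C] cancel because [lam0] solves the same linear equation; what
    remains, tested on the frame, is the hypothesis on [C']. The passage from [nu] to [nu'] is free
    since the equation is the same for both. *)
Lemma normal_lift_extremal u nu nu' t C' : a < t < b -> u t = (0, k) ->
  extremal_equation q lam0 F u nu t -> is_derive t (1 : R) C C' ->
  (forall i, C' * pairing (lam0 t) (frame_vf (F t) i (q t)) =
     k * k * coord (frame_at (F t) (q t)) 1
       (lie_bracket (frame_vf (F t) 1) (frame_vf (F t) i) (q t))) ->
  extremal_equation q normal_lift F u nu' t.
Proof.
move=> tab ut ext Cd C'E; have tabw := lt_itv_le tab.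
have [U [_ [oU Uq UF _ _]]] := frame_along_local (@qc) (@Fq) tabw.
have ap := chart_at_atlas (q t); have dp := chart_at_dom (q t).
have [qv [xi0 [xi0d xi0E]]] := extremal_equationE (@qc) (@Fq) tab ext.
rewrite ut /= scale0r add0r in qv; rewrite ut /= in xi0E.
have [D' [Dd DE]] := dual_in_curve_derive 1 tab qv.
pose ch := chart_at (q t); pose x s := cmap ch (q s).
have [e e0 H] := normal_lift_local tabw.
have CCd : is_derive t (1 : R) (C : R -> R^o) C' by exact: Cd.
have Ld := is_derive_scale CCd xi0d.
have kd := @is_deriveZ _ _ _ _ k _ _ _ Dd.
have xid := is_deriveD kd Ld.
set xi' := (d in is_derive _ _ _ d) in xid.
exists (k *: fX2 (F t) (q t), xi'); split.
  apply: is_derive_pair; first exact: qv.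
  move: xid; apply: near_eq_is_derive; apply/nbhs_ballP.
  exists (Num.min e (Num.min (t - a) (b - t))).
    by rewrite /= !lt_min e0 !subr_gt0.
  move=> s; rewrite /ball /= !lt_min distrC => /and3P[se sa sb]; rewrite [RHS]H//.
  by move: sa sb; rewrite !ltr_norml; lra.
have [[s1 s2 _ _] _] := UF.
have V1d := (vf_in_tame ap oU s1 Uq dp).1.
have V2d := (vf_in_tame ap oU s2 Uq dp).1.
apply/(hamiltonian_vectorP (u t) nu' _ _ _ V1d V2d).
rewrite ut /= scale0r add0r vf_in_chart_at; split=> // w.
rewrite mul0r add0r ccoord_chart_at.
have [eta etaE] := pairing_differential (vf_in ch (fX2 (F t))) (x t) (normal_lift t).
have [eta0 eta0E] := pairing_differential (vf_in ch (fX2 (F t))) (x t) (lam0 t).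
have [eta1 eta1E] := pairing_differential (vf_in ch (fX2 (F t))) (x t)
  (dual_covector (F t) 1 (q t)).
rewrite -etaE -mulNr -pairingZl; congr (pairing _ _) => {w}.
have xi0_eta : xi0 = - k *: eta0.
  by apply: pairing_ext => w; rewrite xi0E pairingZl eta0E mul0r add0r mulNr.
have eta_eta : eta = k *: eta1 + C t *: eta0.
  by apply: pairing_ext => w; rewrite etaE !pairingDl !pairingZl eta1E eta0E.
apply: (pairing_frame_eq UF Uq) => i.
rewrite /xi' xi0_eta eta_eta ccoord_chart_at !pairingDl !pairingZl DE C'E.
rewrite !pairingDl !pairingZl eta1E -(pairing_dual_covector _ _ UF Uq) lie_bracketE.
rewrite frame_vf1; apply: pairing_lift_identity.
exact: linearZZ ('d (vf_in ch (frame_vf (F t) i)) (x t)) k (fX2 (F t) (q t)).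
Qed.

End lift.
End normal_lift.

(** * Abnormal geodesics and their normal lifts *)

Section main.
Context {R : realType} {M : manifold4 R} (S : engel_structure M).
Local Notation mu := (@lebesgue_measure R).

Lemma T4_0_normal (a b k : R) (q : R -> M) (F : R -> frame4 M) (u : R -> R * R) lam0 :
  a < b -> admissible S q a b F u -> pmp q a b F u lam0 0 ->
  (forall t, t \in `[a, b] -> [/\ frame_pairing q F lam0 0 t = 0,
     frame_pairing q F lam0 1 t = 0, frame_pairing q F lam0 2 t = 0 &
     frame_pairing q F lam0 3 t != 0]) ->
  {ae mu, forall t, t \in `]a, b[ -> u t = (0, k)} ->
  (forall t, t \in `[a, b] -> T4 (F t) (q t) = 0) -> normal q a b F u.
Proof.
move=> ab qad pm0 h0 u_k T40; have [lamL _ _ ext0 _] := pm0.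
have [[qc _] Fq _ _ _] := qad.
pose a2 s := coord (frame_at (F s) (q s)) 1
  (lie_bracket (frame_vf (F s) 1) (frame_vf (F s) 3) (q s)).
pose h3 := frame_pairing q F lam0 3.
(* The ODE that the X4-component of the extremal equation imposes on the coefficient [C]. *)
pose g s := k * k * a2 s / h3 s.
have gc : {within [set` `[a, b]], continuous g}.
  have a2c := @bracket_coord_continuous _ _ S a b q F qc Fq 1 3 1.
  have h3c := @frame_pairing_continuous _ _ S a b q F qc Fq lam0 3 lamL.
  apply/subspace_continuousP => t tI.
  have FG : Filter (within [set` `[a, b]] (nbhs t)) by exact: within_filter.
  have a2t := (subspace_continuousP _ _).1 a2c t tI.
  have h3t := (subspace_continuousP _ _).1 h3c t tI.
  apply: (@cvgM _ _ _ FG); first by apply: cvgMr; exact: a2t.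
  by apply: cvgV; [have [] := h0 t tI | exact: h3t].
have [C CP] := antiderivative_segment (ltW ab) gc.
exists (normal_lift q F lam0 C k), (-1); split; first by rewrite ltrN10.
split.
- by apply: (@normal_lift_lipschitz _ _ S a b q F qc Fq) => // t /CP[].
- by rewrite ltW ?ltrN10.
- by move=> t _; rewrite xpair_eqE oppr_eq0 oner_eq0 andbF.
- apply: (ae_imp (ae_and ext0 u_k)) => t [ext_t ut] tI.
  have tab : a < t < b by move: tI; rewrite in_itv.
  have tI' : t \in `[a, b] by rewrite in_itv; exact: lt_itv_le.
  have [U [_ [oU Uq UF _ _]]] := @frame_along_local _ _ S a b q F qc Fq t (lt_itv_le tab).
  have [Cd _] := CP t (lt_itv_le tab); have [h00 h01 h02 h03] := h0 t tI'.
  apply: (@normal_lift_extremal _ _ S a b q F qc Fq _ _ _ _ _ _ _ _ tab (ut tI) (ext_t tI) Cd).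
  (* In the order X1, X2, X3, X4: [X2, X1] = - X3 has no X2-component, [X2, X2] = 0, the
     X2-component of [X2, X3] is T4 = 0, and the last equation is the choice of [g]. *)
  apply: ord4P; rewrite -/(frame_pairing q F lam0 _ t).
  + rewrite h00 mulr0 frame_vf0 frame_vf1 lie_bracketC (bracket12 qad tab) linearN /=.
    by rewrite -frame_vf2 (coord_frame_vf _ _ UF Uq) oppr0 mulr0.
  + by rewrite h01 mulr0 lie_bracketXX linear0 mulr0.
  + by rewrite h02 mulr0 frame_vf1 frame_vf2 -/(T4 (F t) (q t)) T40// mulr0.
  + by rewrite /g /a2 -/h3 divfK.
- apply: (ae_imp u_k) => t ut tI w.
  have tab : a < t < b by move: tI; rewrite in_itv.
  have tI' : t \in `[a, b] by rewrite in_itv; exact: lt_itv_le.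
  have [U [_ [oU Uq UF _ _]]] := @frame_along_local _ _ S a b q F qc Fq t (lt_itv_le tab).
  have [h00 h01 _ _] := h0 t tI'.
  have H0 : pairing (normal_lift q F lam0 C k t) (fX1 (F t) (q t)) = 0.
    rewrite pairingDl !pairingZl (pairing_dual_covector _ _ UF Uq) -frame_vf0.
    by rewrite (coord_frame_vf _ _ UF Uq) -/(frame_pairing q F lam0 0 t) h00 !mulr0 addr0.
  have H1 : pairing (normal_lift q F lam0 C k t) (fX2 (F t) (q t)) = k.
    rewrite pairingDl !pairingZl (pairing_dual_covector _ _ UF Uq) -frame_vf1.
    by rewrite (coord_frame_vf _ _ UF Uq) -/(frame_pairing q F lam0 1 t) h01 mulr1 mulr0 addr0.
  rewrite /hamiltonian /pmp_hamiltonian H0 H1 (ut tI) /=.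
  (* The maximum exceeds the value at [w] by half of [w.1 ^+ 2 + (w.2 - k) ^+ 2]. *)
  have := sqr_ge0 (w.2 - k); have := sqr_ge0 w.1; nra.
Qed.

End main.

Theorem theorem4 (R : realType) (M : manifold4 R) (S : engel_structure M)
    (a b : R) (q : R -> M) (F : R -> frame4 M) (u : R -> R * R)
    (q_geodesic : geodesic S q a b F u)
    (q_nonconstant : nonconstant q a b)
    (q_abnormal : abnormal q a b F u) :
  integral_curve_X2_upto_speed q a b F /\
  (strictly_abnormal q a b F u <->
   exists t : R, t \in `[a, b] /\ T4 (F t) (q t) != 0).
Proof.
have [ab qad [c u_c] [e e0 qmin]] := q_geodesic.
have c0 := nonconstant_speed_gt0 ab qad u_c q_nonconstant.
have [lam0 pm0] := q_abnormal.
have [h0 u1_0] := abnormal_pairings ab qad u_c (lt0r_neq0 c0) pm0.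
have [k [k0 _ vel]] := constant_velocity ab qad u_c c0 e0 qmin u1_0.
have u_k := control_eq qad u1_0 vel.
have qc : {within [set` `[a, b]], continuous q} by case: qad => -[].
split; first exact: (integral_curve_of_velocity ab k0 (@qc) vel).
split=> [[_ not_normal]|[t [tI T4t]]].
  apply: contrapT => noT4; apply: not_normal.
  apply: (T4_0_normal ab qad pm0 h0 u_k) => t tI; apply/eqP/negPn/negP => T4t.
  by apply: noT4; exists t.
split=> // -[lam [nu [nu0 pm]]]; case/eqP: T4t.
exact: (normal_T4 ab qad u1_0 k0 vel nu0 pm).
Qed.
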